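(* Let $d\geq 2$. Let $A,N,\Xi,e_v$ be positive numbers, $L\geq 1$ a positive integer, and let $v_\epsilon=(v_\epsilon^1,\ldots,v_\epsilon^d)$ be a vector field on $\mathbb{R}\times\mathbb{R}^d$ such that $$\|\nabla^\beta v_\epsilon\|_{C^0_{t,x}}\leq A\,\Xi^{|\beta|}e_v^{1/2},\qquad 1\leq|\beta|\leq L.$$ Furthermore, let $U=(U^\ell)$ be a vector field on $\mathbb{R}\times\mathbb{R}^d$ with zero linear and angular momenta, i.e. $$\int U^\ell(t,x)\,dx=0,\qquad \int (x^jU^\ell-x^\ell U^j)(t,x)\,dx=0$$ for all $t$ and all $j,\ell$, and such that $$\operatorname{supp}U\subseteq\hat{C}_{v_\epsilon}(\bar\tau,\bar\rho;t(I),x(I))$$ for some $(t(I),x(I))\in\mathbb{R}\times\mathbb{R}^d$, $\bar\rho>0$ and $0<\bar\tau\leq\Xi^{-1}e_v^{-1/2}$. Assume also that for some $\Lambda>0$ and $0<\hat\tau\leq\Xi^{-1}e_v^{-1/2}$ the vector field $U$ obeys the estimates $$\|\nabla^\beta U\|_{C^0_{t,x}}\leq A\Lambda^{|\beta|},\quad |\beta|=0,\ldots,L,$$ $$\|\nabla^\beta(\partial_t+v_\epsilon\cdot\nabla)U\|_{C^0_{t,x}}\leq A\hat\tau^{-1}\Lambda^{|\beta|},\quad|\beta|=0,\ldots,L-1.$$ Then there exists a symmetric tensor field $R^{j\ell}[U]=R^{\ell j}[U]$, depending linearly on $U$, solving the symmetric divergence equation $$\partial_jR^{j\ell}[U]=U^\ell,$$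 with the following properties: 1. $\operatorname{supp}R^{j\ell}[U]\subseteq\hat{C}_{v_\epsilon}(\bar\tau,\bar\rho;t(I),x(I))$. 2. There exists $C>0$ such that for $|\beta|=0,\ldots,L$, $$\|\nabla^\beta R^{j\ell}[U]\|_{C^0_{t,x}}\leq C A\bar\rho\sum_{m=0}^{|\beta|}\bar\rho^{-(|\beta|-m)}\Lambda^m.$$ 3. There exists $C>0$ such that for $|\beta|=0,\ldots,L-1$, $$\|\nabla^\beta(\partial_t+v_\epsilon\cdot\nabla)R^{j\ell}[U]\|_{C^0_{t,x}}\leq CA\hat\tau^{-1}\bar\rho\sum_{m_0+m_1+m_2=|\beta|}\Xi^{m_0}\bar\rho^{-m_1}\Lambda^{m_2},$$ where the sum is over all triplets of non-negative integers $(m_0,m_1,m_2)$ with $m_0+m_1+m_2=|\beta|$.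
   Context: $\nabla$ denotes derivatives in the spatial variables only and $\beta$ is a spatial multi-index; $C^0_{t,x}$ is the sup norm over $\mathbb{R}\times\mathbb{R}^d$; repeated indices are summed. For a vector field $v$ (continuous in $(t,x)$, with bounded spatial gradient), its flow $\Phi_s(t,x)=(t+s,\Phi'_s(t,x))$ is the flow of the space-time vector field $\partial_t+v\cdot\nabla$, i.e. $\partial_s\Phi'_s(t,x)=v(\Phi_s(t,x))$, $\Phi_0'(t,x)=x$. The $v$-adapted Eulerian cylinder of duration $2\tau$ and base radius $\rho$ centered at $(t_0,x_0)$ is $\hat C_v(\tau,\rho;t_0,x_0)=\{\Phi_s(t_0,x_0)+(0,h): |s|\leq\tau,\ |h|\leq\rho\}$. *)

(* Defs.v *)
From HB Require Import structures.
From mathcomp Require Import all_boot all_order all_algebra.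
From mathcomp Require Import all_classical all_reals all_analysis.

Set Implicit Arguments.
Unset Strict Implicit.
Unset Printing Implicit Defensive.

Import Order.TTheory GRing.Theory Num.Theory.
Import numFieldNormedType.Exports.

Local Open Scope classical_set_scope.
Local Open Scope ring_scope.

Definition spacetime (R : realType) (d : nat) := (R * 'rV[R]_d)%type.

Definition vfield (R : realType) (d : nat) := spacetime R d -> 'rV[R]_d.

Definition tfield (R : realType) (d : nat) := spacetime R d -> 'M[R]_d.

(* The library norm on 'rV is the sup norm; this is the Euclidean one. *)
Definition enorm (R : realType) (d : nat) (h : 'rV[R]_d) : R :=
  Num.sqrt (\sum_(i < d) h 0 i ^+ 2).

Definition pdt (R : realType) (d : nat) (f : spacetime R d -> R)
    (p : spacetime R d) : R :=
  'D_((1 : R, 0 : 'rV[R]_d)) (f : R * 'rV[R]_d -> R) p.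

Definition pdx (R : realType) (d : nat) (i : 'I_d) (f : spacetime R d -> R)
    (p : spacetime R d) : R :=
  'D_((0 : R, delta_mx 0 i : 'rV[R]_d)) (f : R * 'rV[R]_d -> R) p.

Definition mlen (d : nat) (b : {ffun 'I_d -> nat}) : nat :=
  (\sum_(i < d) b i)%N.

Definition nabla (R : realType) (d : nat) (b : {ffun 'I_d -> nat})
    (f : spacetime R d -> R) : spacetime R d -> R :=
  foldr (fun i g => iter (b i) (pdx i) g) f (enum 'I_d).

Definition vcomp (R : realType) (d : nat) (V : vfield R d) (l : 'I_d) :
    spacetime R d -> R := fun p => V p 0 l.

Definition tcomp (R : realType) (d : nat) (T : tfield R d) (j l : 'I_d) :
    spacetime R d -> R := fun p => T p j l.

Definition vnabla (R : realType) (d : nat) (b : {ffun 'I_d -> nat})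
    (V : vfield R d) : vfield R d :=
  fun p => \row_l nabla b (vcomp V l) p.

Definition Dt (R : realType) (d : nat) (v : vfield R d)
    (f : spacetime R d -> R) : spacetime R d -> R :=
  fun p => pdt f p + \sum_(i < d) v p 0 i * pdx i f p.

Definition vDt (R : realType) (d : nat) (v : vfield R d) (V : vfield R d) :
    vfield R d :=
  fun p => \row_l Dt v (vcomp V l) p.

Definition C0norm (R : realType) (d : nat) (f : spacetime R d -> R) : \bar R :=
  ereal_sup [set `|f p|%:E | p in [set: spacetime R d]].

Definition vC0norm (R : realType) (d : nat) (V : vfield R d) : \bar R :=
  ereal_sup [set (enorm (V p))%:E | p in [set: spacetime R d]].

(* All spatial derivatives of order <= k exist and are continuous in (t, x).
   As 'D takes a junk value where the limit does not exist, norms of derivatives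
   are meaningful only together with such a condition. *)
Fixpoint spatialC (R : realType) (d : nat) (k : nat)
    (f : spacetime R d -> R) {struct k} : Prop :=
  continuous (f : R * 'rV[R]_d -> R) /\
  match k with
  | 0 => True
  | k'.+1 => forall i : 'I_d,
      (forall p, derivable (f : R * 'rV[R]_d -> R) p
                   (0 : R, delta_mx 0 i : 'rV[R]_d)) /\
      spatialC k' (pdx i f)
  end.

(* The regularity implicit in bounds on nabla^b f for |b| <= L and on
   nabla^b (d_t + v . nabla) f for |b| <= L - 1. *)
Definition advectedC (R : realType) (d : nat) (v : vfield R d) (L : nat)
    (f : spacetime R d -> R) : Prop :=
  [/\ spatialC L f,
      forall p, derivable (f : R * 'rV[R]_d -> R) p (1 : R, 0 : 'rV[R]_d) &
      spatialC L.-1 (Dt v f)].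

(* Lebesgue integral over R^n as an iterated one-dimensional integral; it is
   used only on continuous functions of compact support. *)
Fixpoint integral_rV (R : realType) (n : nat) : ('rV[R]_n -> R) -> R :=
  match n with
  | 0 => fun f => f 0
  | n'.+1 => fun f =>
      Rintegral (@lebesgue_measure R) setT
        (fun y : R => integral_rV
           (fun z : 'rV[R]_n' => f (row_mx (y%:M : 'rV[R]_1) z)))
  end.

Definition zero_linear_momentum (R : realType) (d : nat) (U : vfield R d) :=
  forall (t : R) (l : 'I_d), integral_rV (fun x => U (t, x) 0 l) = 0.

Definition zero_angular_momentum (R : realType) (d : nat) (U : vfield R d) :=
  forall (t : R) (j l : 'I_d),
    integral_rV (fun x => x 0 j * U (t, x) 0 l - x 0 l * U (t, x) 0 j) = 0.

(* Phi s p is the point Phi_s(p) = (t + s, Phi'_s(p)), for p = (t, x). *)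
Definition is_flow (R : realType) (d : nat) (v : vfield R d)
    (Phi : R -> spacetime R d -> spacetime R d) : Prop :=
  forall p : spacetime R d,
    Phi 0 p = p /\
    forall s : R, (Phi s p).1 = p.1 + s /\
      is_derive s (1 : R) (fun r : R => (Phi r p).2) (v (Phi s p)).

(* If v is continuous in (t, x) with bounded spatial gradient, the flow exists
   and is unique (Cauchy-Lipschitz), so the quantifier on Phi only names it. *)
Definition flow_cylinder (R : realType) (d : nat) (v : vfield R d)
    (tau rho : R) (p0 : spacetime R d) : set (R * 'rV[R]_d) :=
  [set p | exists Phi, is_flow v Phi /\
     exists (s : R) (h : 'rV[R]_d),
       [/\ `|s| <= tau, enorm h <= rho &
           p = ((Phi s p0).1, (Phi s p0).2 + h)]].

Definition supp (R : realType) (d : nat) (W : zmodType)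
    (F : spacetime R d -> W) : set (R * 'rV[R]_d) :=
  closure [set p : R * 'rV[R]_d | F p != 0].

(* The linear space of sources U on which R[U] is defined. *)
Definition admissible_source (R : realType) (d : nat) (v : vfield R d)
    (L : nat) (tau rho : R) (p0 : spacetime R d) (U : vfield R d) : Prop :=
  [/\ forall l : 'I_d, advectedC v L (vcomp U l),
      zero_linear_momentum U,
      zero_angular_momentum U &
      supp U `<=` flow_cylinder v tau rho p0].

Definition linear_on (R : realType) (d : nat) (P : vfield R d -> Prop)
    (op : vfield R d -> tfield R d) : Prop :=
  forall (a : R) (U W : vfield R d), P U -> P W ->
    forall p, op (fun q => a *: U q + W q) p = a *: op U p + op W p.

(* Main.v *)
Require Import Defs.
From HB Require Import structures.
From mathcomp Require Import all_boot all_order all_algebra.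
From mathcomp Require Import all_classical all_reals all_analysis.
From mathcomp Require Import ring lra.

Set Implicit Arguments.
Unset Strict Implicit.
Unset Printing Implicit Defensive.

Import Order.TTheory GRing.Theory Num.Theory.
Import numFieldNormedType.Exports.

Local Open Scope classical_set_scope.
Local Open Scope ring_scope.

(** Let [X(t)] be the trajectory through the centre of the cylinder and let [phi]
    be a bump of unit mass at scale [rho] moving along [X], supported in the
    cylinder.  Sources at [x - s rho q] are transported along segments to points
    [x + (1-s) rho q] distributed according to [phi]:
      R^{jk}(x) = - rho^2 int_0^1 int q_j q_k U^l(x - s rho q)
                                     d_l phi(x + (1-s) rho q) dq ds
                  - rho int q_j U^k(x - rho q) phi(x) dq.
    In the divergence, [rho q_j d_j] acting on the integrand is [- d/ds], so only
    the endpoints of the segments remain; there the zero linear momentum and the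
    mass of [phi] produce [U], and the zero angular momentum makes [R] symmetric.
    The segments stay in the (convex) slices of the cylinder, whence the support.

    The advective derivative of [R] contains [(v^i(x) - v^i(a)) d_i U(a)] with
    [a = x - s rho q], whose derivative of [U] would lose a factor [Lam]; as
    [d_i U(a)] is [- (s rho)^-1 d/dq_i] of [U(a)], an integration by parts in
    [q_i] leaves only the difference quotient of [v], bounded by its gradient.

    Cauchy-Lipschitz existence is not needed: if [v] has no flow, the cylinder is
    empty, [U = 0] and [R = 0] works. *)

(** * Integrals over segments and boxes *)

(** The bump must move because [v] itself is not bounded: with a fixed centre, [d_t + v . grad] of
    the bump would cost [|v| / rho]. Riding on [X] turns it into [(v(x) - v(t, X(t))) . grad phi],
    of size [rho |grad v|] times [1 / rho].

    The integration by parts is singular at [s = 0]: its terms carry [(s rho)^-1] and need not be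
    jointly continuous there. Regularity in all variables is therefore read off the kernel before
    the integration by parts, and size off the kernel after it, at each fixed [s] in []0, 1]].

    The zero angular momentum acts twice: besides the symmetry, it cancels the endpoint [s = 1] of
    the segments against the divergence of the second term of [R].

    The number 3: if both endpoints of a segment are within [rho] of [X(t)] in each coordinate, then
    [|q_i| <= 2], so all integrands vanish on the faces of [[-3, 3]^d]. On this fixed box iterated
    one-dimensional integrals of continuous functions suffice.

    Bounds are kept as an amplitude and a rate per derivative; a rate such as [Lam + d / rho] is
    unfolded into the sums of the statement only at the end. *)

Lemma continuous_pair (S T U : topologicalType) (f : S -> T) (g : S -> U) :
  continuous f -> continuous g -> continuous (fun x => (f x, g x)).
Proof. by move=> cf cg x; have := cvg_pair (cf x) (cg x); exact. Qed.

Lemma continuous_comp2 (S T U : topologicalType) (f : S -> T) (g : T -> U) :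
  continuous f -> continuous g -> continuous (fun x => g (f x)).
Proof. by move=> cf cg x; exact: (continuous_comp (cf x) (cg (f x))). Qed.

Lemma cont_fst (S T : topologicalType) : continuous (fun x : S * T => x.1).
Proof. by move=> x; exact: cvg_fst. Qed.

Lemma cont_snd (S T : topologicalType) : continuous (fun x : S * T => x.2).
Proof. by move=> x; exact: cvg_snd. Qed.

Lemma cont_id (S : topologicalType) : continuous (fun x : S => x).
Proof. by move=> x; exact: cvg_id. Qed.

Section RealContinuity.
Context {R : realType} {S : topologicalType}.
Implicit Types f g : S -> R.

Lemma contD f g : continuous f -> continuous g -> continuous (fun x => f x + g x).
Proof. by move=> cf cg x; apply: cvgD; [exact: cf|exact: cg]. Qed.

Lemma contM f g : continuous f -> continuous g -> continuous (fun x => f x * g x).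
Proof. by move=> cf cg x; apply: cvgM; [exact: cf|exact: cg]. Qed.

Lemma contN f : continuous f -> continuous (fun x => - f x).
Proof. by move=> cf x; apply: cvgN; exact: cf. Qed.

Lemma contZ (k : R) f : continuous f -> continuous (fun x => k * f x).
Proof. by move=> cf x; apply: cvgM; [exact: cvg_cst|exact: cf]. Qed.

Lemma cont_sum (I : Type) (s : seq I) (f : I -> S -> R) :
  (forall i, continuous (f i)) -> continuous (fun x => \sum_(i <- s) f i x).
Proof.
move=> cf; elim: s => [|i s IH].
  under [fun x => _]eq_fun do rewrite big_nil.
  exact: cst_continuous.
under [fun x => _]eq_fun do rewrite big_cons.
exact: contD.
Qed.

Lemma cont_prod (I : Type) (s : seq I) (f : I -> S -> R) :
  (forall i, continuous (f i)) -> continuous (fun x => \prod_(i <- s) f i x).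
Proof.
move=> cf; elim: s => [|i s IH].
  under [fun x => _]eq_fun do rewrite big_nil.
  exact: cst_continuous.
under [fun x => _]eq_fun do rewrite big_cons.
exact: contM.
Qed.

End RealContinuity.

Section VectorContinuity.
Context {R : realType} {S : topologicalType} {V : normedModType R}.

Lemma contVD (f g : S -> V) :
  continuous f -> continuous g -> continuous (fun x => f x + g x).
Proof. by move=> cf cg x; apply: cvgD; [exact: cf|exact: cg]. Qed.

Lemma contVZ (k : S -> R) (f : S -> V) :
  continuous k -> continuous f -> continuous (fun x => k x *: f x).
Proof. by move=> ck cf x; apply: cvgZ; [exact: ck|exact: cf]. Qed.

End VectorContinuity.

(** A derivative along [v] is a limit in one scalar, so it passes to the line through [p] without
    differentiability of [f] as a map, which [spatialC] does not provide. *)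
Lemma is_derive_line (R : realType) (V : normedModType R) (f : V -> R)
    (p v : V) (u l : R) :
  is_derive (u *: v + p) v f l ->
  is_derive u (1 : R) (fun r : R => f (r *: v + p)) l.
Proof.
have E : (fun h : R => h^-1 *: (((fun r : R => f (r *: v + p)) \o shift u) (h *: (1 : R))
      - f (u *: v + p))) =
    (fun h : R => h^-1 *: ((f \o shift (u *: v + p)) (h *: v) - f (u *: v + p))).
  apply/funext => h /=; congr (_ *: (f _ - _)).
  by rewrite [_ *: 1]mulr1 scalerDl addrA.
by case=> d1 d2; split; rewrite /derivable /derive E.
Qed.

Lemma is_derive_line_at0 (R : realType) (V : normedModType R) (f : V -> R)
    (p v : V) (l : R) :
  is_derive (0 : R) (1 : R) (fun r : R => f (r *: v + p)) l ->
  is_derive p v f l.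
Proof.
have E : (fun h : R => h^-1 *: (((fun r : R => f (r *: v + p)) \o shift 0) (h *: (1 : R))
      - f (0 *: v + p))) =
    (fun h : R => h^-1 *: ((f \o shift p) (h *: v) - f p)).
  apply/funext => h /=; congr (_ *: (f _ - f _)).
    by rewrite [_ *: 1]mulr1 addr0.
  by rewrite scale0r add0r.
by case=> d1 d2; split; rewrite /derivable /derive -?E.
Qed.

Lemma is_derive_translate (R : realType) (V W : normedModType R) (f : V -> W)
    (c p v : V) (l : W) :
  is_derive (p + c) v f l -> is_derive p v (fun x => f (x + c)) l.
Proof.
have E : (fun h : R => h^-1 *: (((fun x => f (x + c)) \o shift p) (h *: v)
      - f (p + c))) =
    (fun h : R => h^-1 *: ((f \o shift (p + c)) (h *: v) - f (p + c))).
  by apply/funext => h /=; rewrite addrA.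
by case=> d1 d2; split; rewrite /derivable /derive E.
Qed.

(** Locating the intermediate point by its distance to [a] gives one form for both orders of the
    endpoints, as difference quotients with [h] of either sign require. *)
Lemma mvt_real (R : realType) (g dg : R -> R) :
  (forall u, is_derive u (1 : R) g (dg u)) ->
  forall a b, exists2 c, `|c - a| <= `|b - a| & g b - g a = dg c * (b - a).
Proof.
move=> gd.
have gc : continuous g.
  by move=> x; apply/differentiable_continuous/derivable1_diffP; case: (gd x).
move=> a b; have [ab|/ltW ba] := leP a b.
  have [c] := MVT_segment ab (fun x _ => gd x) (continuous_subspaceT gc).
  rewrite in_itv /= => /andP[ac cb] E; exists c => //.
  by rewrite !ger0_norm ?subr_ge0// lerD2r.
have [c] := MVT_segment ba (fun x _ => gd x) (continuous_subspaceT gc).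
rewrite in_itv /= => /andP[bc ca] E; exists c.
  by rewrite !ler0_norm ?subr_le0// lerN2 lerD2r.
by rewrite -opprB E -mulrN opprB.
Qed.

Lemma mvt_line (R : realType) (V : normedModType R) (f df : V -> R) (p v : V) (h : R) :
  (forall q, is_derive q v f (df q)) ->
  exists2 c : R, `|c| <= `|h| & f (h *: v + p) - f p = h * df (c *: v + p).
Proof.
move=> fd; pose g (r : R) := f (r *: v + p).
have gd (u : R) : is_derive u (1 : R) g (df (u *: v + p)) by apply: is_derive_line.
have [c ch E] := mvt_real gd 0 h.
exists c; first by rewrite !subr0 in ch.
by move: E; rewrite /g scale0r add0r subr0 => ->; rewrite mulrC.
Qed.

(** * Integrals over a segment and the fundamental theorem of calculus *)

Section Integral.
Context {R : realType}.
Notation mu := (@lebesgue_measure R).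

Definition int1 (a b : R) (f : R -> R) : R :=
  \int[mu]_(x in `[a, b]) f x.

Implicit Types (f g : R -> R) (a b : R).

Lemma cont_integrable a b f : continuous f ->
  mu.-integrable `[a, b] (EFin \o f).
Proof.
move=> cf; apply: continuous_compact_integrable; first exact: segment_compact.
exact: continuous_subspaceT.
Qed.

Lemma eq_int1 a b f g : (forall x, a <= x <= b -> f x = g x) ->
  int1 a b f = int1 a b g.
Proof.
move=> fg; apply: eq_Rintegral => x; rewrite inE /= in_itv /=; exact: fg.
Qed.

Lemma int1D a b f g : continuous f -> continuous g ->
  int1 a b (fun x => f x + g x) = int1 a b f + int1 a b g.
Proof. by move=> cf cg; apply: RintegralD => //; apply: cont_integrable. Qed.

Lemma int1Z a b (k : R) f : continuous f ->
  int1 a b (fun x => k * f x) = k * int1 a b f.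
Proof. by move=> cf; apply: RintegralZl => //; apply: cont_integrable. Qed.

Lemma int1_cst a b (k : R) : a <= b -> int1 a b (fun=> k) = k * (b - a).
Proof.
move=> ab; rewrite /int1 Rintegral_cst//= lebesgue_measure_itv /= lte_fin.
by case: ltgtP ab => // -> _; rewrite subrr mulr0.
Qed.

Lemma int1_norm_le a b f (M : R) : a <= b -> continuous f ->
  (forall x, a <= x <= b -> `|f x| <= M) -> `|int1 a b f| <= M * (b - a).
Proof.
move=> ab cf fM; have I := @cont_integrable a b f cf.
apply: le_trans; first exact: le_normr_Rintegral.
have J : mu.-integrable `[a, b] (EFin \o (fun=> M)).
  by apply: cont_integrable; exact: cst_continuous.
rewrite -(int1_cst M ab); apply: le_Rintegral => //.
exact: (integrable_abse I).
Qed.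

(** Continuity carries the bound to the left endpoint. Integrands in [s] are estimated only for
    [0 < s <= 1], since the integration by parts divides by [s]. *)
Lemma int1_norm_le_oc a b f (M : R) : a <= b -> continuous f ->
  (forall x, a < x <= b -> `|f x| <= M) -> `|int1 a b f| <= M * (b - a).
Proof.
rewrite le_eqVlt => /predU1P[<- cf _|ab cf fM].
  have := @int1_norm_le a a f (`|f a|) (lexx a) cf; rewrite subrr !mulr0.
  by apply=> x; rewrite -eq_le => /eqP ->.
apply: int1_norm_le => //; first exact: ltW.
move=> x; case/andP; rewrite le_eqVlt => /predU1P[<- _|ax xb]; last first.
  by apply: fM; rewrite ax.
rewrite leNgt; apply/negP => Mf.
have : \forall y \near a, M < `|f y|.
  have cn : continuous (fun y => `|f y|).
    by move=> y; apply: (continuous_comp (cf y)); apply: norm_continuous.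
  exact: (cvgr_gt _ (cn a)).
move=> /nbhs_ballP[e /= e0 H].
(* A point of []a, b]] so close to [a] that [|f|] still exceeds [M] there. *)
pose y := a + Num.min (e / 2) (b - a).
have m0 : 0 < Num.min (e / 2) (b - a) by rewrite lt_min divr_gt0// subr_gt0.
have /H : ball a e y.
  rewrite /ball /= /y opprD addrA subrr add0r normrN gtr0_norm//.
  by rewrite gt_min ltr_pdivrMr// ltr_pMr// ltr1n.
apply/negP; rewrite -leNgt; apply: fM.
by rewrite /y ltrDl m0 -lerBrDl ge_min lexx orbT.
Qed.

Lemma FTC_int1 a b f F : a <= b -> continuous f ->
  (forall x, a <= x <= b -> is_derive x 1 F (f x)) ->
  int1 a b f = F b - F a.
Proof.
rewrite le_eqVlt => /predU1P[<- _ _|ab cf dF].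
  by rewrite subrr /int1 set_itv1 Rintegral_set1.
have cF (x : R) : a <= x <= b -> {for x, continuous F}.
  by move=> /dF[d _]; apply/differentiable_continuous/derivable1_diffP.
rewrite /int1 /Rintegral (@continuous_FTC2 _ f F)//.
- exact: continuous_subspaceT.
- split.
  + by move=> x; rewrite in_itv/= => /andP[/ltW ax /ltW xb]; case: (dF x) => //; apply/andP.
  + by apply: cvg_at_right_filter; apply: cF; rewrite lexx ltW.
  + by apply: cvg_at_left_filter; apply: cF; rewrite lexx ltW.
- move=> x; rewrite in_itv/= => /andP[/ltW ax /ltW xb].
  by rewrite derive1E; case: (dF x) => //; apply/andP.
Qed.

Lemma primitive_exists a b f : a <= b -> continuous f ->
  exists F, forall x, a <= x <= b -> is_derive x 1 F (f x).
Proof.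
(* Starting the primitive at [a - 1] makes [a] an interior point, so the derivative is two-sided at
   both ends of the segment. *)
move=> ab cf; exists (fun x => \int[mu]_(t in `[a - 1, x]) f t) => x /andP[ax xb].
have xb1 : x < b + 1 by rewrite (le_lt_trans xb)// ltrDl.
have ax1 : a - 1 < x by rewrite (lt_le_trans _ ax)// gtrBl.
have [d e] := @continuous_FTC1_closed _ f (a - 1) x (b + 1) xb1
   (@cont_integrable _ _ _ cf) ax1 (cf x).
by split => //; rewrite -derive1E.
Qed.

End Integral.

(** * Continuity and differentiation under the integral sign *)

Section Parametric.
Context {R : realType}.

(** Compactness of the segment makes the continuity in [t] uniform in [y]. The parameter space is
    any topological space, so that several parameters can be bundled in a product. *)
Lemma near_uniform_segment (T : topologicalType) (F : T * R -> R) (a b : R) (t0 : T) (e : R) :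
  continuous F -> 0 < e ->
  \forall t \near t0, forall y, a <= y <= b -> `|F (t, y) - F (t0, y)| < e.
Proof.
move=> cF e0.
have /compact_near_coveringP := @segment_compact R a b.
move=> /(_ T (nbhs t0) (fun t y => `|F (t, y) - F (t0, y)| < e) _) H.
have : \forall t \near t0, `[a, b] `<=` (fun y => `|F (t, y) - F (t0, y)| < e).
  apply: H => y _.
  have e2 : 0 < e / 2 by rewrite divr_gt0.
  have := cF (t0, y) => /cvgrPdist_lt /(_ _ e2)[[U W]] /= [Ut Wy] UW.
  exists (W, U) => //= -[y' t'] /= [Wy' Ut'].
  have A := UW (t', y') (conj Ut' Wy').
  have B := UW (t0, y') (conj (nbhs_singleton Ut) Wy').
  rewrite -(subrKA (F (t0, y))) (le_lt_trans (ler_normD _ _))//.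
  by rewrite [ltRHS]splitr ltrD// distrC.
apply: filterS => t At y yab; apply: At => /=.
by rewrite in_itv.
Qed.

Lemma continuous_pair2 (T : topologicalType) (F : T * R -> R) (t : T) :
  continuous F -> continuous (fun y => F (t, y)).
Proof.
move=> cF; apply: (continuous_comp2 (f := fun y => (t, y))) => //.
by apply: continuous_pair; [exact: cst_continuous|exact: cont_id].
Qed.

Lemma int1_continuous (T : topologicalType) (F : T * R -> R) (a b : R) :
  a <= b -> continuous F -> continuous (fun t => int1 a b (fun y => F (t, y))).
Proof.
move=> ab cF t0; apply/cvgrPdist_le => e e0.
(* The [+ 1] keeps the denominator positive when [a = b]. *)
have ba1 : 0 < b - a + 1 by rewrite ltr_wpDl// subr_ge0.
have e1 : 0 < e / (b - a + 1) by rewrite divr_gt0.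
near=> t.
have H : forall y, a <= y <= b -> `|F (t, y) - F (t0, y)| < e / (b - a + 1).
  by near: t; apply: near_uniform_segment.
have c1 := continuous_pair2 (t := t) cF; have c0 := continuous_pair2 (t := t0) cF.
have cN := contZ (k := -1) c1.
have -> : int1 a b (fun y => F (t0, y)) - int1 a b (fun y => F (t, y)) =
    int1 a b (fun y => F (t0, y) + -1 * F (t, y)).
  by rewrite int1D// int1Z// mulN1r.
apply: (le_trans (@int1_norm_le _ _ _ _ (e / (b - a + 1)) ab (contD c0 cN) _)).
- by move=> y /H /ltW; rewrite mulN1r distrC.
- rewrite -mulrA ger_pMr// mulrC ler_pdivrMr// mul1r; lra.
Unshelve. all: end_near. Qed.

(** The mean value theorem turns each difference quotient into a value of [D] at an intermediate
    point, and [near_uniform_segment] makes these values converge uniformly in [y]. *)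
Lemma int1_is_derive (V : normedModType R) (F D : V * R -> R) (a b : R) (v : V) :
  a <= b -> continuous F -> continuous D ->
  (forall p y, is_derive p v (fun q => F (q, y)) (D (p, y))) ->
  forall p, is_derive p v (fun q => int1 a b (fun y => F (q, y)))
                          (int1 a b (fun y => D (p, y))).
Proof.
move=> ab cF cD dF p.
suff L : (fun h : R => h^-1 *: (((fun q => int1 a b (fun y => F (q, y))) \o shift p) (h *: v)
      - int1 a b (fun y => F (p, y)))) @ 0^' --> int1 a b (fun y => D (p, y)).
  split; first by apply/cvg_ex; eexists; exact: L.
  exact/cvg_lim.
apply/cvgrPdist_le => e e0.
have ba1 : 0 < b - a + 1 by rewrite ltr_wpDl// subr_ge0.
have e1 : 0 < e / (b - a + 1) by rewrite divr_gt0.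
pose G (z : R * R) := D (z.1 *: v + p, z.2).
have cG : continuous G.
  apply: (continuous_comp2 (f := fun z : R * R => (z.1 *: v + p, z.2))) => //.
  apply: continuous_pair => z; last exact: cvg_snd.
  by apply: cvgD; [apply: cvgZr_tmp; exact: cvg_fst|exact: cvg_cst].
have /nbhs_ballP[d /= d0 Hd] := near_uniform_segment a b 0 cG e1.
near=> h.
have h0 : h != 0 by near: h; exact: nbhs_dnbhs_neq.
have hd : `|h| < d.
  by near: h; exact: dnbhs0_lt.
have cq q := continuous_pair2 (t := q) cF.
have cDp := continuous_pair2 (t := p) cD.
have cFF : continuous (fun y => F (h *: v + p, y) + -1 * F (p, y)).
  by apply: contD => //; exact: contZ.
have cT := contD cDp (contZ (k := - h^-1) cFF).
rewrite /=.
have -> : int1 a b (fun y => D (p, y)) - h^-1 *: (int1 a b (fun y => F (h *: v + p, y)) -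
    int1 a b (fun y => F (p, y))) =
  int1 a b (fun y => D (p, y) + (- h^-1) * (F (h *: v + p, y) + -1 * F (p, y))).
  rewrite int1D//; last exact: contZ.
  rewrite int1Z// int1D//; last exact: contZ.
  by rewrite int1Z// mulN1r mulNr.
apply: (le_trans (@int1_norm_le _ _ _ _ (e / (b - a + 1)) ab cT _)).
- move=> y yab.
  have [c ch E] := mvt_line (f := fun q => F (q, y)) p h (fun q => dF q y).
  rewrite mulN1r E mulNr mulKf// distrC.
  have := Hd c; rewrite /ball /= sub0r normrN => /(_ (le_lt_trans ch hd)) /(_ _ yab).
  by rewrite /G /= scale0r add0r => /ltW.
- rewrite -mulrA ger_pMr// mulrC ler_pdivrMr// mul1r; lra.
Unshelve. all: end_near. Qed.

End Parametric.

Lemma continuous_rV (T : topologicalType) (R : realType) n (f : T -> 'rV[R]_n) :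
  (forall i, continuous (fun t => f t 0 i)) -> continuous f.
Proof.
move=> cf t; apply/cvgrPdist_lt => e e0; near=> s.
rewrite /Num.Def.normr/= mx_normrE bigmax_lt// => -[i j] _ /=.
rewrite !mxE ord1; move: j; near: s; apply: filter_forall => j.
by have /cvgrPdist_lt := cf j t; apply.
Unshelve. all: end_near. Qed.

Lemma continuous_coord (R : realType) n (i : 'I_n) :
  continuous (fun x : 'rV[R]_n => x 0 i).
Proof. exact: coord_continuous. Qed.

(** * Iterated integrals over cubes *)

Section BoxIntegral.
Context {R : realType}.

(** The same [row_mx] as in [integral_rV], so that both iterated integrals unfold alike. *)
Definition rcons_mx n (y : R) (z : 'rV[R]_n) : 'rV[R]_n.+1 :=
  row_mx (y%:M : 'rV[R]_1) z.

Lemma rcons_mx0 n y (z : 'rV[R]_n) : rcons_mx y z 0 ord0 = y.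
Proof.
rewrite /rcons_mx (_ : ord0 = lshift n (ord0 : 'I_1)); last exact/val_inj.
by apply: (etrans (row_mxEl (y%:M : 'rV[R]_1) z 0 ord0)); rewrite mxE eqxx mulr1n.
Qed.

Lemma rcons_mxS n y (z : 'rV[R]_n) j : rcons_mx y z 0 (lift ord0 j) = z 0 j.
Proof. by rewrite -rshift1; exact: (row_mxEr (y%:M : 'rV[R]_1) z 0 j). Qed.

Definition rcons_mxE := (rcons_mx0, rcons_mxS).

Lemma rcons_mxP n (q q' : 'rV[R]_n.+1) :
  q 0 ord0 = q' 0 ord0 -> (forall j, q 0 (lift ord0 j) = q' 0 (lift ord0 j)) ->
  q = q'.
Proof.
move=> e0 eS; apply/rowP => i; case: (unliftP ord0 i) => [j ->|->] //.
Qed.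

Lemma rcons_mx_continuous n :
  continuous (fun x : R * 'rV[R]_n => rcons_mx x.1 x.2).
Proof.
apply: continuous_rV => i; case: (unliftP ord0 i) => [j ->|->].
  under [fun x => _]eq_fun do rewrite rcons_mxS.
  exact: (continuous_comp2 (@cont_snd _ _) (@continuous_coord _ _ j)).
under [fun x => _]eq_fun do rewrite rcons_mx0.
exact: cont_fst.
Qed.

Lemma continuous_rcons_mx (T : topologicalType) n (f : T -> R) (g : T -> 'rV[R]_n) :
  continuous f -> continuous g -> continuous (fun t => rcons_mx (f t) (g t)).
Proof.
move=> cf cg; apply: (continuous_comp2 (f := fun t => (f t, g t)) _ (@rcons_mx_continuous n)).
exact: continuous_pair.
Qed.

Lemma continuous_slice (T : topologicalType) n :
  continuous (fun x : (T * R) * 'rV[R]_n => (x.1.1, rcons_mx x.1.2 x.2)).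
Proof.
have cfst : continuous (fun x : (T * R) * 'rV[R]_n => x.1) by exact: cont_fst.
have c1 := continuous_comp2 cfst (@cont_fst T R).
have c2 := continuous_comp2 cfst (@cont_snd T R).
exact: (continuous_pair c1 (continuous_rcons_mx c2 (@cont_snd _ _))).
Qed.

Fixpoint boxint (c : R) (n : nat) : ('rV[R]_n -> R) -> R :=
  match n with
  | 0 => fun F => F 0
  | n'.+1 => fun F =>
      int1 (- c) c (fun y => boxint c (fun z : 'rV[R]_n' => F (rcons_mx y z)))
  end.

Definition in_box (c : R) n (q : 'rV[R]_n) := forall i, `|q 0 i| <= c.

Lemma in_box_rcons (c : R) n y (z : 'rV[R]_n) :
  - c <= y <= c -> in_box c z -> in_box c (rcons_mx y z).
Proof.
move=> yc zc i; case: (unliftP ord0 i) => [j ->|->].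
  by rewrite rcons_mxS.
by rewrite rcons_mx0 ler_norml.
Qed.

Variable c : R.
Hypothesis c0 : 0 <= c.
Let Ncc : - c <= c. Proof. by rewrite -subr_ge0 opprK addr_ge0. Qed.

Lemma boxint_continuous n (T : topologicalType) (F : T * 'rV[R]_n -> R) :
  continuous F -> continuous (fun t => boxint c (fun q => F (t, q))).
Proof.
elim: n T F => [|n IH] T F cF /=.
  have cf : continuous (fun t : T => (t, 0 : 'rV[R]_0)).
    by apply: continuous_pair; [exact: cont_id|exact: cst_continuous].
  exact: (continuous_comp2 cf cF).
pose G (x : T * R) := boxint c (fun z : 'rV[R]_n => F (x.1, rcons_mx x.2 z)).
apply: (@int1_continuous _ _ G) => //.
apply: (IH _ (fun xz : (T * R) * 'rV_n => F (xz.1.1, rcons_mx xz.1.2 xz.2))).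
exact: (continuous_comp2 (@continuous_slice T n) cF).
Qed.

Lemma slice_continuous n (F : 'rV[R]_n.+1 -> R) : continuous F ->
  continuous (fun x : R * 'rV[R]_n => F (rcons_mx x.1 x.2)).
Proof. by move=> cF; exact: (continuous_comp2 (@rcons_mx_continuous n) cF). Qed.

Lemma slice2_continuous n (F : 'rV[R]_n.+1 -> R) (y : R) : continuous F ->
  continuous (fun z => F (rcons_mx y z)).
Proof.
move=> cF; have := continuous_rcons_mx (@cst_continuous _ _ y) (@cont_id 'rV[R]_n).
by move=> /continuous_comp2; exact.
Qed.

Lemma slice1_continuous n (F : 'rV[R]_n.+1 -> R) : continuous F ->
  continuous (fun y => boxint c (fun z => F (rcons_mx y z))).
Proof. by move=> cF; exact: boxint_continuous (slice_continuous cF). Qed.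

Lemma eq_boxint n (F G : 'rV[R]_n -> R) :
  (forall q, in_box c q -> F q = G q) -> boxint c F = boxint c G.
Proof.
elim: n F G => [|n IH] F G FG /=; first by apply: FG => -[].
apply: eq_int1 => y yc; apply: IH => z zc; apply: FG; exact: in_box_rcons.
Qed.

Lemma boxintD n (F G : 'rV[R]_n -> R) : continuous F -> continuous G ->
  boxint c (fun q => F q + G q) = boxint c F + boxint c G.
Proof.
elim: n F G => [//|n IH] F G cF cG /=.
rewrite -int1D; [|exact: slice1_continuous|exact: slice1_continuous].
by apply: eq_int1 => y _; apply: IH; exact: slice2_continuous.
Qed.

Lemma boxintZ n (k : R) (F : 'rV[R]_n -> R) : continuous F ->
  boxint c (fun q => k * F q) = k * boxint c F.
Proof.
elim: n F => [//|n IH] F cF /=.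
rewrite -int1Z; last exact: slice1_continuous.
by apply: eq_int1 => y _; apply: IH; exact: slice2_continuous.
Qed.

Lemma boxint0 n : boxint c (fun _ : 'rV[R]_n => 0) = 0.
Proof.
have := @boxintZ n 0 (fun=> 0) (@cst_continuous _ _ 0); rewrite [X in _ = X]mul0r => H.
by rewrite -[RHS]H; apply: eq_boxint => q _; rewrite mulr0.
Qed.

Lemma boxint_sum n (I : Type) (s : seq I) (F : I -> 'rV[R]_n -> R) :
  (forall i, continuous (F i)) ->
  boxint c (fun q => \sum_(i <- s) F i q) = \sum_(i <- s) boxint c (F i).
Proof.
move=> cF; elim: s => [|i s IH].
  rewrite big_nil -[RHS](boxint0 n); apply: eq_boxint => q _; by rewrite big_nil.
rewrite big_cons -IH -boxintD//; last exact: cont_sum.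
by apply: eq_boxint => q _; rewrite big_cons.
Qed.

Lemma boxint_is_derive n (V : normedModType R) (F D : V * 'rV[R]_n -> R) (v : V) :
  continuous F -> continuous D ->
  (forall p q, is_derive p v (fun x => F (x, q)) (D (p, q))) ->
  forall p, is_derive p v (fun x => boxint c (fun q => F (x, q)))
                          (boxint c (fun q => D (p, q))).
Proof.
have cslice n' (G : V * 'rV[R]_n'.+1 -> R) : continuous G ->
    continuous (fun x : (V * R) * 'rV[R]_n' => G (x.1.1, rcons_mx x.1.2 x.2)).
  by move=> cG; exact: (continuous_comp2 (@continuous_slice V n') cG).
elim: n F D => [|n IH] F D cF cD dF p /=; first exact: (dF p 0).
pose G (x : V * R) := boxint c (fun z : 'rV[R]_n => F (x.1, rcons_mx x.2 z)).
pose E (x : V * R) := boxint c (fun z : 'rV[R]_n => D (x.1, rcons_mx x.2 z)).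
apply: (@int1_is_derive _ _ G E) => //.
- exact: (@boxint_continuous _ _ (fun x : (V * R) * 'rV_n => F (x.1.1, rcons_mx x.1.2 x.2)) (cslice _ _ cF)).
- exact: (@boxint_continuous _ _ (fun x : (V * R) * 'rV_n => D (x.1.1, rcons_mx x.1.2 x.2)) (cslice _ _ cD)).
move=> {}p y.
have cs (H : V * 'rV[R]_n.+1 -> R) : continuous H ->
    continuous (fun x : V * 'rV[R]_n => H (x.1, rcons_mx y x.2)).
  move=> cH; apply: (continuous_comp2 _ cH); apply: continuous_pair.
    exact: cont_fst.
  by apply: continuous_rcons_mx; [exact: cst_continuous|exact: cont_snd].
apply: (IH (fun x => F (x.1, rcons_mx y x.2)) (fun x => D (x.1, rcons_mx y x.2))).
- exact: cs.
- exact: cs.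
by move=> {}p z; exact: (dF p (rcons_mx y z)).
Qed.

Lemma rcons_mx_delta0 n (y : R) (z : 'rV[R]_n) :
  rcons_mx y z = y *: delta_mx 0 ord0 + rcons_mx 0 z.
Proof.
apply: rcons_mxP => [|j]; rewrite rcons_mxE.
  have := rcons_mx0 0 z; move: (rcons_mx 0 z) => w w0.
  by rewrite !mxE w0 !eqxx mulr1 addr0.
have := rcons_mxS 0 z j; move: (rcons_mx 0 z) => w wS.
by rewrite !mxE wS /= mulr0 add0r.
Qed.

Lemma rcons_mx_deltaS n (y h : R) (z : 'rV[R]_n) j :
  rcons_mx y (h *: delta_mx 0 j + z) =
  h *: delta_mx 0 (lift ord0 j) + rcons_mx y z.
Proof.
apply: rcons_mxP => [|k]; rewrite rcons_mxE.
  have := rcons_mx0 y z; move: (rcons_mx y z) => w w0.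
  by rewrite !mxE w0 /= mulr0 add0r.
have := rcons_mxS y z k; move: (rcons_mx y z) => w wS.
by rewrite !mxE wS !eqxx /= (inj_eq lift_inj).
Qed.

(** The divergence theorem in one coordinate. If [i] is not the outermost variable, the induction
    works under the outer integral; if it is, the inner integral is differentiated in [y] and the
    fundamental theorem leaves two faces on which [F] vanishes. *)
Lemma boxint_derive0 n (F D : 'rV[R]_n -> R) (i : 'I_n) :
  continuous F -> continuous D ->
  (forall q : 'rV[R]_n, is_derive q (delta_mx 0 i : 'rV[R]_n) F (D q)) ->
  (forall q : 'rV[R]_n, c <= `|q 0 i| -> F q = 0) ->
  boxint c D = 0.
Proof.
elim: n F D i => [|n IH] F D i cF cD dF F0; first by case: i {dF F0}.
case: (unliftP ord0 i) dF F0 => [j ->|->] dF F0 /=.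
  rewrite -[RHS](@mul0r _ (c - - c)) -int1_cst//.
  apply: eq_int1 => y _.
  apply: (IH (fun z => F (rcons_mx y z)) _ j).
  - exact: slice2_continuous.
  - exact: slice2_continuous.
  - move=> z; have := dF (rcons_mx y z).
    have E : (fun h : R => h^-1 *: ((F \o shift (rcons_mx y z)) (h *: delta_mx 0 (lift ord0 j))
         - F (rcons_mx y z))) =
      (fun h : R => h^-1 *: (((fun z => F (rcons_mx y z)) \o shift z) (h *: delta_mx 0 j)
         - F (rcons_mx y z))).
      by apply/funext => h /=; rewrite rcons_mx_deltaS.
    by case=> d1 d2; split; rewrite /derivable /derive -?E.
  - by move=> z zc; apply: F0; rewrite rcons_mxS.
pose G (y : R) := boxint c (fun z : 'rV[R]_n => F (rcons_mx y z)).
have G0 y : c <= `|y| -> G y = 0.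
  move=> yc; rewrite /G -[RHS](boxint0 n); apply: eq_boxint => z _.
  by apply: F0; rewrite rcons_mx0.
suff -> : int1 (- c) c (fun y => boxint c (fun z => D (rcons_mx y z))) = G c - G (- c).
  by rewrite !G0 ?subrr// ?normrN ger0_norm.
apply: FTC_int1 => //; first exact: slice1_continuous.
move=> y _.
apply: (@boxint_is_derive n R (fun x => F (rcons_mx x.1 x.2)) (fun x => D (rcons_mx x.1 x.2)) 1).
- exact: slice_continuous.
- exact: slice_continuous.
move=> {}y z /=.
have := @is_derive_line _ _ F (rcons_mx 0 z) (delta_mx 0 ord0) y (D (rcons_mx y z)).
rewrite -rcons_mx_delta0 => /(_ (dF _)).
rewrite (_ : (fun r : R => F _) = (fun r => F (rcons_mx r z)))//.
by apply/funext => r; rewrite [in RHS]rcons_mx_delta0.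
Qed.

(** Serves to compute the mass of a product bump from that of its one-dimensional factor. *)
Lemma boxint_prod n (g : 'I_n -> R -> R) : (forall i, continuous (g i)) ->
  boxint c (fun q : 'rV[R]_n => \prod_(i < n) g i (q 0 i)) =
  \prod_(i < n) int1 (- c) c (g i).
Proof.
elim: n g => [|n IH] g cg /=; first by rewrite !big_ord0.
rewrite big_ord_recl mulrC -(IH (fun j => g (lift ord0 j)))// -int1Z//.
apply: eq_int1 => y _.
have cp : continuous (fun q : 'rV[R]_n => \prod_(i < n) g (lift ord0 i) (q 0 i)).
  by apply: cont_prod => i; apply: (continuous_comp2 (@continuous_coord _ _ i)).
rewrite mulrC -boxintZ//; apply: eq_boxint => z _.
rewrite big_ord_recl rcons_mx0; congr (_ * _).
by apply: eq_bigr => j _; rewrite rcons_mxS.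
Qed.

Lemma boxint_eq0 n (F : 'rV[R]_n -> R) : (forall q, in_box c q -> F q = 0) ->
  boxint c F = 0.
Proof. by move=> F0; rewrite -(boxint0 n); exact: eq_boxint. Qed.

(** The change of variables is made on a primitive [P] of [g]: the derivative of [- P (x - rho * q)]
    in [q] is [rho * g (x - rho * q)], so both sides are the same increment of [P]. *)
Lemma int1_integral (g : R -> R) (x rho : R) : 0 < rho -> continuous g ->
  (forall q, c <= `|q| -> g (x - rho * q) = 0) ->
  Rintegral (@lebesgue_measure R) setT g =
  rho * int1 (- c) c (fun q => g (x - rho * q)).
Proof.
move=> r0 cg g0.
have ab : x - rho * c <= x + rho * c.
  by rewrite lerD2l lerNl -mulrN ler_pM2l.
have -> : Rintegral (@lebesgue_measure R) setT g =
    int1 (x - rho * c) (x + rho * c) g.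
  rewrite /int1 [RHS]Rintegral_mkcond; congr Rintegral; apply/funext => y.
  rewrite /= patchE; case: ifPn => //; rewrite notin_setE /= in_itv /= => /negP H.
  have -> : y = x - rho * ((x - y) / rho).
    by rewrite mulrC divfK ?gt_eqF// subKr.
  apply: g0; rewrite leNgt; apply: contra H; rewrite ltr_norml.
  rewrite ltr_pdivlMr// ltr_pdivrMr// => /andP[h1 h2].
  by apply/andP; split; lra.
have caff : continuous (fun q : R => x - rho * q).
  exact: (contD (@cst_continuous _ _ x) (contN (contZ (k := rho) (@cont_id R)))).
have [P dP] := primitive_exists ab cg.
rewrite (FTC_int1 ab cg dP) -int1Z; last first.
  exact: (continuous_comp2 caff cg).
suff -> : int1 (- c) c (fun q => rho * g (x - rho * q)) =
    - P (x - rho * c) - - P (x - rho * - c).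
  by rewrite mulrN opprK opprK addrC.
apply: (@FTC_int1 _ _ _ _ (fun q => - P (x - rho * q))) => //.
  exact: contZ (continuous_comp2 caff cg).
move=> q /andP[h1 h2].
have dPq : is_derive (x - rho * q) 1 P (g (x - rho * q)).
  apply: dP; rewrite lerD2l lerN2 ler_pM2l// h2 /= lerD2l -mulrN ler_pM2l//; lra.
have dl : is_derive q (1 : R) (cst x - rho *: (id : R -> R)) (- rho).
  by apply: is_derive_eq; rewrite sub0r [_ *: 1]mulr1.
have := @is_deriveN _ _ _ _ _ _ _ (@is_derive1_comp _ P (cst x - rho *: (id : R -> R)) q _ _ dPq dl).
by rewrite mulrN opprK mulrC.
Qed.

End BoxIntegral.

(** Turns the momenta, which are integrals over the whole space, into integrals in the rescaled
    variable [q] centred at [x], provided the box of scale [rho] around [x] covers the support. *)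
Lemma integral_rV_boxint (R : realType) (c : R) n (g : 'rV[R]_n -> R) (x : 'rV[R]_n)
    (rho : R) :
  0 <= c -> 0 < rho -> continuous g ->
  (forall (q : 'rV[R]_n) i, c <= `|q 0 i| -> g (x - rho *: q) = 0) ->
  integral_rV g = rho ^+ n * boxint c (fun q => g (x - rho *: q)).
Proof.
move=> c0 r0; elim: n g x => [|n IH] g x cg g0 /=.
  by rewrite mul1r; congr g; apply/rowP => -[].
pose x0 := x 0 ord0; pose x' : 'rV[R]_n := \row_j x 0 (lift ord0 j).
have xE (y q : R) (q' : 'rV[R]_n) : y = x0 - rho * q ->
    rcons_mx y (x' - rho *: q') = x - rho *: rcons_mx q q'.
  move=> ->; apply: rcons_mxP => [|j]; rewrite rcons_mxE.
    have := rcons_mx0 q q'; move: (rcons_mx q q') => w w0.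
    by rewrite !mxE w0.
  have := rcons_mxS q q' j; move: (rcons_mx q q') => w wS.
  by rewrite !mxE wS.
have yE y : y = x0 - rho * ((x0 - y) / rho).
  by rewrite mulrC divfK ?gt_eqF// subKr.
pose G y := boxint c (fun z : 'rV[R]_n => g (rcons_mx y (x' - rho *: z))).
have caff : continuous (fun q : 'rV[R]_n => x' - rho *: q).
  have c1 := contVZ (@cst_continuous _ _ (- rho)) (@cont_id 'rV[R]_n).
  have := contVD (@cst_continuous _ _ x') c1.
  by under [fun q => _ + _]eq_fun do rewrite scaleNr.
have cgs : continuous (fun y => boxint c (fun z : 'rV[R]_n => g (rcons_mx y (x' - rho *: z)))).
  apply: (@boxint_continuous _ _ c0 _ _ (fun yz : R * 'rV_n => g (rcons_mx yz.1 (x' - rho *: yz.2)))).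
  have cc := continuous_rcons_mx (@cont_fst R 'rV[R]_n)
    (continuous_comp2 (@cont_snd R 'rV[R]_n) caff).
  exact: (continuous_comp2 cc cg).
have -> : (fun y : R => integral_rV (fun z : 'rV_n => g (row_mx y%:M z))) =
    (fun y => rho ^+ n * G y).
  apply/funext => y; apply: (IH (fun z => g (rcons_mx y z))) => [|q i qi].
    exact: slice2_continuous.
  rewrite (xE _ _ _ (yE y)); apply: (g0 _ (lift ord0 i)).
  by rewrite rcons_mxS.
rewrite (@int1_integral _ c c0 _ x0 rho r0); last first.
- move=> q qc; suff -> : G (x0 - rho * q) = 0 by rewrite mulr0.
  apply: boxint_eq0 => // z _.
  by rewrite (xE _ q)//; apply: (g0 _ ord0); rewrite rcons_mx0.
- exact: contZ.
rewrite exprS -mulrA; congr (_ * _).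
have caff1 : continuous (fun q : R => x0 - rho * q).
  exact: (contD (@cst_continuous _ _ x0) (contN (contZ (k := rho) (@cont_id R)))).
rewrite int1Z; last exact: (continuous_comp2 caff1 cgs).
congr (_ * _); apply: eq_int1 => q _; apply: eq_boxint => // z _.
by rewrite (xE _ q).
Qed.

(** * Fields with bounded spatial derivatives *)

Section Regularity.
Context {R : realType} {d : nat}.
Local Notation ST := (R * 'rV[R]_d)%type.
Local Notation ex i := ((0 : R, delta_mx 0 i : 'rV[R]_d) : ST).

(* [bndC D k C mu F]: spatial derivatives of [F th] of order [m <= k] are
   continuous jointly with the parameter [th], and bounded by [C * mu ^+ m] at
   the points of [D].  With [D = set0] it only records regularity. *)
Fixpoint bndC (T : topologicalType) (D : set (T * ST)) (k : nat) (C mu : R)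
    (F : T -> ST -> R) {struct k} : Prop :=
  [/\ continuous (fun z : T * ST => F z.1 z.2),
      forall z, D z -> `|F z.1 z.2| <= C &
      match k with
      | 0 => True
      | k'.+1 => forall i : 'I_d,
          (forall th p, derivable (F th) p (ex i)) /\
          bndC D k' (C * mu) mu (fun th => pdx i (F th))
      end].

Section Closure.
Context {T : topologicalType}.
Implicit Types (D : set (T * ST)) (F G : T -> ST -> R) (C mu : R).

Lemma bndC_cont D k C mu F : bndC D k C mu F -> continuous (fun z : T * ST => F z.1 z.2).
Proof. by case: k => [|k] []. Qed.

Lemma bndC_bnd D k C mu F : bndC D k C mu F -> forall z, D z -> `|F z.1 z.2| <= C.
Proof. by case: k => [|k] []. Qed.

Lemma bndC_der D k C mu F i : bndC D k.+1 C mu F -> forall th p, derivable (F th) p (ex i).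
Proof. by case=> _ _ /(_ i)[]. Qed.

Lemma bndC_pdx D k C mu F i : bndC D k.+1 C mu F ->
  bndC D k (C * mu) mu (fun th => pdx i (F th)).
Proof. by case=> _ _ /(_ i)[]. Qed.

Lemma bndC_is_derive D k C mu F i : bndC D k.+1 C mu F ->
  forall th p, is_derive p (ex i) (F th) (pdx i (F th) p).
Proof. by move=> H th p; apply: derivableP; exact: bndC_der H th p. Qed.

Lemma bndC_pred D k C mu F : bndC D k.+1 C mu F -> bndC D k C mu F.
Proof.
elim: k C F => [|k IH] C F; first by case=> c b _; split.
move=> [c b H]; split => // i; have [h1 h2] := H i; split => //; exact: IH.
Qed.

Lemma bndC_leq D k k' C mu F : (k' <= k)%N -> bndC D k C mu F -> bndC D k' C mu F.
Proof.
move/subnK <-; elim: (k - k')%N => [//|m IH] H; apply: IH.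
by apply: bndC_pred; rewrite -addSn.
Qed.

Lemma bndC_sub D D' k C mu F : D' `<=` D -> bndC D k C mu F -> bndC D' k C mu F.
Proof.
move=> DD'; elim: k C F => [|k IH] C F [c b H]; split => //; try by move=> z /DD'; exact: b.
by move=> i; have [h1 h2] := H i; split => //; exact: IH.
Qed.

Lemma bndC_le D k C mu C' mu' F : 0 <= C -> 0 <= mu -> C <= C' -> mu <= mu' ->
  bndC D k C mu F -> bndC D k C' mu' F.
Proof.
move=> + m0; elim: k C C' F => [|k IH] C C' F C0 CC' mm' [c b H]; split => //;
  try by move=> z /b /le_trans; apply.
move=> i; have [h1 h2] := H i; split => //.
by apply: (IH (C * mu)) => //; [exact: mulr_ge0|exact: ler_pM].
Qed.

(** Over [set0] the bounds are vacuous, so the constants can be exchanged at will. *)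
Lemma bndC_regular D k C mu F C' mu' : bndC D k C mu F -> bndC set0 k C' mu' F.
Proof.
elim: k C C' F => [|k IH] C C' F [c b H]; split => // i.
by have [h1 h2] := H i; split => //; exact: IH h2.
Qed.

Lemma bndC_cst D k C mu (a : R) : 0 <= mu -> `|a| <= C -> bndC D k C mu (fun _ _ => a).
Proof.
move=> m0; elim: k C a => [|k IH] C a aC; split => //; try exact: cst_continuous.
move=> i; split=> [th p|]; first exact: derivable_cst.
have -> : (fun _ : T => pdx i (fun _ => a)) = (fun _ _ => 0).
  by apply/funext => th; apply/funext => p; exact: derive_cst.
by apply: IH; rewrite normr0 mulr_ge0// (le_trans _ aC).
Qed.

Lemma bndC_param D k C mu (f : T -> R) : continuous f ->
  0 <= mu -> (forall z, D z -> `|f z.1| <= C) -> 0 <= C -> bndC D k C mu (fun th _ => f th).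
Proof.
move=> cf m0 fC C0.
have c : continuous (fun z : T * ST => f z.1) by exact: (continuous_comp2 (@cont_fst T ST) cf).
case: k => [|k]; split => // i; split=> [th p|]; first exact: derivable_cst.
have -> : (fun th : T => pdx i (fun=> f th)) = (fun _ _ => 0).
  by apply/funext => th; apply/funext => p; exact: derive_cst.
by apply: bndC_cst; rewrite ?normr0 ?mulr_ge0.
Qed.

Lemma bndCD D k C1 C2 mu F G : bndC D k C1 mu F -> bndC D k C2 mu G ->
  bndC D k (C1 + C2) mu (fun th p => F th p + G th p).
Proof.
elim: k C1 C2 F G => [|k IH] C1 C2 F G [cF bF HF] [cG bG HG]; split;
  try exact: contD; try (by move=> z Dz; apply: le_trans (ler_normD _ _) _; apply: lerD;
    [exact: bF|exact: bG]); first by [].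
move=> i; have [f1 f2] := HF i; have [g1 g2] := HG i.
split=> [th p|]; first exact: (derivableD (f1 th p) (g1 th p)).
rewrite mulrDl; have -> : (fun th => pdx i (fun p => F th p + G th p)) =
    (fun th p => pdx i (F th) p + pdx i (G th) p).
  by apply/funext => th; apply/funext => p; exact: (deriveD (f1 th p) (g1 th p)).
exact: IH.
Qed.

(** By the Leibniz rule the order [m] splits binomially between the factors, and the binomial
    theorem sums the result to [(mu1 + mu2) ^+ m]: amplitudes multiply and rates add. *)
Lemma bndCM D k C1 C2 mu1 mu2 F G : bndC D k C1 mu1 F -> bndC D k C2 mu2 G ->
  bndC D k (C1 * C2) (mu1 + mu2) (fun th p => F th p * G th p).
Proof.
elim: k C1 C2 F G => [|k IH] C1 C2 F G HF HG.
  case: HF HG => [cF bF _] [cG bG _]; split => //; first exact: contM.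
  by move=> z Dz; rewrite normrM ler_pM//; [exact: bF|exact: bG].
have HF' := bndC_pred HF; have HG' := bndC_pred HG.
case: HF HG => [cF bF HF] [cG bG HG]; split; first exact: contM.
  by move=> z Dz; rewrite normrM ler_pM//; [exact: bF|exact: bG].
move=> i; have [f1 f2] := HF i; have [g1 g2] := HG i.
split=> [th p|]; first exact: (derivableM (f1 th p) (g1 th p)).
have -> : (fun th => pdx i (fun p => F th p * G th p)) =
    (fun th p => pdx i (F th) p * G th p + F th p * pdx i (G th) p).
  apply/funext => th; apply/funext => p.
  rewrite /pdx [LHS](deriveM (f1 th p) (g1 th p)) addrC; congr (_ + _).
  by rewrite [LHS]mulrC.
have -> : C1 * C2 * (mu1 + mu2) = (C1 * mu1) * C2 + C1 * (C2 * mu2) by ring.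
by apply: bndCD; exact: IH.
Qed.

Lemma bndCZ D k C mu (a : R) F : bndC D k C mu F ->
  bndC D k (`|a| * C) mu (fun th p => a * F th p).
Proof.
move=> HF; rewrite -[X in bndC _ _ _ X _]add0r; apply: bndCM HF.
by apply: bndC_cst.
Qed.

Lemma bndC_sum D k C mu (I : Type) (s : seq I) (F : I -> T -> ST -> R) : 0 <= mu ->
  (forall i, bndC D k C mu (F i)) ->
  bndC D k ((size s)%:R * C) mu (fun th p => \sum_(i <- s) F i th p).
Proof.
move=> m0 HF; elim: s => [|i s IH].
  rewrite mul0r; under [fun th => _]eq_fun do under [fun p => _]eq_fun do rewrite big_nil.
  by apply: bndC_cst; rewrite ?normr0.
under [fun th => _]eq_fun do under [fun p => _]eq_fun do rewrite big_cons.
rewrite /= -natr1 mulrDl mul1r addrC; exact: bndCD.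
Qed.

Lemma bndC_prod D k C mu (I : Type) (s : seq I) (F : I -> T -> ST -> R) : 0 <= mu -> 0 <= C ->
  (forall i, bndC D k C mu (F i)) ->
  bndC D k (C ^+ size s) ((size s)%:R * mu) (fun th p => \prod_(i <- s) F i th p).
Proof.
move=> m0 C0 HF; elim: s => [|i s IH].
  rewrite mul0r expr0; under [fun th => _]eq_fun do under [fun p => _]eq_fun do rewrite big_nil.
  by apply: bndC_cst; rewrite ?normr1.
under [fun th => _]eq_fun do under [fun p => _]eq_fun do rewrite big_cons.
rewrite /= -natr1 mulrDl mul1r addrC exprS; exact: bndCM.
Qed.

Lemma bndC_ext D k C mu F G : (forall th p, F th p = G th p) ->
  bndC D k C mu F -> bndC D k C mu G.
Proof. by move=> FG; rewrite (_ : F = G)//; apply/funext => th; apply/funext => p. Qed.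

(** Separates size from joint continuity: the bound may be proved parameter by parameter, through a
    formula for [F th] that is not continuous in [th]. This is how the integration by parts,
    singular at [s = 0], is fed into the integral over [s]. *)
Lemma bndC_fiber D k C mu F : (forall th, bndC [set z : T * ST | D (th, z.2)] k C mu (fun _ : T => F th)) ->
  bndC set0 k 0 0 F -> bndC D k C mu F.
Proof.
elim: k C F => [|k IH] C F Hf [c _ H].
  by split => // -[th p] Dz; have [_ b _] := Hf th; exact: (b (th, p)).
split => //.
  by move=> [th p] Dz; have [_ b _] := Hf th; exact: (b (th, p)).
move=> i; have [h1 h2] := H i; split => //; apply: IH.
  by move=> th; have [_ _ /(_ i)[]] := Hf th.
exact: bndC_regular h2.
Qed.

End Closure.

Lemma bndC_reparam (T S : topologicalType) (g : S -> T) (D : set (T * ST)) k C mu F :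
  continuous g -> bndC D k C mu F ->
  bndC [set z : S * ST | D (g z.1, z.2)] k C mu (fun s => F (g s)).
Proof.
move=> cg; elim: k C F => [|k IH] C F [c b H].
all: have c' : continuous (fun z : S * ST => F (g z.1) z.2);
  [exact: (continuous_comp2 (continuous_pair (continuous_comp2 (@cont_fst _ _) cg) (@cont_snd _ _)) c)|].
  by split => // z /b.
split => //; first by move=> z /b.
by move=> i; have [h1 h2] := H i; split => //; exact: (IH _ _ h2).
Qed.

Lemma spatialC_bndC (T : topologicalType) k C mu (f : ST -> R) :
  spatialC k f -> bndC (set0 : set (T * ST)) k C mu (fun _ => f).
Proof.
elim: k C f => [|k IH] C f [c H].
all: have c' := continuous_comp2 (@cont_snd T ST) c.
  by split.
split => // i; have [h1 h2] := H i; split => //; exact: (IH _ _ h2).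
Qed.

Lemma bndC_spatialC (T : topologicalType) (D : set (T * ST)) k C mu F (th : T) :
  bndC D k C mu F -> spatialC k (F th).
Proof.
elim: k C F => [|k IH] C F [c b H].
all: have c' : continuous (F th : ST -> R);
  [exact: (continuous_comp2 (continuous_pair (@cst_continuous _ _ th) (@cont_id ST)) c)|].
  by split.
split => // i; have [h1 h2] := H i; split; [exact: h1|exact: (IH _ _ h2)].
Qed.

Lemma pdx_translate i (f : ST -> R) (w p : ST) : derivable f (p + w) (ex i) ->
  is_derive p (ex i) (fun x => f (x + w)) (pdx i f (p + w)).
Proof. by move=> /derivableP df; exact: is_derive_translate. Qed.

(** The shift depends on the parameter only, so it commutes with spatial derivatives and costs
    nothing. *)
Lemma bndC_translate (T : topologicalType) (D : set (T * ST)) k C mu F (h : T -> 'rV[R]_d) :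
  continuous h -> bndC D k C mu F ->
  bndC [set z : T * ST | D (z.1, z.2 + (0, h z.1))] k C mu
     (fun th p => F th (p + (0, h th))).
Proof.
move=> ch; elim: k C F => [|k IH] C F [c b H].
all: have c' : continuous (fun z : T * ST => F z.1 (z.2 + (0, h z.1)));
 [ have c1 : continuous (fun z : T * ST => z.2 + (0, h z.1));
   [exact: (contVD (@cont_snd T ST) (continuous_pair (@cst_continuous _ _ (0 : R))
       (continuous_comp2 (@cont_fst T ST) ch)))|];
   exact: (continuous_comp2 (continuous_pair (@cont_fst _ _) c1) c) |].
  by split => // z /b.
split => //; first by move=> z /b.
move=> i; have [h1 h2] := H i; split.
  by move=> th p; case: (pdx_translate (h1 th (p + (0, h th)))).
apply: bndC_ext (IH _ _ h2) => th p.
by have [_ <-] := pdx_translate (h1 th (p + (0, h th))).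
Qed.

(** Derivatives pass under the integral at every order; the half-open range of [y] keeps the
    singular endpoint out of the estimate. *)
Lemma bndC_int1 (T : topologicalType) (D : set (T * ST)) (D' : set ((T * R) * ST)) k C mu
    (F : T * R -> ST -> R) (a b : R) : a <= b ->
  (forall th y p, D (th, p) -> a < y <= b -> D' ((th, y), p)) ->
  bndC D' k C mu F ->
  bndC D k (C * (b - a)) mu (fun th p => int1 a b (fun y => F (th, y) p)).
Proof.
move=> ab DD'; elim: k C F => [|k IH] C F HF.
all: have cF := bndC_cont HF.
all: have cF2 : continuous (fun z : (T * ST) * R => F (z.1.1, z.2) z.1.2);
 [ have c1 : continuous (fun z : (T * ST) * R => ((z.1.1, z.2), z.1.2));
   [exact: (continuous_pair (continuous_pair (continuous_comp2 (@cont_fst _ _) (@cont_fst _ _)) (@cont_snd _ _))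
      (continuous_comp2 (@cont_fst _ _) (@cont_snd _ _)))|];
   exact: (continuous_comp2 c1 cF) |].
all: have c' := @int1_continuous _ _ _ a b ab cF2.
all: have b' : forall z : T * ST, D z -> `|int1 a b (fun y => F (z.1, y) z.2)| <= C * (b - a);
 [ move=> [th p] Dz; apply: int1_norm_le_oc => //;
   [exact: (continuous_pair2 (t := (th, p)) cF2)|move=> y yab; exact: (bndC_bnd HF (DD' _ _ _ Dz yab))] |].
  by split.
split => // i; have H := bndC_pdx i HF; have cH := bndC_cont H.
have dF : forall th p, is_derive p (ex i) (fun p => int1 a b (fun y => F (th, y) p))
    (int1 a b (fun y => pdx i (F (th, y)) p)).
  move=> th p.
  have cc (G : T * R -> ST -> R) : continuous (fun z : (T * R) * ST => G z.1 z.2) ->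
      continuous (fun z : ST * R => G (th, z.2) z.1).
    move=> cG; have c1 := continuous_pair (continuous_pair (@cst_continuous _ _ th)
      (@cont_snd ST R)) (@cont_fst ST R).
    exact: (continuous_comp2 c1 cG).
  apply: (@int1_is_derive _ _ (fun z : ST * R => F (th, z.2) z.1)
    (fun z => pdx i (F (th, z.2)) z.1)) => //.
  - exact: (cc F cF).
  - exact: (cc (fun x => pdx i (F x)) cH).
  - by move=> q y; exact: (bndC_is_derive i HF (th, y) q).
split; first by move=> th p; case: (dF th p).
rewrite (_ : C * (b - a) * mu = C * mu * (b - a)); last by ring.
by apply: bndC_ext (IH _ _ H) => th p; have [_ <-] := dF th p.
Qed.

Lemma bndC_boxint (c : R) n (T : topologicalType) (D : set (T * ST))
    (D' : set ((T * 'rV[R]_n) * ST)) k C mu (F : T * 'rV[R]_n -> ST -> R) : 0 <= c ->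
  (forall th q p, D (th, p) -> in_box c q -> D' ((th, q), p)) ->
  bndC D' k C mu F ->
  bndC D k (C * (c + c) ^+ n) mu (fun th p => boxint c (fun q => F (th, q) p)).
Proof.
move=> c0; elim: n T D D' F => [|n IH] T D D' F DD' HF /=.
  rewrite mulr1.
  have cg : continuous (fun th : T => (th, 0 : 'rV[R]_0)).
    exact: (continuous_pair (@cont_id T) (@cst_continuous T _ (0 : 'rV[R]_0))).
  apply: bndC_sub (bndC_reparam cg HF) => -[th p] /= Dz.
  by apply: DD' => // -[].
rewrite exprSr mulrA -[X in _ * (c + X)]opprK.
have cg := @continuous_slice R T n.
pose F' (x : (T * R) * 'rV[R]_n) := F (x.1.1, rcons_mx x.1.2 x.2).
have HF' : bndC [set z : ((T * R) * 'rV[R]_n) * ST | D' ((z.1.1.1, rcons_mx z.1.1.2 z.1.2), z.2)]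
  k C mu F' by exact: (bndC_reparam cg HF).
apply: (@bndC_int1 _ D [set z : (T * R) * ST | D (z.1.1, z.2) /\ - c < z.1.2 <= c]
   _ _ _ (fun x p => boxint c (fun z => F' (x, z) p))).
- by rewrite -subr_ge0 opprK addr_ge0.
- by move=> th y p Dz yc; split.
apply: (IH _ _ _ F' _ HF') => -[th y] z p /= [Dz /andP[yc1 yc2]] zc.
by apply: DD' => //; apply: in_box_rcons => //; rewrite yc2 ltW.
Qed.

End Regularity.

(** * Spatial calculus *)

Section SpatialCalculus.
Context {R : realType} {d : nat}.
Local Notation ST := (R * 'rV[R]_d)%type.
Local Notation ex i := ((0 : R, delta_mx 0 i : 'rV[R]_d) : ST).
Implicit Types (f g : ST -> R) (p : ST) (w xi : 'rV[R]_d).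

Lemma norm_rV_le w (e : R) : 0 <= e -> (forall i, `|w 0 i| <= e) -> `|w| <= e.
Proof.
move=> e0 H; rewrite /Num.Def.normr/= mx_normrE (bigmax_le _ e0)// => -[i j] _ /=.
by rewrite ord1.
Qed.

Lemma coord_norm_le w i : `|w 0 i| <= `|w|.
Proof.
rewrite [leRHS]/Num.Def.normr/= mx_normrE.
exact: (le_bigmax _ (fun ij : 'I_1 * 'I_d => `|w ij.1 ij.2|) (0, i)).
Qed.

Lemma scale_pair0 (a : R) w : a *: ((0, w) : ST) = (0, a *: w).
Proof. by apply: (f_equal2 pair); first exact: mulr0. Qed.

Lemma add_pair0 u w : ((0, u) : ST) + (0, w) = (0, u + w).
Proof. by apply: (f_equal2 pair); first exact: addr0. Qed.

Lemma continuous_shift_near f p (e : R) : {for p, continuous f} -> 0 < e ->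
  exists2 dl : R, 0 < dl & forall xi, `|xi| < dl -> `|f (p + (0, xi)) - f p| < e.
Proof.
move=> cf e0; have /cvgrPdist_lt/(_ _ e0)/nbhs_ballP[dl /= d0 H] := cf.
exists dl => // xi xd; rewrite distrC; apply: H.
rewrite -ball_normE /ball_ /= opprD addrA subrr add0r normrN.
by rewrite prod_normE /= normr0 gt_max d0.
Qed.

(** The path from [p] to [p + (0, w)] changes one coordinate at a time ([W k] has the first [k]
    coordinates of [w]), so each leg is a one-dimensional mean value theorem for one partial
    derivative. *)
Lemma mvt_spatial f : (forall i p, derivable f p (ex i)) -> forall p w,
  exists xi : 'I_d -> 'rV[R]_d, (forall k i, `|xi k 0 i| <= `|w 0 i|) /\
    f (p + (0, w)) - f p = \sum_k w 0 k * pdx k f (p + (0, xi k)).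
Proof.
move=> df p w.
pose W (k : nat) : 'rV[R]_d := \row_i (if (i < k)%N then w 0 i else 0).
have WS (k : 'I_d) : p + (0, W k.+1) = w 0 k *: ex k + (p + (0, W k)).
  rewrite addrCA; congr (_ + _).
  rewrite scale_pair0 add_pair0; congr (_, _).
  apply/rowP => i; rewrite !mxE eqxx /= ltnS leq_eqVlt [X in X || _]val_eqE.
  have [->|ik] := eqVneq i k; first by rewrite ltnn mulr1 addr0.
  by rewrite mulr0 add0r.
have step (k : 'I_d) : exists c : R, `|c| <= `|w 0 k| /\
    f (p + (0, W k.+1)) - f (p + (0, W k)) = w 0 k * pdx k f (c *: ex k + (p + (0, W k))).
  have [c cw E] := mvt_line (p + (0, W k)) (w 0 k) (fun q => derivableP (df k q)).
  by exists c; split => //; rewrite WS; exact: E.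
have /choice[c cP] := step.
exists (fun k : 'I_d => W k + c k *: delta_mx 0 k); split=> [k i|].
  rewrite !mxE eqxx /=; have [->|ik] := eqVneq i k.
    by rewrite ltnn add0r mulr1; case: (cP k).
  by rewrite mulr0 addr0; case: ifP => // _; rewrite normr0.
have -> : f (p + (0, w)) - f p = \sum_(0 <= k < d) (f (p + (0, W k.+1)) - f (p + (0, W k))).
  rewrite telescope_sumr//; congr (f _ - f _).
    by congr (_ + (_, _)); apply/rowP => i; rewrite mxE ltn_ord.
  suff -> : W 0 = 0 by rewrite addr0.
  by apply/rowP => i; rewrite !mxE.
rewrite big_mkord; apply: eq_bigr => k _; have [_ ->] := cP k.
congr (_ * pdx k f _); rewrite addrCA; congr (_ + _).
by rewrite scale_pair0 add_pair0 addrC.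
Qed.

(** The intermediate points of [mvt_spatial] for the increment [h w] shrink to [p], where the
    partial derivatives are continuous. *)
Lemma is_derive_spatial f p w :
  (forall i q, derivable f q (ex i)) -> (forall i, continuous (pdx i f)) ->
  is_derive p (0, w) f (\sum_k w 0 k * pdx k f p).
Proof.
move=> df cf.
suff L : (fun h : R => h^-1 *: ((f \o shift p) (h *: ((0, w) : ST)) - f p)) @ 0^' -->
    \sum_k w 0 k * pdx k f p.
  split; first by apply/cvg_ex; eexists; exact: L.
  exact/cvg_lim.
apply/cvgrPdist_le => e e0.
pose M := \sum_k `|w 0 k| + 1.
have M0 : 0 < M by rewrite ltr_wpDl// sumr_ge0.
have /choice[dl H] : forall k : 'I_d, exists dl : R, 0 < dl /\
    forall xi, `|xi| < dl -> `|pdx k f (p + (0, xi)) - pdx k f p| < e / M.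
  by move=> k; have [dl d0 H] := continuous_shift_near (cf k p) (divr_gt0 e0 M0); exists dl.
have hw : \forall h \near (0 : R)^', forall k : 'I_d, `|h| * (`|w| + 1) < dl k.
  apply: filter_forall => k.
  have w1 : 0 < `|w| + 1 by rewrite ltr_wpDl.
  near=> h; rewrite -ltr_pdivlMr//; near: h.
  by apply: dnbhs0_lt; rewrite divr_gt0//; case: (H k).
near=> h.
have h0 : h != 0 by near: h; exact: nbhs_dnbhs_neq.
have hh : forall k : 'I_d, `|h| * (`|w| + 1) < dl k by near: h.
have [xi [xiw E]] := mvt_spatial df p (h *: w).
have -> : (f \o shift p) (h *: ((0, w) : ST)) - f p = \sum_k h * w 0 k * pdx k f (p + (0, xi k)).
  rewrite /= [_ + p]addrC scale_pair0.
  by rewrite E; apply: eq_bigr => k _; rewrite mxE.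
rewrite scaler_sumr -sumrB.
have xid k : `|xi k| < dl k.
  apply: le_lt_trans (hh k); apply: norm_rV_le; first by rewrite mulr_ge0 ?addr_ge0.
  move=> i; apply: le_trans (xiw k i) _; rewrite mxE normrM ler_wpM2l//.
  by apply: le_trans (coord_norm_le w i) _; rewrite lerDl.
apply: (@le_trans _ _ (\sum_k `|w 0 k| * (e / M))).
  apply: le_trans (ler_norm_sum _ _ _) _; apply: ler_sum => k _.
  rewrite [_ *: _]mulrA mulKf// -mulrBr normrM ler_wpM2l// distrC.
  by apply: ltW; have [_] := H k; exact.
rewrite -mulr_suml mulrCA ger_pMr// ler_pdivrMr// mul1r.
by rewrite lerDl.
Unshelve. all: end_near. Qed.

Lemma spatial_lipschitz f (M : R) : (forall i p, derivable f p (ex i)) ->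
  (forall i p, `|pdx i f p| <= M) ->
  forall p w, `|f (p + (0, w)) - f p| <= M * \sum_k `|w 0 k|.
Proof.
move=> df fM p w; have [xi [_ ->]] := mvt_spatial df p w.
apply: le_trans (ler_norm_sum _ _ _) _; rewrite mulr_sumr; apply: ler_sum => k _.
by rewrite normrM mulrC ler_wpM2r.
Qed.

(** Schwarz's theorem. The mixed second difference does not depend on the order of the two steps,
    and the mean value theorem applied in either order exhibits it as [h^2] times one of the two
    mixed derivatives near [p]. *)
Lemma pdxC i j f : spatialC 2 f -> pdx i (pdx j f) = pdx j (pdx i f).
Proof.
move=> [cf H2]; apply/funext => p.
have df k q : is_derive q (ex k) f (pdx k f q) by apply: derivableP; case: (H2 k).
have ddf k l q : is_derive q (ex l) (pdx k f) (pdx l (pdx k f) q).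
  by apply: derivableP; have [_ [_ /(_ l)[]]] := H2 k.
have cddf k l : continuous (pdx l (pdx k f)).
  by have [_ [_ /(_ l)[_ []]]] := H2 k.
have dbl k l (h : R) : exists a b : R, [/\ `|a| <= `|h|, `|b| <= `|h| &
    f (h *: ex k + (h *: ex l + p)) - f (h *: ex k + p) - (f (h *: ex l + p) - f p) =
    h * (h * pdx l (pdx k f) (p + (0, a *: delta_mx 0 k + b *: delta_mx 0 l)))].
  pose phi q := f (q + h *: ex l) - f q.
  have dphi q : is_derive q (ex k) phi (pdx k f (q + h *: ex l) - pdx k f q).
    have := @is_deriveB _ _ _ _ _ _ _ _ _ (is_derive_translate (df k (q + h *: ex l))) (df k q).
    exact.
  have [a ah Ea] := mvt_line p h dphi.
  have [b bh Eb] := mvt_line (a *: ex k + p) h (ddf k l).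
  exists a, b; split => //.
  rewrite [X in f X - _ - _]addrCA [X in f X - _ - _]addrC [X in _ - (f X - _)]addrC.
  rewrite [LHS]Ea -[X in pdx k f X - _]addrC Eb; congr (_ * (_ * pdx l _ _)).
  by rewrite !scale_pair0 addrA addrC add_pair0 [X in (0, X)]addrC.
apply/eqP; rewrite -subr_eq0 -normr_le0 leNgt; apply/negP => e0.
set e := `|_| in e0.
have e2 : 0 < e / 2 by rewrite divr_gt0.
have [d1 d10 H1] := continuous_shift_near (cddf j i p) e2.
have [d2 d20 H2'] := continuous_shift_near (cddf i j p) e2.
(* Intermediate points lie within [2 h] of [p], hence inside both radii of continuity. *)
pose h : R := Num.min d1 d2 / 4.
have h0 : 0 < h by rewrite divr_gt0// lt_min d10.
have small (a b : R) k l : `|a| <= `|h| -> `|b| <= `|h| ->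
    `|a *: delta_mx 0 k + b *: delta_mx 0 l : 'rV[R]_d| < Num.min d1 d2.
  move=> ah bh; apply: (@le_lt_trans _ _ (h + h)).
    apply: norm_rV_le; first by rewrite addr_ge0 ?ltW.
    have le1 (c : R) (j' m : 'I_d) : `|c| <= `|h| -> `|c * (m == j')%:R| <= h.
      rewrite (gtr0_norm h0); case: eqP => _; first by rewrite mulr1.
      by rewrite mulr0 normr0 => _; exact: ltW.
    move=> m; rewrite !mxE !eqxx /=; apply: le_trans (ler_normD _ _) _.
    by apply: lerD; exact: le1.
  have m0 : 0 < Num.min d1 d2 by rewrite lt_min d10.
  rewrite /h; lra.
have [a [b [ah bh E1]]] := dbl j i h.
have [a' [b' [ah' bh' E2]]] := dbl i j h.
have hn : h != 0 by rewrite gt_eqF.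
have EE : h * (h * pdx i (pdx j f) (p + (0, a *: delta_mx 0 j + b *: delta_mx 0 i))) =
    h * (h * pdx j (pdx i f) (p + (0, a' *: delta_mx 0 i + b' *: delta_mx 0 j))).
  apply: etrans (esym E1) (etrans _ E2); rewrite (addrCA (h *: ex j)).
  by rewrite !opprB addrACA [RHS]addrACA; congr (_ + _); rewrite addrC.
have E := mulfI hn (mulfI hn EE).
have := small a b j i ah bh; rewrite lt_min => /andP[/H1 + _].
have := small a' b' i j ah' bh'; rewrite lt_min => /andP[_ /H2'].
rewrite E => A B.
have tri (x u w : R) : `|x - w| < `|u - w| / 2 -> `|x - u| < `|u - w| / 2 -> False.
  move=> xw xu; have := ler_normD (u - x) (x - w).
  by rewrite subrKA (distrC u x) leNgt => /negP; apply; rewrite [ltRHS]splitr ltrD.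
exact: (tri _ _ _ A B).
Qed.

(** Derivatives along a word in the coordinates: [bndC] differentiates in any order, while [nabla b]
    fixes the order of [enum]. Schwarz's theorem reconciles the two. *)
Definition iter_pdx (s : seq 'I_d) f : ST -> R := foldr (fun i g => pdx i g) f s.

Lemma spatialC_leq k k' f : (k' <= k)%N -> spatialC k f -> spatialC k' f.
Proof.
move=> kk' Hf; have := spatialC_bndC R 0 0 Hf.
by move=> /(bndC_leq kk') /(bndC_spatialC 0).
Qed.

Lemma spatialC_pdx k i f : spatialC k.+1 f -> spatialC k (pdx i f).
Proof. by case=> _ /(_ i)[]. Qed.

Lemma spatialC_iter_pdx s k f : spatialC (size s + k) f -> spatialC k (iter_pdx s f).
Proof.
elim: s k => [//|i s IH] k /= Hf.
by apply: spatialC_pdx; apply: IH; rewrite addnS.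
Qed.

Lemma iter_pdx_front s1 i s2 f : spatialC (size s1 + size s2).+1 f ->
  iter_pdx (s1 ++ i :: s2) f = iter_pdx (i :: s1 ++ s2) f.
Proof.
elim: s1 => [//|j s1 IH] Hf /=.
rewrite IH; last exact: (spatialC_leq _ Hf).
apply: pdxC; apply: spatialC_iter_pdx; apply: (spatialC_leq _ Hf).
by rewrite size_cat /= addnC.
Qed.

Lemma iter_pdx_perm s1 s2 f : spatialC (size s1) f -> perm_eq s1 s2 -> iter_pdx s1 f = iter_pdx s2 f.
Proof.
elim: s1 s2 => [|i s1 IH] s2 Hf E.
  by move: E; rewrite perm_sym => /perm_nilP ->.
have i2 : i \in s2 by rewrite -(perm_mem E) mem_head.
case/splitPr: i2 E => t1 t2 E.
have E' : perm_eq s1 (t1 ++ t2).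
  by move: E; rewrite perm_sym perm_catC /= perm_cons perm_catC perm_sym.
rewrite iter_pdx_front; first by rewrite /= (IH _ _ E')//; exact: (spatialC_leq _ Hf).
by apply: (spatialC_leq _ Hf); rewrite -size_cat -(perm_size E').
Qed.

Definition multi_seq (b : {ffun 'I_d -> nat}) : seq 'I_d :=
  flatten [seq nseq (b i) i | i <- enum 'I_d].

Lemma nabla_iter_pdx b f : nabla b f = iter_pdx (multi_seq b) f.
Proof.
rewrite /nabla /multi_seq; elim: (enum 'I_d) => [//|i s /= ->].
rewrite /iter_pdx foldr_cat; elim: (b i) => [//|n /= <-] //.
Qed.

Lemma size_multi_seq b : size (multi_seq b) = mlen b.
Proof.
rewrite /mlen size_flatten /shape -map_comp sumnE big_map big_enum.
by apply: eq_bigr => i _; rewrite /= size_nseq.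
Qed.

Lemma iter_pdx_nabla s f : spatialC (size s) f ->
  exists2 b : {ffun 'I_d -> nat}, mlen b = size s & iter_pdx s f = nabla b f.
Proof.
move=> Hf; pose b : {ffun 'I_d -> nat} := [ffun i => count_mem i s].
have E : perm_eq s (multi_seq b).
  apply/allP => j _ /=; rewrite /multi_seq count_flatten -map_comp sumnE big_map big_enum /=.
  rewrite (bigD1 j)//= big1 ?addn0 => [|i ij]; last first.
    by rewrite count_nseq /= (negbTE ij) mul0n.
  by rewrite count_nseq /= eqxx mul1n ffunE.
exists b; first by rewrite -size_multi_seq (perm_size E).
by rewrite nabla_iter_pdx; exact: iter_pdx_perm.
Qed.

(** The word [s] records derivatives already taken. The empty word serves fields bounded from order
    0; a one-letter word serves [v], of which only orders at least 1 are controlled. *)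
Lemma bndC_of_nabla (T : topologicalType) (s : seq 'I_d) m (C mu : R) f :
  spatialC (size s + m) f ->
  (forall b : {ffun 'I_d -> nat}, (size s <= mlen b <= size s + m)%N ->
    forall p, `|nabla b f p| <= C * mu ^+ mlen b) ->
  bndC (setT : set (T * ST)) m (C * mu ^+ size s) mu (fun _ => iter_pdx s f).
Proof.
elim: m s => [|m IH] s Hf fb.
all: have bnd : forall z : T * ST, setT z -> `|iter_pdx s f z.2| <= C * mu ^+ size s;
  [ by move=> z _; have [|b bs ->] := @iter_pdx_nabla s f;
    [by apply: (spatialC_leq _ Hf); rewrite leq_addr|rewrite -bs; apply: fb; rewrite bs leqnn leq_addr] |].
all: have Hs := spatialC_iter_pdx Hf.
  by split => //; have [c _] := Hs; exact: (continuous_comp2 (@cont_snd T ST) c).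
case: Hs => c Hs; split => //; first exact: (continuous_comp2 (@cont_snd T ST) c).
move=> i; have [h1 h2] := Hs i; split => //.
rewrite -mulrA -exprSr; apply: (IH (i :: s)); first by rewrite -[size _]/(size s).+1 addSnnS.
move=> b /= /andP[b1 b2]; apply: fb; rewrite (ltnW b1) /=.
by rewrite -addSnnS.
Qed.

Lemma bndC_iter_pdx (T : topologicalType) (D : set (T * ST)) s k C mu F :
  bndC D (size s + k) C mu F -> bndC D k (C * mu ^+ size s) mu (fun th => iter_pdx s (F th)).
Proof.
elim: s k => [|i s IH] k /= HF; first by rewrite mulr1.
by rewrite exprSr mulrA; apply: (bndC_pdx i); apply: IH; rewrite addnS.
Qed.

Lemma bndC_nabla (T : topologicalType) (D : set (T * ST)) k C mu F b : (mlen b <= k)%N ->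
  bndC D k C mu F -> forall th p, D (th, p) -> `|nabla b (F th) p| <= C * mu ^+ mlen b.
Proof.
move=> bk HF th p Dp; rewrite nabla_iter_pdx -size_multi_seq.
have HF' : bndC D (size (multi_seq b) + 0) C mu F by apply: (bndC_leq _ HF); rewrite size_multi_seq addn0.
exact: (bndC_bnd (bndC_iter_pdx HF') Dp).
Qed.

Lemma derive_zero_open (v : ST) (O : set ST) f : open O -> (forall p, O p -> f p = 0) ->
  forall p, O p -> is_derive p v f 0.
Proof.
move=> oO f0 p Op.
apply: (@near_eq_is_derive _ _ _ (cst 0) f p v 0).
near=> q; rewrite f0//; near: q; exact: open_nbhs_nbhs.
Unshelve. all: end_near. Qed.

(** Differentiation is local. Applied off the closed cylinder, where the kernel estimates made on
    the tube say nothing. *)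
Lemma nabla_zero_open (O : set ST) b f : open O -> (forall p, O p -> f p = 0) ->
  forall p, O p -> nabla b f p = 0.
Proof.
move=> oO f0; rewrite nabla_iter_pdx; elim: (multi_seq b) => [//|i s IH] p Op /=.
by have [] := @derive_zero_open (ex i) O _ oO IH p Op.
Qed.

End SpatialCalculus.

(** * Bump profiles *)

Section Profiles.
Context {R : realType}.

Lemma is_derive_affine (h : R -> R) (a b u l : R) :
  is_derive (a * u + b) (1 : R) h l ->
  is_derive u (1 : R) (fun r => h (a * r + b)) (a * l).
Proof.
move=> dh; have da : is_derive u (1 : R) (a *: (id : R -> R) + cst b) a.
  by apply: is_derive_eq; rewrite addr0 [_ *: 1]mulr1.
by have := @is_derive1_comp _ h (a *: (id : R -> R) + cst b) u _ _ dh da; rewrite mulrC.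
Qed.

(** Successive derivatives are existential witnesses, so that sums, products and affine
    substitutions exhibit theirs directly. *)
Fixpoint smooth1 (k : nat) (h : R -> R) : Prop :=
  continuous h /\ match k with
  | 0 => True
  | k'.+1 => exists2 h', (forall x : R, is_derive x (1 : R) h (h' x)) & smooth1 k' h'
  end.

Fixpoint smooth1_bnd (K : R) (k : nat) (h : R -> R) : Prop :=
  [/\ continuous h, forall x, `|h x| <= K & match k with
  | 0 => True
  | k'.+1 => exists2 h', (forall x : R, is_derive x (1 : R) h (h' x)) & smooth1_bnd K k' h'
  end].

Lemma smooth1_cont k h : smooth1 k h -> continuous h.
Proof. by case: k => [|k] []. Qed.

Lemma smooth1_pred k h : smooth1 k.+1 h -> smooth1 k h.
Proof.
elim: k h => [|k IH] h; first by case.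
by move=> [c [h' d H]]; split => //; exists h' => //; exact: IH.
Qed.

Lemma smooth1D k h g : smooth1 k h -> smooth1 k g -> smooth1 k (fun x => h x + g x).
Proof.
elim: k h g => [|k IH] h g [ch Hh] [cg Hg]; split => //; try exact: contD.
case: Hh Hg => [h' dh Hh] [g' dg Hg]; exists (fun x => h' x + g' x); last exact: IH.
by move=> x; exact: (is_deriveD (dh x) (dg x)).
Qed.

Lemma smooth1M k h g : smooth1 k h -> smooth1 k g -> smooth1 k (fun x => h x * g x).
Proof.
elim: k h g => [|k IH] h g Hh Hg.
  by split => //; apply: contM; [case: Hh|case: Hg].
have Hh' := smooth1_pred Hh; have Hg' := smooth1_pred Hg.
case: Hh Hg => [ch [h' dh Hh]] [cg [g' dg Hg]]; split; first exact: contM.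
exists (fun x => h x * g' x + g x * h' x).
  by move=> x; exact: (is_deriveM (dh x) (dg x)).
by apply: smooth1D; exact: IH.
Qed.

Lemma smooth1_cst k (a : R) : smooth1 k (fun=> a).
Proof.
elim: k a => [|k IH] a; split => //; try exact: cst_continuous.
by exists (fun=> 0) => // x; exact: is_derive_cst.
Qed.

Lemma smooth1_affine k h (a b : R) : smooth1 k h -> smooth1 k (fun x => h (a * x + b)).
Proof.
elim: k h => [|k IH] h [ch Hh].
all: have c : continuous (fun x => h (a * x + b));
  [exact: (continuous_comp2 (contD (contZ (k := a) (@cont_id R)) (@cst_continuous _ _ b)) ch)|].
  by split.
split => //; case: Hh => [h' dh Hh]; exists (fun x => a * h' (a * x + b)).
  by move=> x; exact: is_derive_affine.
by apply: smooth1M; [exact: smooth1_cst|exact: IH].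
Qed.

(** Only the corner 0 needs an argument: there the difference quotient is at most [|h|^(n+1)], which
    is at most [|h|] once [|h| < 1]. *)
Lemma is_derive_truncated_power n (x : R) :
  is_derive x (1 : R) (fun x : R => Num.max 0 x ^+ n.+2) (n.+2%:R * Num.max 0 x ^+ n.+1).
Proof.
have [x0|x0|->] := ltgtP x 0.
- rewrite expr0n mulr0.
  apply: (@near_eq_is_derive _ _ _ (cst 0)).
  near=> y; rewrite /cst; have -> : Num.max 0 y = 0; last by rewrite expr0n.
  by apply/max_idPl; apply: ltW; near: y; exact: lt_nbhsl.
- have D : is_derive x (1 : R) (fun y : R => y ^+ n.+2) (n.+2%:R * x ^+ n.+1).
    have := @is_deriveX _ _ (id : R -> R) n.+2 x 1 1 (is_derive_id _ _).
    by rewrite [_ *: 1]mulr1 /= exprfctE.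
  refine (near_eq_is_derive _ D).
  near=> y; have -> // : Num.max 0 y = y.
  by apply/max_idPr; apply: ltW; near: y; exact: lt_nbhsr.
rewrite expr0n mulr0.
suff L : (fun h : R => h^-1 *: (((fun x : R => Num.max 0 x ^+ n.+2) \o shift 0) (h *: (1 : R))
    - Num.max 0 0 ^+ n.+2)) @ 0^' --> (0 : R).
  split; first by apply/cvg_ex; eexists; exact: L.
  exact/cvg_lim.
apply/cvgrPdist_le => e e0; near=> h.
have h0 : h != 0 by near: h; exact: nbhs_dnbhs_neq.
have h1 : `|h| < 1 by near: h; exact: dnbhs0_lt.
have he : `|h| < e by near: h; exact: dnbhs0_lt.
rewrite /= maxxx expr0n subr0 addr0 [_ *: 1]mulr1 sub0r normrN normrM normfV normrX.
rewrite mulrC ler_pdivrMr ?normr_gt0// exprSr; apply: ler_pM => //; last first.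
  by rewrite /Num.max; case: ifP; rewrite ?normr0.
apply: le_trans (ltW he); rewrite exprSr -[leRHS]mul1r.
have mh : `|Num.max 0 h| <= `|h| by rewrite /Num.max; case: ifP; rewrite ?normr0.
apply: ler_pM => //; rewrite exprn_ile1//.
exact: le_trans mh (ltW h1).
Unshelve. all: end_near. Qed.

Lemma smooth1_truncated_power k : smooth1 k (fun x : R => Num.max 0 x ^+ k.+1).
Proof.
have cm : continuous (fun x : R => Num.max 0 x).
  move=> x; apply: (@continuous_max _ _ (cst 0) id); first exact: cvg_cst.
  exact: cvg_id.
have cp n : continuous (fun x : R => Num.max 0 x ^+ n).
  elim: n => [|n IH]; first by under [fun x => _]eq_fun do rewrite expr0; exact: cst_continuous.
  by under [fun x => _]eq_fun do rewrite exprS; exact: contM.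
elim: k => [|k IH]; split => //.
exists (fun x => k.+2%:R * Num.max 0 x ^+ k.+1).
  exact: is_derive_truncated_power.
by apply: smooth1M => //; exact: smooth1_cst.
Qed.

Lemma smooth1_bnd_le K K' k h : K <= K' -> smooth1_bnd K k h -> smooth1_bnd K' k h.
Proof.
move=> KK'; elim: k h => [|k IH] h [c b H]; split => //; try by move=> x; exact: le_trans (b x) KK'.
by case: H => h' d H; exists h' => //; exact: IH.
Qed.

Lemma compact_support_bounded (h : R -> R) (r : R) : continuous h ->
  (forall x : R, r <= `|x| -> h x = 0) -> exists K, forall x : R, `|h x| <= K.
Proof.
move=> ch h0; have cn : continuous (fun x => `|h x|) by move=> x; apply: cvg_norm; exact: ch.
have [rN|r0] := ltP r 0; first by exists 0 => x; rewrite h0 ?normr0// (le_trans (ltW rN)).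
have rr : - r <= r by rewrite (le_trans _ r0)// oppr_le0.
have [c _ hc] := EVT_max rr (continuous_subspaceT cn).
exists `|h c| => x; have [xr|xr] := leP r `|x|; first by rewrite h0// normr0.
by apply: hc; rewrite in_itv /= -ler_norml ltW.
Qed.

Lemma smooth1_bounded k h (r : R) : smooth1 k h -> (forall x : R, r <= `|x| -> h x = 0) ->
  exists K, smooth1_bnd K k h.
Proof.
elim: k h r => [|k IH] h r Hh h0; have ch := smooth1_cont Hh;
  have [K hK] := compact_support_bounded ch h0; first by exists K.
case: Hh => _ [h' dh Hh'].
(* The derivative at [x] is known to vanish only if [h] vanishes around [x], that is for [r < |x|];
   the larger radius makes the inequality strict. *)
have [||K' HK'] := IH h' (r + 1) => //.
  move=> x xr; have rx : r < `|x| by rewrite (lt_le_trans _ xr)// ltrDl.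
  have [_ <-] := dh x.
  have [_ ->//] : is_derive x (1 : R) h (0 : R).
  apply: (@near_eq_is_derive _ _ _ (cst 0)).
  near=> y; rewrite h0//; apply: ltW; near: y.
  have cn : continuous (fun x : R => `|x|) by move=> y; exact: norm_continuous.
  exact: (cvgr_gt _ (cn x)).
exists (Num.max K K'); split => //.
  by move=> x; rewrite le_max hK.
exists h' => //; apply: smooth1_bnd_le HK'.
by rewrite le_max lexx orbT.
Unshelve. all: end_near. Qed.

(** Finitely many derivatives are taken of the bump, so a normalised product of the truncated powers
    of [r + x] and [r - x] suffices. The window [[-3, 3]] holds the whole shifted support, because
    [|x| <= 1] and [r <= 1] confine [q] to [|q| <= 2]. *)
Lemma bump_exists (k : nat) (r : R) : 0 < r -> r <= 1 ->
  exists h K, [/\ 0 < K, smooth1_bnd K k h, forall x, r <= `|x| -> h x = 0 &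
    forall x, `|x| <= 1 -> int1 (- 3) 3 (fun q => h (x + q)) = 1].
Proof.
move=> r0 r1; pose g x : R := Num.max 0 x ^+ k.+1.
pose b x := g (1 * x + r) * g (-1 * x + r).
have sb : smooth1 k b.
  by apply: smooth1M; apply: smooth1_affine; exact: smooth1_truncated_power.
have cb := smooth1_cont sb.
have g0 x : 0 <= g x by rewrite exprn_ge0// le_max lexx.
have gN x : x <= 0 -> g x = 0 by move=> x0; rewrite /g (max_idPl x0) expr0n.
have b0 x : 0 <= b x by rewrite mulr_ge0.
have bout x : r <= `|x| -> b x = 0.
  rewrite ler_normr /b => /orP[h|h]; first by rewrite [X in _ * X]gN ?mulr0//; lra.
  by rewrite gN ?mul0r//; lra.
have bin x : `|x| < r -> 0 < b x.
  rewrite ltr_norml => /andP[h1 h2].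
  by rewrite mulr_gt0// exprn_gt0// lt_max; apply/orP; right; lra.
have N33 : - 3 <= 3 :> R by lra.
have [P dP] := primitive_exists N33 cb.
have mono (x y : R) : -3 <= x -> x <= y -> y <= 3 -> exists2 c, x <= c <= y & P y - P x = b c * (y - x).
  move=> h1 h2 h3.
  have dPxy z : z \in `[x, y] -> is_derive z (1 : R) P (b z).
    by rewrite in_itv /= => /andP[? ?]; apply: dP; apply/andP; split; lra.
  have dPo z : z \in `]x, y[ -> is_derive z (1 : R) P (b z).
    by move=> zxy; apply: dPxy; apply: subset_itv_oo_cc zxy.
  have cP : {within `[x, y], continuous P}.
    by apply: derivable_within_continuous => z /dPxy[].
  have [c] := MVT_segment h2 dPo cP.
  by rewrite in_itv /= => cxy E; exists c.
pose I := int1 (- 3) 3 b.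
have IE : I = P 3 - P (- 3) by exact: FTC_int1.
have I0 : 0 < I.
  (* The mean value theorem on three pieces: the outer two contribute a nonnegative amount, the
     middle one a positive amount since [b] is positive on [[- r / 2, r / 2]]. *)
  have [c1 _ E1] := mono (- 3) (- (r / 2)) ltac:(lra) ltac:(lra) ltac:(lra).
  have [c2 c2r E2] := mono (- (r / 2)) (r / 2) ltac:(lra) ltac:(lra) ltac:(lra).
  have [c3 _ E3] := mono (r / 2) 3 ltac:(lra) ltac:(lra) ltac:(lra).
  have B2 : 0 < b c2.
    by apply: bin; rewrite ltr_norml; case/andP: c2r => ? ?; apply/andP; split; lra.
  have -> : I = (P 3 - P (r / 2)) + (P (r / 2) - P (- (r / 2))) + (P (- (r / 2)) - P (- 3)).
    by rewrite IE; ring.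
  rewrite E1 E2 E3 ltr_pwDl//; last by rewrite mulr_ge0//; lra.
  by rewrite ltr_pwDr//; [rewrite mulr_gt0//; lra|rewrite mulr_ge0//; lra].
pose h x := I^-1 * b x.
have sh : smooth1 k h by apply: smooth1M => //; exact: smooth1_cst.
have ch := smooth1_cont sh.
have hout x : r <= `|x| -> h x = 0 by move=> /bout; rewrite /h => ->; rewrite mulr0.
have [K HK] := smooth1_bounded sh hout.
exists h, (Num.max K 1); split => //.
- by rewrite lt_max ltr01 orbT.
- by apply: smooth1_bnd_le HK; rewrite le_max lexx.
have int_h : Rintegral (@lebesgue_measure R) setT h = 1.
  rewrite (@int1_integral _ 3 _ h 0 1)//; last first.
    by move=> q q3; apply: hout; rewrite sub0r mul1r normrN; lra.
  rewrite mul1r (_ : int1 _ _ _ = int1 (- 3) 3 h).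
    by rewrite int1Z// mulVf// gt_eqF.
  apply: eq_int1 => q _; rewrite sub0r mul1r /h /b; congr (_ * _).
  by rewrite mulrC !mul1r !mulN1r opprK.
(* Evenness turns [h (x + q)] into [h (- x - q)], the form required by [int1_integral] with scale
   1. *)
have hN x : h (- x) = h x.
  by rewrite /h /b; congr (_ * _); rewrite mulrC !mul1r !mulN1r opprK.
move=> x x1; rewrite -[RHS]int_h (@int1_integral _ 3 _ h (- x) 1)//.
  by rewrite mul1r; apply: eq_int1 => q _; rewrite mul1r -opprD hN.
move=> q q3; rewrite mul1r -opprD hN; apply: hout.
have : `|q| <= `|x + q| + `|x|.
  by rewrite -{1}(addKr x q) addrC (le_trans (ler_normD _ _))// normrN.
lra.
Qed.

Context {d : nat}.
Local Notation ST := (R * 'rV[R]_d)%type.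
Local Notation ex i := ((0 : R, delta_mx 0 i : 'rV[R]_d) : ST).

Lemma cvg_sumr (T : Type) (F : set_system T) (I : Type) (s : seq I) (f : I -> T -> R) (l : I -> R) :
  Filter F -> (forall i, f i x @[x --> F] --> l i) ->
  \sum_(i <- s) f i x @[x --> F] --> \sum_(i <- s) l i.
Proof.
move=> FF fl; elim: s => [|i s IH].
  rewrite big_nil; under [fun x => _]eq_fun do rewrite big_nil; exact: cvg_cst.
rewrite big_cons; under [fun x => _]eq_fun do rewrite big_cons; exact: cvgD.
Qed.

(** The curve is differentiable coordinate by coordinate and [f] is of class C^1 in space only;
    [mvt_spatial] splits each quotient into coordinate quotients of [w] times partial derivatives
    near the base point. *)
Lemma chain_curve (f : ST -> R) (t : R) (w : R -> 'rV[R]_d) (w' : 'rV[R]_d) (u : R) :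
  (forall i q, derivable f q (ex i)) -> (forall i, continuous (pdx i f)) ->
  (forall k, is_derive u (1 : R) (fun r => w r 0 k) (w' 0 k)) ->
  is_derive u (1 : R) (fun r => f (t, w r)) (\sum_k w' 0 k * pdx k f (t, w u)).
Proof.
move=> df cf dw.
suff L : (fun h : R => h^-1 *: (((fun r => f (t, w r)) \o shift u) (h *: (1 : R)) - f (t, w u)))
    @ 0^' --> \sum_k w' 0 k * pdx k f (t, w u).
  split; first by apply/cvg_ex; eexists; exact: L.
  exact/cvg_lim.
have /choice[xi xiP] := fun h : R => mvt_spatial df (t, w u) (w (h *: (1 : R) + u) - w u).
have -> : (fun h : R => h^-1 *: (((fun r => f (t, w r)) \o shift u) (h *: (1 : R)) - f (t, w u))) =
  (fun h => \sum_k (h^-1 *: (((fun r => w r 0 k) \o shift u) (h *: (1 : R)) - w u 0 k)) *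
     pdx k f ((t, w u) + (0, xi h k))).
  apply/funext => h /=; have [_ E] := xiP h.
  have -> : (t, w (h *: 1 + u)) = (t, w u) + (0, w (h *: (1 : R) + u) - w u).
    by apply: (f_equal2 pair); [rewrite /= addr0|rewrite /= subrKC].
  rewrite E scaler_sumr; apply: eq_bigr => k _.
  by rewrite !mxE [LHS]mulrA.
apply: cvg_sumr => k; apply: cvgM.
  by have [d1 <-] := dw k; exact: d1.
apply/cvgrPdist_lt => e e0.
have [dl d0 H] := continuous_shift_near (cf k (t, w u)) e0.
have hw : \forall h \near (0 : R)^', forall i : 'I_d, `|w (h *: (1 : R) + u) 0 i - w u 0 i| < dl / 2.
  apply: filter_forall => i; apply: cvg_within.
  have c : {for u, continuous (fun r => w r 0 i)}.
    by apply/differentiable_continuous/derivable1_diffP; case: (dw i).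
  have ca : continuous (fun h : R => h *: (1 : R) + u).
    exact: (contVD (contVZ (@cont_id R) (@cst_continuous _ _ (1 : R))) (@cst_continuous _ _ u)).
  have c0 : {for (0 *: (1 : R) + u), continuous (fun r => w r 0 i)}.
    by rewrite scale0r add0r.
  have d2 : 0 < dl / 2 by rewrite divr_gt0.
  have /cvgrPdist_lt/(_ _ d2) := continuous_comp (ca 0) c0.
  by rewrite /= scale0r add0r; apply: filterS => h; rewrite distrC.
near=> h; rewrite distrC; apply: H.
apply: (@le_lt_trans _ _ (dl / 2)); last lra.
apply: norm_rV_le; first by rewrite divr_ge0// ltW.
move=> i; have [/(_ k i) + _] := xiP h; rewrite !mxE => /le_trans; apply.
by apply: ltW; move: i; near: h.
Unshelve. all: end_near. Qed.

Lemma bndC_coord (T : topologicalType) k K (h : R -> R) (i : 'I_d) (rho : R) : 0 < rho ->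
  smooth1_bnd K k h ->
  bndC (setT : set (T * ST)) k K rho^-1 (fun _ p => h (rho^-1 * p.2 0 i)).
Proof.
move=> r0; elim: k K h => [|k IH] K h [c b H].
all: have c' : continuous (fun z : T * ST => h (rho^-1 * z.2.2 0 i)); [
  have c1 := continuous_comp2 (continuous_comp2 (@cont_snd T ST) (@cont_snd R 'rV[R]_d)) (@continuous_coord _ _ i);
  exact: (continuous_comp2 (contZ (k := rho^-1) c1) c) |].
  by split.
split => // j; case: H => h' dh Hh'.
have D (p : ST) : is_derive p (ex j) (fun p : ST => h (rho^-1 * p.2 0 i))
    (((i == j)%:R * rho^-1) * h' (rho^-1 * p.2 0 i)).
  apply: is_derive_line_at0.
  have := @is_derive_affine h (rho^-1 * (i == j)%:R) (rho^-1 * p.2 0 i) 0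
    (h' (rho^-1 * p.2 0 i)).
  rewrite mulr0 add0r => /(_ (dh _)); rewrite [X in X * h' _]mulrC.
  rewrite (_ : (fun r : R => h (_ * r + _)) = (fun r : R => h (rho^-1 * (r *: ex j + p).2 0 i)))//.
  by apply/funext => r; rewrite /= !mxE eqxx /= mulrDr mulrAC mulrA.
split=> [_ p|]; first by case: (D p).
apply: (@bndC_ext _ _ _ _ _ _ _ (fun _ p => ((i == j)%:R * rho^-1) * h' (rho^-1 * p.2 0 i))).
  by move=> _ p; have [_ <-] := D p.
have [K0 m0] : 0 <= K /\ 0 <= rho^-1 by split; [exact: le_trans (b 0)|rewrite invr_ge0 ltW].
have H := bndCZ ((i == j)%:R * rho^-1) (IH _ _ Hh'); apply: bndC_le H => //.
  by rewrite mulr_ge0.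
rewrite mulrC ler_wpM2l// normrM (ger0_norm m0) ler_piMl//.
by case: eqP; rewrite ?normr0 ?normr1.
Qed.

(** With [E] the static profile this is the moving bump [phi]: all its dependence on time comes from
    [X], so its time derivative is a spatial derivative along the velocity of [X]. *)
Definition comove (X : R -> 'rV[R]_d) (E : ST -> R) : ST -> R :=
  fun p => E (0, p.2 - X p.1).

Lemma is_derive_comove X E i p : derivable E (0, p.2 - X p.1) (ex i) ->
  is_derive p (ex i) (comove X E) (comove X (pdx i E) p).
Proof.
have Q : (fun h : R => h^-1 *: ((comove X E \o shift p) (h *: ex i) - comove X E p)) =
    (fun h : R => h^-1 *: ((E \o shift (0, p.2 - X p.1)) (h *: ex i) - E (0, p.2 - X p.1))).
  apply/funext => h; rewrite /comove /=; congr (_ *: (E _ - _)).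
  apply: (f_equal2 pair); first by rewrite /= addr0 [h *: 0]mulr0.
  by rewrite /= [h *: 0]mulr0 add0r addrA.
by move=> dE; split; rewrite /derivable /derive Q.
Qed.

Lemma bndC_comove (T : topologicalType) X k C mu E : continuous X ->
  bndC (setT : set (T * ST)) k C mu (fun _ => E) ->
  bndC (setT : set (T * ST)) k C mu (fun _ => comove X E).
Proof.
move=> cX; elim: k C E => [|k IH] C E [c b H].
all: have c' : continuous (fun z : T * ST => comove X E z.2); [
  have c1 := contVD (continuous_comp2 (@cont_snd T ST) (@cont_snd R 'rV[R]_d))
    (contVZ (@cst_continuous _ _ (-1 : R)) (continuous_comp2 (continuous_comp2 (@cont_snd T ST) (@cont_fst R 'rV[R]_d)) cX));
  have := continuous_comp2 (continuous_pair (@cont_fst T ST) (continuous_pair (@cst_continuous _ _ (0 : R)) c1)) c;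
  by rewrite /comove; under [X in continuous X -> _]eq_fun do rewrite scaleN1r |].
  by split => // z _; exact: (b (z.1, (0, _)) I).
split => //; first by move=> z _; exact: (b (z.1, (0, _)) I).
move=> i; have [h1 h2] := H i; split.
  by move=> th p; case: (is_derive_comove (h1 th (0, p.2 - X p.1))).
apply: bndC_ext (IH _ _ h2) => th p.
by have [_ <-] := is_derive_comove (h1 th (0, p.2 - X p.1)).
Qed.

Lemma comove_pdt (X : R -> 'rV[R]_d) (E : ST -> R) (X' : R -> 'rV[R]_d) (p : ST) :
  (forall i q, derivable E q (ex i)) -> (forall i, continuous (pdx i E)) ->
  (forall (t : R) k, is_derive t (1 : R) (fun r => X r 0 k) (X' t 0 k)) ->
  is_derive p ((1, 0) : ST) (comove X E) (- \sum_k X' p.1 0 k * comove X (pdx k E) p).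
Proof.
move=> dE cE dX.
pose w r := p.2 - X (r + p.1).
have dw k : is_derive (0 : R) (1 : R) (fun r => w r 0 k) ((- X' p.1) 0 k).
  have h1 : is_derive (0 : R) (1 : R) (fun r : R => X (1 * r + p.1) 0 k) (1 * X' p.1 0 k).
    apply: (@is_derive_affine (fun r => X r 0 k)).
    by rewrite mulr0 add0r.
  have := is_deriveB (is_derive_cst (p.2 0 k) (0 : R) (1 : R)) h1.
  rewrite mul1r sub0r (_ : _ - _ = (fun r => w r 0 k)) ?mxE//.
  by apply/funext => r; rewrite /w !mxE -[in RHS](mul1r r).
apply: is_derive_line_at0.
have := chain_curve 0 dE cE dw.
rewrite (_ : (fun r => E (0, w r)) = (fun r : R => comove X E (r *: (1, 0) + p))); last first.
  apply/funext => r; rewrite /comove /w /=; congr (E (_, _ - X (_ + _))).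
    by rewrite scaler0 add0r.
  by rewrite [r *: 1]mulr1.
rewrite (_ : \sum_k _ = - \sum_k X' p.1 0 k * comove X (pdx k E) p)//.
rewrite -sumrN; apply: eq_bigr => k _.
by rewrite mxE mulNr /comove /w add0r.
Qed.

End Profiles.

(** * Averages along segments *)

Section AveragedOperator.
Context {R : realType} {d : nat}.
Local Notation ST := (R * 'rV[R]_d)%type.
Local Notation ex i := ((0 : R, delta_mx 0 i : 'rV[R]_d) : ST).
Local Notation et := ((1 : R, 0 : 'rV[R]_d) : ST).
Local Notation bndF k C mu f := (bndC (setT : set (R * ST)) k C mu (fun _ => f)).

(** One boolean covers both terms of the inverse, the average over segments and the endpoint term,
    so that each estimate is proved once. *)
Definition avg (b : bool) (g : R -> R) : R := if b then int1 0 1 g else g 1.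

Definition avgbox (b : bool) (F : R * 'rV[R]_d -> R) : R :=
  avg b (fun s => boxint 3 (fun q => F (s, q))).

Let c3 : 0 <= 3 :> R. Proof. by []. Qed.

Lemma boxint_slice_continuous (F : R * 'rV[R]_d -> R) : continuous F ->
  continuous (fun s => boxint 3 (fun q => F (s, q))).
Proof. by move=> cF; exact: boxint_continuous. Qed.

Lemma slice_pair_continuous (T S : topologicalType) (F : T * S -> R) (s : T) :
  continuous F -> continuous (fun q => F (s, q)).
Proof.
by move=> cF; exact: (continuous_comp2 (continuous_pair (@cst_continuous _ _ s) (@cont_id S)) cF).
Qed.

Lemma eq_avgbox b F G : (forall s q, 0 <= s <= 1 -> in_box 3 q -> F (s, q) = G (s, q)) ->
  avgbox b F = avgbox b G.
Proof.
move=> FG; case: b; rewrite /avgbox /avg.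
  by apply: eq_int1 => s s01; apply: eq_boxint => // q qb; exact: FG.
by apply: eq_boxint => // q qb; apply: FG => //; rewrite ler01 lexx.
Qed.

Lemma avgboxD b F G : continuous F -> continuous G ->
  avgbox b (fun z => F z + G z) = avgbox b F + avgbox b G.
Proof.
move=> cF cG; case: b; rewrite /avgbox /avg.
  rewrite -int1D; [|exact: boxint_slice_continuous|exact: boxint_slice_continuous].
  by apply: eq_int1 => s _; apply: boxintD => //; exact: slice_pair_continuous.
by apply: boxintD => //; exact: slice_pair_continuous.
Qed.

Lemma avgboxZ b (k : R) F : continuous F -> avgbox b (fun z => k * F z) = k * avgbox b F.
Proof.
move=> cF; case: b; rewrite /avgbox /avg.
  rewrite -int1Z; last exact: boxint_slice_continuous.
  by apply: eq_int1 => s _; apply: boxintZ => //; exact: slice_pair_continuous.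
by apply: boxintZ => //; exact: slice_pair_continuous.
Qed.

Lemma avgbox0 b : avgbox b (fun=> 0) = 0.
Proof.
have := @avgboxZ b 0 (fun=> 0) (@cst_continuous _ _ 0); rewrite [X in _ = X]mul0r => H.
by rewrite -[RHS]H; apply: eq_avgbox => s q _ _; rewrite mulr0.
Qed.

Lemma avgbox_sum b (I : Type) (s : seq I) (F : I -> R * 'rV[R]_d -> R) :
  (forall i, continuous (F i)) ->
  avgbox b (fun q => \sum_(i <- s) F i q) = \sum_(i <- s) avgbox b (F i).
Proof.
move=> cF; elim: s => [|i s IH].
  by rewrite big_nil -[RHS](avgbox0 b); apply: eq_avgbox => ? ? _ _; rewrite big_nil.
rewrite big_cons -IH -avgboxD//; last exact: cont_sum.
by apply: eq_avgbox => ? ? _ _; rewrite big_cons.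
Qed.

Lemma bndC_avg b (D : set ST) k C mu (H : R -> ST -> R) :
  bndC [set z : R * ST | 0 < z.1 <= 1 /\ D z.2] k C mu H ->
  bndC [set z : R * ST | D z.2] k C mu (fun _ p => avg b (fun s => H s p)).
Proof.
move=> HH; case: b; rewrite /avg.
  have := @bndC_int1 R d R [set z | D z.2] [set z | 0 < z.1.2 <= 1 /\ D z.2] k C mu
    (fun x p => H x.2 p) 0 1 ler01.
  rewrite subr0 mulr1; apply; first by [].
  exact: (bndC_reparam (@cont_snd R R) HH).
apply: bndC_sub (bndC_reparam (@cst_continuous R _ (1 : R)) HH) => -[u p] /= Dp.
by rewrite ltr01 lexx.
Qed.

Lemma bndC_box (D : set (R * ST)) k C mu (F : R * 'rV[R]_d -> ST -> R) :
  bndC [set z | in_box 3 z.1.2 /\ D (z.1.1, z.2)] k C mu F ->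
  bndC D k (C * 6 ^+ d) mu (fun s p => boxint 3 (fun q => F (s, q) p)).
Proof.
move=> HF; have -> : 6 = 3 + 3 :> R by rewrite -natrD.
by apply: (bndC_boxint c3 _ HF) => s q p Dp qb.
Qed.

Lemma avgbox_is_derive b (F G : R * 'rV[R]_d -> ST -> R) (u : ST) :
  continuous (fun z : (R * 'rV[R]_d) * ST => F z.1 z.2) ->
  continuous (fun z : (R * 'rV[R]_d) * ST => G z.1 z.2) ->
  (forall z p, is_derive p u (F z) (G z p)) ->
  forall p, is_derive p u (fun p => avgbox b (fun z => F z p)) (avgbox b (fun z => G z p)).
Proof.
move=> cF cG dF p.
have c1 (H : R * 'rV[R]_d -> ST -> R) s : continuous (fun z : (R * 'rV[R]_d) * ST => H z.1 z.2) ->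
    continuous (fun x : ST * 'rV[R]_d => H (s, x.2) x.1).
  move=> cH; have c := continuous_pair (continuous_pair (@cst_continuous _ _ s)
    (@cont_snd ST 'rV[R]_d)) (@cont_fst ST 'rV[R]_d).
  exact: (continuous_comp2 c cH).
have D1 s q : is_derive q u (fun p => boxint 3 (fun y => F (s, y) p))
    (boxint 3 (fun y => G (s, y) q)).
  exact: (boxint_is_derive c3 (c1 F s cF) (c1 G s cG) (fun p y => dF (s, y) p)).
case: b; rewrite /avgbox /avg; last exact: D1.
have c2 (H : R * 'rV[R]_d -> ST -> R) : continuous (fun z : (R * 'rV[R]_d) * ST => H z.1 z.2) ->
    continuous (fun x : ST * R => boxint 3 (fun y => H (x.2, y) x.1)).
  move=> cH.
  apply: (@boxint_continuous _ _ c3 _ _ (fun z : (ST * R) * 'rV_d => H (z.1.2, z.2) z.1.1)).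
  have c := continuous_pair (continuous_pair (continuous_comp2 (@cont_fst (ST * R)%type 'rV[R]_d) (@cont_snd ST R))
    (@cont_snd (ST * R)%type 'rV[R]_d)) (continuous_comp2 (@cont_fst (ST * R)%type 'rV[R]_d) (@cont_fst ST R)).
  exact: (continuous_comp2 c cH).
exact: (int1_is_derive ler01 (c2 F cF) (c2 G cG) (fun p s => D1 s p)).
Qed.

Lemma bndC_at (T : topologicalType) (D : set (T * ST)) k C mu f (h : T -> 'rV[R]_d) :
  continuous h -> bndF k C mu f -> bndC D k C mu (fun th p => f (p + (0, h th))).
Proof.
move=> ch Hf; have H1 := bndC_reparam (@cst_continuous T _ (0 : R)) Hf.
by apply: bndC_sub (bndC_translate ch H1).
Qed.

Lemma reg_at (T : topologicalType) k f (h : T -> 'rV[R]_d) :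
  continuous h -> spatialC k f ->
  bndC (set0 : set (T * ST)) k 0 0 (fun th p => f (p + (0, h th))).
Proof.
move=> ch Hf; have H1 := spatialC_bndC T 0 0 Hf.
exact: (bndC_sub _ (bndC_translate ch H1)).
Qed.

(** With constants 0 over [set0], the rules for [bndC] become a calculus of pure regularity. *)
Lemma regD (T : topologicalType) k (F G : T -> ST -> R) :
  bndC set0 k 0 0 F -> bndC set0 k 0 0 G -> bndC set0 k 0 0 (fun th p => F th p + G th p).
Proof. by move=> HF HG; have := bndCD HF HG; rewrite addr0. Qed.

Lemma regM (T : topologicalType) k (F G : T -> ST -> R) :
  bndC set0 k 0 0 F -> bndC set0 k 0 0 G -> bndC set0 k 0 0 (fun th p => F th p * G th p).
Proof. by move=> HF HG; have := bndCM HF HG; rewrite addr0 mulr0. Qed.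

Lemma reg_sum (T : topologicalType) k (I : Type) (s : seq I) (F : I -> T -> ST -> R) :
  (forall i, bndC set0 k 0 0 (F i)) -> bndC set0 k 0 0 (fun th p => \sum_(i <- s) F i th p).
Proof. by move=> HF; have := bndC_sum s (lexx 0) HF; rewrite mulr0. Qed.

Lemma reg_param (T : topologicalType) k (f : T -> R) : continuous f ->
  bndC (set0 : set (T * ST)) k 0 0 (fun th _ => f th).
Proof. by move=> cf; exact: bndC_param. Qed.

Lemma regB (T : topologicalType) k (F G : T -> ST -> R) :
  bndC set0 k 0 0 F -> bndC set0 k 0 0 G -> bndC set0 k 0 0 (fun th p => F th p - G th p).
Proof.
move=> HF HG; have := regD HF (regM (reg_param k (@cst_continuous T _ (-1 : R))) HG).
by apply: bndC_ext => th p; rewrite mulN1r.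
Qed.

Lemma time_only_pdx (c : R -> R) i p : is_derive p (ex i) (fun p : ST => c p.1) 0.
Proof.
apply: is_derive_line_at0.
rewrite (_ : (fun r : R => _) = cst (c p.1)); first exact: is_derive_cst.
by apply/funext => r; rewrite /= [r *: 0]mulr0 add0r.
Qed.

Lemma bndC_time_only (T : topologicalType) k (c : R -> R) : continuous c ->
  bndC (set0 : set (T * ST)) k 0 0 (fun _ p => c p.1).
Proof.
move=> cc; have c' := continuous_comp2 (continuous_comp2 (@cont_snd T ST) (@cont_fst R 'rV[R]_d)) cc.
case: k => [|k]; split => // i; split=> [_ p|].
  by case: (time_only_pdx c i p).
apply: (@bndC_ext _ _ _ _ _ _ _ (fun _ _ => 0)).
  by move=> _ p; have [_ <-] := time_only_pdx c i p.
by apply: bndC_cst; rewrite ?normr0 ?mulr0.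
Qed.

Lemma translate_pdt f (w : 'rV[R]_d) p : derivable f (p + (0, w)) et ->
  is_derive p et (fun x => f (x + (0, w))) (pdt f (p + (0, w))).
Proof. by move=> /derivableP df; exact: is_derive_translate. Qed.

(** The factor [c] is what lets a spatial derivative of [f] be traded for a derivative in the
    integration variable [q]. *)
Lemma is_derive_dilation f i (p : ST) (c : R) (q : 'rV[R]_d) :
  derivable f (p + (0, c *: q)) (ex i) ->
  is_derive q (delta_mx 0 i : 'rV[R]_d) (fun q => f (p + (0, c *: q)))
    (c * pdx i f (p + (0, c *: q))).
Proof.
move=> /derivableP df; apply: is_derive_line_at0.
have h : is_derive (c * 0 + 0 : R) (1 : R) (fun r : R => f (r *: ex i + (p + (0, c *: q))))
    (pdx i f (p + (0, c *: q))).
  by apply: is_derive_line; rewrite mulr0 addr0 scale0r add0r.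
have := is_derive_affine h.
rewrite (_ : (fun r : R => f (_ *: _ + _)) = (fun r : R => f (p + (0, c *: (r *: delta_mx 0 i + q)))))//.
apply/funext => r; rewrite addr0 scale_pair0 addrCA add_pair0; congr (f (_ + (_, _))).
by rewrite scalerDr scalerA.
Qed.

Lemma diff_bound k (M mu c : R) (g : ST -> R) : 0 <= M ->
  spatialC k.+1 g -> (forall i, bndF k M mu (pdx i g)) ->
  forall z : 'rV[R]_d * ST, in_box 3 z.1 ->
   `|g z.2 - g (z.2 + (0, c *: z.1))| <= M * (`|c| * (3 * d%:R)).
Proof.
move=> M0 Hg HM [q p] /= qb; rewrite distrC.
have dg i p' : derivable g p' (ex i) by case: Hg => _ /(_ i)[].
have bg i p' : `|pdx i g p'| <= M by exact: (bndC_bnd (HM i) (z := (0, p')) I).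
apply: (le_trans (spatial_lipschitz dg bg _ _)); rewrite ler_wpM2l//.
apply: (@le_trans _ _ (\sum_(k < d) `|c| * 3)).
  by apply: ler_sum => i _; rewrite mxE normrM ler_wpM2l.
by rewrite sumr_const card_ord -[leLHS]mulr_natr mulrA.
Qed.

(** A spatial derivative of the difference is the difference of the derivative, so the factor [|c|]
    is gained at every order. Divided by [c], the bound is uniform in [c]; this keeps the quotient
    of [v] harmless as [s] tends to 0. *)
Lemma bndC_diff k (M mu c : R) (g : ST -> R) : 0 <= M -> 0 <= mu ->
  spatialC k.+1 g -> (forall i, bndF k M mu (pdx i g)) ->
  bndC [set z : 'rV[R]_d * ST | in_box 3 z.1] k (M * (`|c| * (3 * d%:R))) mu
     (fun q p => g p - g (p + (0, c *: q))).
Proof.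
elim: k M g => [|k IH] M g M0 mu0 Hg HM.
all: have ch : continuous (fun q : 'rV[R]_d => c *: q) by exact: scaler_continuous.
all: have H0 := spatialC_bndC 'rV[R]_d 0 0 Hg.
all: have H1 := reg_at ch Hg.
all: have H2 := regB H0 H1.
all: have b := diff_bound c M0 Hg HM.
  by split => //; exact: (bndC_cont H2).
split => //; first exact: (bndC_cont H2).
move=> i; split; first (move=> th p; exact: (bndC_der H2)).
refine (@bndC_ext R d 'rV[R]_d _ _ _ _ (fun q p => pdx i g p - pdx i g (p + (0, c *: q))) _ _ _).
  move=> q p; have d0 : derivable g p (ex i) := @bndC_der _ _ _ _ _ _ _ _ i H0 q p.
  have d1 := @bndC_der _ _ _ _ _ _ _ _ i H1 q p.
  rewrite [RHS](deriveB d0 d1).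
  by congr (_ - _); have [_ ->] := @pdx_translate _ _ i g (0, c *: q) p (@bndC_der _ _ _ _ _ _ _ _ i H0 q _).
rewrite (_ : M * _ * mu = M * mu * (`|c| * (3 * d%:R))); last by rewrite mulrAC.
apply: IH => //; first exact: mulr_ge0.
  exact: spatialC_pdx.
move=> j; rewrite pdxC; last exact: (spatialC_leq _ Hg).
exact: (bndC_pdx i (HM j)).
Qed.

End AveragedOperator.

(** * The advective derivative of a segment average *)

Section Commutator.
Context {R : realType} {d : nat}.
Local Notation ST := (R * 'rV[R]_d)%type.
Local Notation ex i := ((0 : R, delta_mx 0 i : 'rV[R]_d) : ST).
Local Notation et := ((1 : R, 0 : 'rV[R]_d) : ST).
Local Notation bndF k C mu f := (bndC (setT : set (R * ST)) k C mu (fun _ => f)).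
Implicit Types (f E psi : ST -> R) (P : 'rV[R]_d -> R) (z : R * 'rV[R]_d) (p : ST).

Variables (L : nat) (v : vfield R d) (X : R -> 'rV[R]_d) (rho : R).
Hypothesis Hv : forall l, spatialC L.+1 (vcomp v l).
Hypothesis HX : forall (t : R) k,
  is_derive t (1 : R) (fun r => X r 0 k) (v (t, X t) 0 k).

Definition shift_lo z : 'rV[R]_d := - (z.1 * rho) *: z.2.
Definition shift_hi z : 'rV[R]_d := ((1 - z.1) * rho) *: z.2.

Lemma shift_lo_continuous : continuous shift_lo.
Proof.
apply: (contVZ (k := fun z => - (z.1 * rho))); last exact: cont_snd.
apply: contN; apply: contM; [exact: cont_fst|exact: cst_continuous].
Qed.

Lemma shift_hi_continuous : continuous shift_hi.
Proof.
apply: (contVZ (k := fun z => (1 - z.1) * rho)); last exact: cont_snd.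
apply: contM; last exact: cst_continuous.
by apply: contD; [exact: cst_continuous|apply: contN; exact: cont_fst].
Qed.

Definition segment_kernel f psi P z p : R :=
  P z.2 * (f (p + (0, shift_lo z)) * psi (p + (0, shift_hi z))).

(* For [b = true], the average over [s] in [0, 1] of the box integral; for
   [b = false], its value at the endpoint [s = 1], where [shift_hi] vanishes. *)
Definition segment_avg b f psi P p : R := avgbox b (fun z => segment_kernel f psi P z p).

(** On the box of half-side 3 the value 9 bounds [q_j q_k], and a fortiori [q_j] and the first
    derivatives of both. *)
Definition weight P := continuous P /\ forall q, in_box 3 q -> `|P q| <= 9.

Lemma bndC_segment_kernel (D : set ((R * 'rV[R]_d) * ST)) k A B la mu f psi P :
  weight P -> (forall x, D x -> in_box 3 x.1.2) ->
  bndF k A la f -> bndF k B mu psi ->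
  bndC D k (9 * A * B) (la + mu) (segment_kernel f psi P).
Proof.
move=> [cP bP] Db Hf Hpsi; rewrite -mulrA -[X in bndC _ _ _ X _]add0r.
apply: bndCM; last first.
  exact: (bndCM (bndC_at _ shift_lo_continuous Hf) (bndC_at _ shift_hi_continuous Hpsi)).
apply: bndC_param => //; first exact: (continuous_comp2 (@cont_snd _ _) cP).
by move=> x /Db; exact: bP.
Qed.

Lemma bndC_avgbox b (D : set ST) k C mu (F : R * 'rV[R]_d -> ST -> R) :
  bndC [set z : (R * 'rV[R]_d) * ST | in_box 3 z.1.2 /\ 0 < z.1.1 <= 1 /\ D z.2] k C mu F ->
  bndC [set z : R * ST | D z.2] k (C * 6 ^+ d) mu (fun _ p => avgbox b (fun z => F z p)).
Proof. by move=> HF; apply: bndC_avg; exact: (bndC_box HF). Qed.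

Lemma segment_avg_bndF b k A B la mu f psi P : weight P ->
  bndF k A la f -> bndF k B mu psi ->
  bndF k (9 * A * B * 6 ^+ d) (la + mu) (segment_avg b f psi P).
Proof.
move=> wP Hf Hpsi; apply: (@bndC_avgbox b setT).
by apply: bndC_segment_kernel => // z [].
Qed.

Lemma X_continuous : continuous X.
Proof.
apply: continuous_rV => i t.
by apply/differentiable_continuous/derivable1_diffP; case: (HX t i).
Qed.

Lemma vel_continuous i : continuous (fun t => v (t, X t) 0 i).
Proof.
have [c _] := Hv i.
exact: (continuous_comp2 (continuous_pair (@cont_id R) X_continuous) c).
Qed.

Section Advected.
Variables (f E : ST -> R) (P : 'rV[R]_d -> R) (B mu : R).
Hypothesis Hf : advectedC v L.+1 f.
Hypothesis HE : bndF L.+2 B mu E.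
Hypothesis wP : weight P.

Notation psi := (comove X E).
Notation dpsi i := (comove X (pdx i E)).

Let Hpsi := bndC_comove X_continuous HE.
Let Hdpsi i := bndC_comove X_continuous (bndC_pdx i HE).

Lemma pdx_comove i : pdx i psi = dpsi i.
Proof.
apply/funext => p.
have dE : derivable E (0, p.2 - X p.1) (ex i) := @bndC_der _ _ _ _ _ _ _ _ i HE 0 _.
by have [_ e] := is_derive_comove dE; exact: e.
Qed.

(** The three lines are the transported source, the commutator of [v . grad] with the shift to
    [x - s rho q], and the slip of the bump, which moves with the velocity at [X(t)] and not with
    that at [x]. *)
Definition Dt_kernel z p : R :=
  P z.2 * (Dt v f (p + (0, shift_lo z)) * psi (p + (0, shift_hi z))) +
  P z.2 * ((\sum_i (v p 0 i - v (p + (0, shift_lo z)) 0 i) *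
      pdx i f (p + (0, shift_lo z))) * psi (p + (0, shift_hi z))) +
  P z.2 * (f (p + (0, shift_lo z)) *
    \sum_i (v p 0 i - v (p.1, X p.1) 0 i) * dpsi i (p + (0, shift_hi z))).

(** For [f] the time derivative is only assumed to exist. Written as [Dt v f] minus [v . grad f] it
    is visibly continuous, as differentiation under the integral demands. *)
Definition pdt_kernel z p : R :=
  P z.2 * (Dt v f (p + (0, shift_lo z)) * psi (p + (0, shift_hi z))) +
  P z.2 * ((\sum_i (- v (p + (0, shift_lo z)) 0 i) *
      pdx i f (p + (0, shift_lo z))) * psi (p + (0, shift_hi z))) +
  P z.2 * (f (p + (0, shift_lo z)) *
    \sum_i (- v (p.1, X p.1) 0 i) * dpsi i (p + (0, shift_hi z))).

Definition pdx_kernel i z p : R :=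
  P z.2 * (pdx i f (p + (0, shift_lo z)) * psi (p + (0, shift_hi z)) +
           f (p + (0, shift_lo z)) * dpsi i (p + (0, shift_hi z))).

Lemma Dt_kernelE z p : Dt_kernel z p = pdt_kernel z p + \sum_i v p 0 i * pdx_kernel i z p.
Proof.
rewrite /Dt_kernel /pdt_kernel /pdx_kernel.
set a := p + (0, shift_lo z); set c := p + (0, shift_hi z).
have -> : \sum_i v p 0 i * (P z.2 * (pdx i f a * psi c + f a * dpsi i c)) =
   P z.2 * ((\sum_i v p 0 i * pdx i f a) * psi c) + P z.2 * (f a * \sum_i v p 0 i * dpsi i c).
  rewrite mulr_suml !mulr_sumr -big_split; apply: eq_bigr => i _ /=; ring.
have e1 : \sum_i (v p 0 i - v a 0 i) * pdx i f a =
    \sum_i v p 0 i * pdx i f a + \sum_i (- v a 0 i) * pdx i f a.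
  by rewrite -big_split; apply: eq_bigr => i _; rewrite /= -mulrDl.
have e2 : \sum_i (v p 0 i - v (p.1, X p.1) 0 i) * dpsi i c =
    \sum_i v p 0 i * dpsi i c + \sum_i (- v (p.1, X p.1) 0 i) * dpsi i c.
  by rewrite -big_split; apply: eq_bigr => i _; rewrite /= -mulrDl.
rewrite e1 e2; ring.
Qed.

Local Notation TH := (R * 'rV[R]_d)%type.
Let regular k F := bndC (set0 : set (TH * ST)) k 0 0 F.

Let rP k : regular k (fun z _ => P z.2).
Proof. by apply: reg_param; exact: (continuous_comp2 (@cont_snd _ _) wP.1). Qed.

Let rf : regular L.+1 (fun z p => f (p + (0, shift_lo z))).
Proof. by apply: reg_at; [exact: shift_lo_continuous|case: Hf]. Qed.

Let rDf : regular L (fun z p => Dt v f (p + (0, shift_lo z))).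
Proof. by apply: reg_at; [exact: shift_lo_continuous|case: Hf]. Qed.

Let rdf i : regular L (fun z p => pdx i f (p + (0, shift_lo z))).
Proof. by apply: reg_at; [exact: shift_lo_continuous|case: Hf => /(spatialC_pdx i)]. Qed.

Let rva i : regular L.+1 (fun z p => v (p + (0, shift_lo z)) 0 i).
Proof. exact: (reg_at shift_lo_continuous (Hv i)). Qed.

Let rv i : regular L.+1 (fun z p => v p 0 i).
Proof. exact: (spatialC_bndC _ 0 0 (Hv i)). Qed.

Let rvX i k : regular k (fun z p => v (p.1, X p.1) 0 i).
Proof. exact: (bndC_time_only _ k (@vel_continuous i)). Qed.

Let rpsi : regular L.+1 (fun z p => psi (p + (0, shift_hi z))).
Proof.
have H : bndF L.+1 B mu psi := bndC_pred Hpsi.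
exact: (bndC_regular _ _ (bndC_at set0 shift_hi_continuous H)).
Qed.

Let rdpsi i : regular L.+1 (fun z p => dpsi i (p + (0, shift_hi z))).
Proof. exact: (bndC_regular _ _ (bndC_at set0 shift_hi_continuous (Hdpsi i))). Qed.

Let low k F : regular k.+1 F -> regular k F. Proof. exact: bndC_pred. Qed.

Lemma Dt_kernel_regular : regular L Dt_kernel.
Proof.
have rpsi' := low rpsi; have rf' := low rf.
apply: regD; first apply: regD.
- exact: (regM (rP _) (regM rDf rpsi')).
- apply: (regM (rP _)); apply: (regM _ rpsi'); apply: reg_sum => i.
  exact: (regM (regB (low (rv i)) (low (rva i))) (rdf i)).
- apply: (regM (rP _)); apply: (regM rf'); apply: reg_sum => i.
  exact: (regM (regB (low (rv i)) (rvX i _)) (low (rdpsi i))).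
Qed.

Lemma pdt_kernel_continuous : continuous (fun x : TH * ST => pdt_kernel x.1 x.2).
Proof.
have cc k F : regular k F -> regular 0 F by apply: bndC_leq.
apply: (@bndC_cont _ _ _ set0 0 0 0 pdt_kernel).
have rN F : regular 0 F -> regular 0 (fun z p => - F z p).
  move=> HF; have := regB (reg_param 0 (@cst_continuous _ _ (0 : R))) HF.
  by apply: bndC_ext => z p; rewrite sub0r.
apply: regD; first apply: regD.
- exact: (regM (rP _) (regM (cc _ _ rDf) (cc _ _ rpsi))).
- apply: (regM (rP _)); apply: (regM _ (cc _ _ rpsi)).
  by apply: reg_sum => i; exact: (regM (rN _ (cc _ _ (rva i))) (cc _ _ (rdf i))).
- apply: (regM (rP _)); apply: (regM (cc _ _ rf)).
  by apply: reg_sum => i; exact: (regM (rN _ (rvX i 0)) (cc _ _ (rdpsi i))).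
Qed.

Lemma pdx_kernel_continuous i : continuous (fun x : TH * ST => pdx_kernel i x.1 x.2).
Proof.
have cc k F : regular k F -> regular 0 F by apply: bndC_leq.
apply: (@bndC_cont _ _ _ set0 0 0 0 (pdx_kernel i)).
apply: (regM (rP _)); apply: regD.
  exact: (regM (cc _ _ (rdf i)) (cc _ _ rpsi)).
exact: (regM (cc _ _ rf) (cc _ _ (rdpsi i))).
Qed.

Lemma segment_kernel_continuous : continuous (fun x : TH * ST => segment_kernel f psi P x.1 x.2).
Proof.
apply: (@bndC_cont _ _ _ set0 L.+1 0 0 (segment_kernel f psi P)).
exact: (regM (rP _) (regM rf rpsi)).
Qed.

Lemma segment_kernel_pdx i z p : is_derive p (ex i) (segment_kernel f psi P z) (pdx_kernel i z p).
Proof.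
have dfa : is_derive p (ex i) (fun p => f (p + (0, shift_lo z))) (pdx i f (p + (0, shift_lo z))).
  by apply: pdx_translate; case: Hf => -[_ /(_ i)[]].
have dpa : is_derive p (ex i) (fun p => psi (p + (0, shift_hi z))) (dpsi i (p + (0, shift_hi z))).
  rewrite -pdx_comove; apply: pdx_translate.
  exact: (@bndC_der _ _ _ _ _ _ _ _ i Hpsi 0).
have h : is_derive p (ex i) (segment_kernel f psi P z) _ := is_deriveZ (P z.2) (is_deriveM dfa dpa).
apply: is_derive_eq h _; rewrite /pdx_kernel [LHS]/GRing.scale /=; congr (_ * _).
by rewrite addrC; congr (_ + _); rewrite [LHS]mulrC.
Qed.

Lemma segment_kernel_pdt z p : is_derive p et (segment_kernel f psi P z) (pdt_kernel z p).
Proof.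
have dfa : is_derive p et (fun p => f (p + (0, shift_lo z))) (pdt f (p + (0, shift_lo z))).
  by apply: translate_pdt; case: Hf.
have dpa : is_derive p et (fun p => psi (p + (0, shift_hi z)))
    (- \sum_k v (p.1, X p.1) 0 k * dpsi k (p + (0, shift_hi z))).
  apply: is_derive_translate.
  have dE i q : derivable E q (ex i) by exact: (@bndC_der _ _ _ _ _ _ _ _ i HE 0 q).
  have cE i : continuous (pdx i E).
    have c := bndC_cont (bndC_pdx i HE).
    exact: (continuous_comp2 (continuous_pair (@cst_continuous _ _ (0 : R)) (@cont_id ST)) c).
  have := @comove_pdt R d X E (fun t => v (t, X t)) (p + (0, shift_hi z)) dE cE HX.
  by rewrite [(p + _).1]/= addr0.
have h : is_derive p et (segment_kernel f psi P z) _ := is_deriveZ (P z.2) (is_deriveM dfa dpa).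
apply: is_derive_eq h _; rewrite /pdt_kernel [LHS]/GRing.scale /=.
set a := p + (0, shift_lo z); set c := p + (0, shift_hi z).
have -> : Dt v f a = pdt f a + \sum_i v a 0 i * pdx i f a by [].
have -> : \sum_i (- v a 0 i) * pdx i f a = - \sum_i v a 0 i * pdx i f a.
  by rewrite -sumrN; apply: eq_bigr => i _; rewrite mulNr.
have -> : \sum_i (- v (p.1, X p.1) 0 i) * dpsi i c = - \sum_i v (p.1, X p.1) 0 i * dpsi i c.
  by rewrite -sumrN; apply: eq_bigr => i _; rewrite mulNr.
rewrite [f a *: _]/GRing.scale /= [psi c *: _]/GRing.scale /=; ring.
Qed.

Lemma segment_avg_pdx b i p : is_derive p (ex i) (segment_avg b f psi P) (avgbox b (fun z => pdx_kernel i z p)).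
Proof.
exact: (avgbox_is_derive b segment_kernel_continuous (pdx_kernel_continuous (i := i)) (fun z p => segment_kernel_pdx i z p)).
Qed.

Lemma segment_avg_pdt b p : is_derive p et (segment_avg b f psi P) (avgbox b (fun z => pdt_kernel z p)).
Proof.
exact: (avgbox_is_derive b segment_kernel_continuous pdt_kernel_continuous (fun z p => segment_kernel_pdt z p)).
Qed.

Lemma segment_avg_Dt b p : Dt v (segment_avg b f psi P) p = avgbox b (fun z => Dt_kernel z p).
Proof.
have cf (F : TH -> ST -> R) : continuous (fun x : TH * ST => F x.1 x.2) -> continuous (fun z => F z p).
  by move=> cF; exact: (continuous_comp2 (continuous_pair (@cont_id TH) (@cst_continuous _ _ p)) cF).
have ct := cf _ pdt_kernel_continuous.
have cx i := cf _ (pdx_kernel_continuous (i := i)).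
rewrite /Dt; have [_ e] := segment_avg_pdt b p; rewrite [pdt _ _]e {e}.
have -> : \sum_i v p 0 i * pdx i (segment_avg b f psi P) p =
    avgbox b (fun z => \sum_i v p 0 i * pdx_kernel i z p).
  rewrite avgbox_sum => [|i]; last exact: contZ.
  apply: eq_bigr => i _; rewrite avgboxZ//.
  by have [_ e] := segment_avg_pdx b i p; rewrite [pdx _ _ _]e.
rewrite -avgboxD//; last by apply: cont_sum => i; exact: contZ.
by apply: eq_avgbox => s q _ _; rewrite Dt_kernelE.
Qed.

Lemma segment_avg_Dt_spatialC b : spatialC L (Dt v (segment_avg b f psi P)).
Proof.
have -> : Dt v (segment_avg b f psi P) = fun p => avgbox b (fun z => Dt_kernel z p).
  by apply/funext => p; exact: segment_avg_Dt.
have H0 : bndC [set z : TH * ST | in_box 3 z.1.2 /\ 0 < z.1.1 <= 1 /\ set0 z.2] L 0 0 Dt_kernel.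
  by apply: bndC_sub Dt_kernel_regular => z [_ [_ []]].
exact: (bndC_spatialC 0 (bndC_avgbox b H0)).
Qed.

Lemma segment_avg_pdt_derivable b p : derivable (segment_avg b f psi P) p et.
Proof. by case: (segment_avg_pdt b p). Qed.

End Advected.
End Commutator.

(** * Commutator with the advective derivative *)

Section CommutatorBound.
Context {R : realType} {d : nat}.
Local Notation ST := (R * 'rV[R]_d)%type.
Local Notation ex i := ((0 : R, delta_mx 0 i : 'rV[R]_d) : ST).
Local Notation bndF k C mu f := (bndC (setT : set (R * ST)) k C mu (fun _ => f)).

Variables (L : nat) (v : vfield R d) (X : R -> 'rV[R]_d) (rho : R).
Hypothesis r0 : 0 < rho.
Hypothesis Hv : forall l, spatialC L.+1 (vcomp v l).
Hypothesis HX : forall (t : R) k,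
  is_derive t (1 : R) (fun r => X r 0 k) (v (t, X t) 0 k).

Variables (M Xi : R).
Hypothesis M0 : 0 <= M.
Hypothesis Xi0 : 0 <= Xi.
Hypothesis Hgrad : forall i l, bndF L M Xi (pdx i (vcomp v l)).

(** A coordinate cube around [X(t)], at all times, containing the round slices of the cylinder; the
    box in [q] sees coordinates and not Euclidean distances. *)
Definition tube : set ST := [set p : ST | forall k, `|p.2 0 k - X p.1 0 k| <= rho].

(** The value is the gradient bound times the distance to [X(t)]. From the first derivative on, the
    term in [X] disappears and the gradient of [v] no longer carries a factor [rho]; the [rho^-1] in
    the rate makes up for it. *)
Lemma bndC_drift (T : topologicalType) i :
  bndC [set x : T * ST | tube x.2] L (M * (rho * d%:R)) (Xi + rho^-1)
     (fun _ p => v p 0 i - v (p.1, X p.1) 0 i).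
Proof.
have Ri : 0 <= rho^-1 by rewrite invr_ge0 ltW.
have r1 : bndC (set0 : set (T * ST)) L.+1 0 0 (fun _ p => v p 0 i) by exact: spatialC_bndC (Hv i).
have r2 : bndC (set0 : set (T * ST)) L.+1 0 0 (fun _ p => v (p.1, X p.1) 0 i).
  exact: (bndC_time_only _ _ (@vel_continuous R d L v X Hv HX i)).
have r3 := regB r1 r2.
have dv k p : derivable (vcomp v i) p (ex k) by case: (Hv i) => _ /(_ k)[].
have bv k p : `|pdx k (vcomp v i) p| <= M by exact: (bndC_bnd (Hgrad k i) (z := (0, p)) I).
have bnd : forall x : T * ST, tube x.2 ->
    `|v x.2 0 i - v (x.2.1, X x.2.1) 0 i| <= M * (rho * d%:R).
  move=> [th [t x]] /= Tx.
  have := spatial_lipschitz dv bv (t, X t) (x - X t).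
  have -> : (t, X t) + (0, x - X t) = (t, x) :> ST.
    by apply: (f_equal2 pair); [exact: addr0|exact: subrKC].
  move/le_trans; apply; rewrite ler_wpM2l//.
  apply: (@le_trans _ _ (\sum_(k < d) rho)).
    by apply: ler_sum => k _; rewrite !mxE; exact: Tx.
  by rewrite sumr_const card_ord -[leLHS]mulr_natr.
have C0 : 0 <= M * (rho * d%:R) by rewrite !mulr_ge0// ltW.
case: L Hgrad r3 => [|k] Hg [c _ H]; split => // j; have [h1 h2] := H j; split => //.
have Hg' : bndC [set x : T * ST | tube x.2] k.+1 M Xi (fun _ => pdx j (vcomp v i)).
  exact: (bndC_sub _ (bndC_reparam (@cst_continuous T _ (0 : R)) (Hg j i))).
apply: (@bndC_ext _ _ _ _ _ _ _ (fun _ => pdx j (vcomp v i))).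
  move=> th p; have d2 := time_only_pdx (fun t => v (t, X t) 0 i) j p.
  have [_ e] := @is_deriveB _ _ _ _ _ _ _ _ _ (derivableP (dv j p)) d2.
  by rewrite [RHS]e subr0.
apply: (bndC_pred (bndC_le M0 Xi0 _ _ Hg')); last by rewrite lerDl.
rewrite -{1}[M]mulr1 -mulrA ler_wpM2l//.
have d1 : 1 <= d%:R :> R by rewrite ler1n (leq_trans _ (ltn_ord j)).
have : rho * d%:R * (Xi + rho^-1) = rho * d%:R * Xi + d%:R.
  by rewrite mulrDr; congr (_ + _); rewrite mulrAC divff ?mul1r ?gt_eqF.
move=> ->; rewrite (le_trans d1)// lerDr !mulr_ge0// ltW//.
Qed.

Variables (f E : ST -> R) (P : 'rV[R]_d -> R) (dP : 'I_d -> 'rV[R]_d -> R).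
Variables (A At B la mu : R).
Hypothesis Hadv : advectedC v L.+1 f.
Hypothesis Hf : bndF L.+1 A la f.
Hypothesis HDf : bndF L At la (Dt v f).
Hypothesis HE : bndF L.+2 B mu E.
Hypothesis wP : weight P.
Hypothesis wdP : forall i, weight (dP i).
Hypothesis HdP : forall i q, is_derive q (delta_mx 0 i : 'rV[R]_d) P (dP i q).
Hypothesis A0 : 0 <= A.
Hypothesis At0 : 0 <= At.
Hypothesis B0 : 0 <= B.
Hypothesis la0 : 0 <= la.
Hypothesis mu0 : 0 <= mu.
Hypothesis mu_rho : rho * mu <= d%:R.
Hypothesis f_tube : forall p, f p != 0 -> tube p.
Hypothesis psi_tube : forall p, comove X E p != 0 -> tube p.

Notation psi := (comove X E).
Notation dpsi i := (comove X (pdx i E)).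
Notation slo := (@shift_lo R d rho).
Notation shi := (@shift_hi R d rho).
Notation cX := (@X_continuous R d v X HX).

Let Hpsi : bndF L.+2 B mu psi := bndC_comove cX HE.
Let Hdpsi i : bndF L.+1 (B * mu) mu (dpsi i) := bndC_comove cX (bndC_pdx i HE).

Let vel_quotient s i (q : 'rV[R]_d) (p : ST) := (s * rho)^-1 * (v p 0 i - v (p + (0, slo (s, q))) 0 i).

(* Integrating by parts in [q] moves the derivative off [f]: in
   [(v^i(x) - v^i(a)) d_i f(a)] with [a = x - s rho q], one has
   [d_i f(a) = - (s rho)^-1 d/dq_i f(a)]. *)
Definition ker_div i s q p : R :=
  P q * (f (p + (0, slo (s, q))) * pdx i (vcomp v i) (p + (0, slo (s, q))) *
         psi (p + (0, shi (s, q)))).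
Definition ker_dprofile i s q p : R :=
  (1 - s) * rho * (P q * (f (p + (0, slo (s, q))) * vel_quotient s i q p * dpsi i (p + (0, shi (s, q))))).
Definition ker_dweight i s q p : R :=
  dP i q * (f (p + (0, slo (s, q))) * vel_quotient s i q p * psi (p + (0, shi (s, q)))).
Definition ker_transport i s q p : R :=
  P q * ((v p 0 i - v (p + (0, slo (s, q))) 0 i) * pdx i f (p + (0, slo (s, q))) *
    psi (p + (0, shi (s, q)))).
Definition ibp_flux i s q p : R :=
  P q * (f (p + (0, slo (s, q))) * vel_quotient s i q p * psi (p + (0, shi (s, q)))).

Definition ker_source s q p : R := P q * (Dt v f (p + (0, slo (s, q))) * psi (p + (0, shi (s, q)))).
Definition ker_drift i s q p : R :=
  P q * (f (p + (0, slo (s, q))) * ((v p 0 i - v (p.1, X p.1) 0 i) * dpsi i (p + (0, shi (s, q))))).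

Let pair_cont (s : R) := continuous_pair (@cst_continuous 'rV[R]_d R s) (@cont_id 'rV[R]_d).
Let slo_cont s : continuous (fun q : 'rV[R]_d => slo (s, q)).
Proof. exact: (continuous_comp2 (@pair_cont s) (@shift_lo_continuous R d rho)). Qed.
Let shi_cont s : continuous (fun q : 'rV[R]_d => shi (s, q)).
Proof. exact: (continuous_comp2 (@pair_cont s) (@shift_hi_continuous R d rho)). Qed.

Section FixedTime.
Variable s : R.
Hypothesis s01 : 0 < s <= 1.
Let s0 : 0 < s. Proof. by case/andP: s01. Qed.
Let sr0 : 0 < s * rho. Proof. exact: mulr_gt0. Qed.

(** Product rule on four factors. On the quotient of [v] the factor [s rho] cancels, leaving the
    gradient of [v]; on [f] it restores the difference of velocities and yields the unwanted
    [ker_transport] with a minus sign. *)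
Lemma ibp_flux_is_derive i q p :
  is_derive q (delta_mx 0 i : 'rV[R]_d) (fun q => ibp_flux i s q p)
    (ker_div i s q p + ker_dprofile i s q p + ker_dweight i s q p - ker_transport i s q p).
Proof.
have df := @is_derive_dilation R d f i p (- (s * rho)) q.
have {}df : is_derive q (delta_mx 0 i : 'rV[R]_d) (fun q => f (p + (0, slo (s, q))))
    (- (s * rho) * pdx i f (p + (0, slo (s, q)))).
  by apply: df; case: Hadv => -[_ /(_ i)[]].
have dv : is_derive q (delta_mx 0 i : 'rV[R]_d) (fun q => vel_quotient s i q p)
    (pdx i (vcomp v i) (p + (0, slo (s, q)))).
  have h : is_derive q (delta_mx 0 i : 'rV[R]_d) (fun q => v (p + (0, slo (s, q))) 0 i)
      (- (s * rho) * pdx i (vcomp v i) (p + (0, slo (s, q)))).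
    apply: (@is_derive_dilation R d (vcomp v i) i p (- (s * rho)) q).
    by case: (Hv i) => _ /(_ i)[].
  have h2 := is_deriveZ (s * rho)^-1 (is_deriveB (is_derive_cst (v p 0 i) q (delta_mx 0 i)) h).
  have {}h2 : is_derive q (delta_mx 0 i : 'rV[R]_d) (fun q => vel_quotient s i q p) _ := h2.
  apply: is_derive_eq h2 _; rewrite sub0r mulNr opprK [LHS]/GRing.scale /=.
  by rewrite mulKf// gt_eqF.
have dps : is_derive q (delta_mx 0 i : 'rV[R]_d) (fun q => psi (p + (0, shi (s, q))))
    ((1 - s) * rho * dpsi i (p + (0, shi (s, q)))).
  rewrite -(pdx_comove X HE); apply: (@is_derive_dilation R d psi i p ((1 - s) * rho) q).
  exact: (@bndC_der _ _ _ _ _ _ _ _ i Hpsi 0).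
have h := is_deriveM (HdP i q) (is_deriveM (is_deriveM df dv) dps).
have {}h : is_derive q (delta_mx 0 i : 'rV[R]_d) (fun q => ibp_flux i s q p) _ := h.
apply: is_derive_eq h _; rewrite /GRing.scale /= /ker_div /ker_dprofile /ker_dweight /ker_transport.
have -> : v p 0 i - v (p + (0, slo (s, q))) 0 i = s * rho * vel_quotient s i q p.
  by rewrite /vel_quotient mulrA divff ?mul1r// gt_eqF.
rewrite !fctE; ring.
Qed.

(** The endpoints of a segment differ by [rho q]; if both are in the tube then [|q_i| <= 2]. *)
Lemma ibp_flux_support i (q : 'rV[R]_d) (p : ST) : 3 <= `|q 0 i| -> ibp_flux i s q p = 0.
Proof.
move=> q3; have [e|fn] := eqVneq (f (p + (0, slo (s, q)))) 0.
  by rewrite /ibp_flux e !mul0r mulr0.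
have [e|pn] := eqVneq (psi (p + (0, shi (s, q)))) 0.
  by rewrite /ibp_flux e !mulr0.
have := psi_tube pn i; have := f_tube fn i; rewrite /=.
rewrite !addr0 !mxE => h1 h2.
have : `|rho * q 0 i| <= rho + rho.
  have -> : rho * q 0 i = (p.2 0 i + (1 - s) * rho * q 0 i - X p.1 0 i) -
      (p.2 0 i + - (s * rho) * q 0 i - X p.1 0 i) by ring.
  by apply: le_trans (ler_normB _ _) _; exact: lerD.
rewrite normrM gtr0_norm// -mulr2n -mulr_natr ler_pM2l// => q2.
by have := le_trans q3 q2; rewrite ler_nat.
Qed.

Notation D := [set x : 'rV[R]_d * ST | in_box 3 x.1 /\ tube x.2].
Notation Mu := (la + Xi + rho^-1 + mu).

Let c3d := 3 * d%:R : R.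

Let Ri : 0 <= rho^-1. Proof. by rewrite invr_ge0 ltW. Qed.

Let leMu0 : la + mu <= Mu. Proof. by rewrite lerD2r -addrA lerDl addr_ge0. Qed.
Let leMu1 : la + Xi + mu <= Mu. Proof. by rewrite lerD2r lerDl. Qed.

Let jf : bndC D L A la (fun q p => f (p + (0, slo (s, q)))).
Proof. exact: (bndC_at _ (@slo_cont s) (bndC_pred Hf)). Qed.

Let jpsi : bndC D L B mu (fun q p => psi (p + (0, shi (s, q)))).
Proof. exact: (bndC_at _ (@shi_cont s) (bndC_pred (bndC_pred Hpsi))). Qed.

Let jdpsi i : bndC D L (B * mu) mu (fun q p => dpsi i (p + (0, shi (s, q)))).
Proof. exact: (bndC_at _ (@shi_cont s) (bndC_pred (Hdpsi i))). Qed.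

(** The factor [(s rho)^-1] cancels the one gained in [bndC_diff], so the bound does not depend on
    [s]. *)
Let jquot i : bndC D L (M * c3d) Xi (fun q p => vel_quotient s i q p).
Proof.
have H := bndC_diff (- (s * rho)) M0 Xi0 (Hv i) (Hgrad ^~ i).
have H' := bndCZ (s * rho)^-1 (bndC_sub (D' := D) (fun x h => proj1 h) H).
apply: bndC_le H' => //; first by rewrite !mulr_ge0.
rewrite normrN !gtr0_norm ?invr_gt0//.
by rewrite mulrCA mulKf// gt_eqF.
Qed.

Let jgrad i : bndC D L M Xi (fun q p => pdx i (vcomp v i) (p + (0, slo (s, q)))).
Proof. exact: (bndC_at _ (@slo_cont s) (Hgrad i i)). Qed.

Let jw (Q : 'rV[R]_d -> R) C m F : weight Q -> 0 <= m -> bndC D L C m F ->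
  bndC D L (9 * C) m (fun q p => Q q * F q p).
Proof.
move=> [cQ bQ] m0 HF; rewrite -[X in bndC _ _ _ X _]add0r; apply: bndCM HF.
by apply: bndC_param => // x [/bQ].
Qed.

Let Bmu : rho * (B * mu) <= B * d%:R.
Proof. by rewrite mulrCA ler_wpM2l. Qed.

Lemma ker_source_bndC : bndC D L (9 * (At * B)) Mu (ker_source s).
Proof.
apply: (@bndC_le _ _ _ _ _ (9 * (At * B)) (la + mu)); rewrite ?mulr_ge0 ?addr_ge0//.
apply: jw => //; first by rewrite addr_ge0.
by apply: bndCM => //; exact: (bndC_at _ (@slo_cont s) HDf).
Qed.

Lemma ker_div_bndC i : bndC D L (9 * (A * M * B)) Mu (ker_div i s).
Proof.
apply: (@bndC_le _ _ _ _ _ (9 * (A * M * B)) (la + Xi + mu)); rewrite ?mulr_ge0 ?addr_ge0//.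
apply: jw => //; first by rewrite !addr_ge0.
by apply: bndCM => //; exact: bndCM.
Qed.

(** The additional derivative of the profile costs [mu], which is paid by the factor [(1 - s) rho]
    of the dilation, as [rho mu <= d]. *)
Lemma ker_dprofile_bndC i : bndC D L (9 * (A * (M * c3d) * (B * d%:R))) Mu (ker_dprofile i s).
Proof.
have H : bndC D L (`|(1 - s) * rho| * (9 * (A * (M * c3d) * (B * mu)))) (la + Xi + mu) (ker_dprofile i s).
  apply: bndCZ; apply: jw => //; first by rewrite !addr_ge0.
  by apply: bndCM => //; exact: bndCM.
apply: bndC_le H; rewrite ?mulr_ge0 ?addr_ge0//.
have s1 : 0 <= 1 - s by case/andP: s01 => _; rewrite subr_ge0.
rewrite mulrCA ler_wpM2l// mulrCA ler_wpM2l ?mulr_ge0//.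
apply: le_trans Bmu; rewrite ler_wpM2r ?mulr_ge0// ger0_norm ?mulr_ge0 ?(ltW r0)//.
by rewrite ler_piMl ?(ltW r0)// gerBl ltW.
Qed.

Lemma ker_dweight_bndC i : bndC D L (9 * (A * (M * c3d) * B)) Mu (ker_dweight i s).
Proof.
apply: (@bndC_le _ _ _ _ _ (9 * (A * (M * c3d) * B)) (la + Xi + mu)); rewrite ?mulr_ge0 ?addr_ge0//.
apply: jw => //; first by rewrite !addr_ge0.
by apply: bndCM => //; exact: bndCM.
Qed.

Lemma ker_drift_bndC i : bndC D L (9 * (A * (M * d%:R * (B * d%:R)))) Mu (ker_drift i s).
Proof.
have H : bndC D L (9 * (A * (M * (rho * d%:R) * (B * mu)))) (la + (Xi + rho^-1 + mu)) (ker_drift i s).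
  apply: jw => //; first by rewrite !addr_ge0.
  apply: bndCM => //; apply: bndCM => //.
  by apply: bndC_sub (bndC_drift _ i) => x [].
apply: bndC_le H; rewrite ?mulr_ge0 ?addr_ge0//; [exact: ltW| |by rewrite !addrA].
rewrite !ler_wpM2l// -!mulrA ler_wpM2l//.
by rewrite mulrCA ler_wpM2l.
Qed.

(** The four terms of the inner bracket come from [ker_div], [ker_dprofile], [ker_dweight] and
    [ker_drift] in this order; the [d] in front comes from the sum over [i]. *)
Definition Dt_const : R := 9 * B * (At + A * M * (d%:R * (1 + c3d * d%:R + c3d + d%:R * d%:R))).

Definition ker_total (q : 'rV[R]_d) (p : ST) : R :=
  ker_source s q p + \sum_(i < d) (ker_div i s q p + ker_dprofile i s q p + ker_dweight i s q p + ker_drift i s q p).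

Lemma ker_total_bndC : bndC D L Dt_const Mu ker_total.
Proof.
have Mu0 : 0 <= Mu by rewrite !addr_ge0.
have := bndC_sum (index_enum 'I_d) Mu0
  (fun i => bndCD (bndCD (bndCD (ker_div_bndC i) (ker_dprofile_bndC i)) (ker_dweight_bndC i)) (ker_drift_bndC i)).
have -> : (size (index_enum 'I_d))%:R = d%:R :> R.
  by congr _%:R; rewrite -sum1_size sum1_card card_ord.
move=> {}H; have := bndCD ker_source_bndC H.
set C := _ + _; have -> // : C = Dt_const.
by rewrite /C /Dt_const; ring.
Qed.

Lemma boxint_Dt_kernel p :
  boxint 3 (fun q => Dt_kernel v X rho f E P (s, q) p) = boxint 3 (fun q => ker_total q p).
Proof.
have c3 : 0 <= 3 :> R by [].
have cp k C m F (D' : set ('rV[R]_d * ST)) : bndC D' k C m F -> continuous (fun q => F q p).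
  move=> /bndC_cont cF.
  exact: (continuous_comp2 (continuous_pair (@cont_id 'rV[R]_d) (@cst_continuous _ _ p)) cF).
have cDt : continuous (fun q => Dt_kernel v X rho f E P (s, q) p).
  have c := bndC_cont (Dt_kernel_regular rho Hv HX Hadv HE wP).
  exact: (continuous_comp2 (continuous_pair (@pair_cont s) (@cst_continuous _ _ p)) c).
have c1k i := cp _ _ _ _ _ (ker_div_bndC i).
have c2k i := cp _ _ _ _ _ (ker_dprofile_bndC i).
have c3k i := cp _ _ _ _ _ (ker_dweight_bndC i).
have cG i : continuous (fun q => ker_div i s q p + ker_dprofile i s q p + ker_dweight i s q p - ker_transport i s q p).
  apply: contD; first by apply: contD => //; exact: contD.
  apply: contN; apply: contM; first exact: wP.1.
  apply: contM; last exact: (cp _ _ _ _ _ jpsi).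
  apply: contM.
    apply: contD; first exact: cst_continuous.
    apply: contN; have [c _] := Hv i.
    have c1 := contVD (@cst_continuous 'rV[R]_d _ p) (continuous_pair (@cst_continuous _ _ (0 : R)) (@slo_cont s)).
    exact: (continuous_comp2 c1 c).
  exact: (cp _ _ _ _ _ (bndC_at set0 (@slo_cont s) (bndC_pdx i Hf))).
have cflux i : continuous (fun q => ibp_flux i s q p).
  exact: (cp _ _ _ _ _ (jw wP (addr_ge0 (addr_ge0 la0 Xi0) mu0) (bndCM (bndCM jf (jquot i)) jpsi))).
have G0 i : boxint 3 (fun q => ker_div i s q p + ker_dprofile i s q p + ker_dweight i s q p - ker_transport i s q p) = 0.
  apply: (@boxint_derive0 _ 3 c3 d (fun q => ibp_flux i s q p) _ i) => // q; last exact: ibp_flux_support.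
  exact: ibp_flux_is_derive.
(* Adding the vanishing integrals of the flux derivatives replaces [ker_transport], which
   differentiates [f], by three kernels that do not. *)
transitivity (boxint 3 (fun q => Dt_kernel v X rho f E P (s, q) p) +
    \sum_(i < d) boxint 3 (fun q => ker_div i s q p + ker_dprofile i s q p + ker_dweight i s q p - ker_transport i s q p)).
  by rewrite big1 ?addr0.
rewrite -boxint_sum// -boxintD//; last exact: cont_sum.
apply: eq_boxint => // q _; rewrite /Dt_kernel /ker_total /= -addrA -addrA; congr (_ + _).
rewrite mulr_suml !mulr_sumr -!big_split; apply: eq_bigr => i _ /=.
by rewrite /ker_transport /ker_drift; ring.
Qed.

End FixedTime.

Lemma segment_avg_Dt_bound b :
  bndC [set x : R * ST | tube x.2] L (Dt_const * 6 ^+ d) (la + Xi + rho^-1 + mu)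
    (fun _ => Dt v (segment_avg rho b f psi P)).
Proof.
have -> : Dt v (segment_avg rho b f psi P) =
    (fun p => avg b (fun s => boxint 3 (fun q => Dt_kernel v X rho f E P (s, q) p))).
  by apply/funext => p; exact: (segment_avg_Dt rho Hv HX Hadv HE wP b p).
apply: bndC_avg.
have Hreg := Dt_kernel_regular rho Hv HX Hadv HE wP.
(* Joint regularity in [(s, x)] is taken from the original kernel; the integrated one is used only
   at fixed [s]. *)
have H0 : bndC (set0 : set (R * ST)) L 0 0 (fun s p => boxint 3 (fun q => Dt_kernel v X rho f E P (s, q) p)).
  have h : bndC [set z : (R * 'rV[R]_d) * ST | in_box 3 z.1.2 /\ set0 (z.1.1, z.2)] L 0 0
      (Dt_kernel v X rho f E P) by apply: bndC_sub Hreg => x [].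
  exact: (bndC_regular _ _ (bndC_box h)).
apply: bndC_fiber => // s.
(* For [s] outside []0, 1]] the fibre of the domain is empty, so regularity alone is asked. *)
have [s01|s01] := boolP (0 < s <= 1); last first.
  have h := bndC_reparam (@cst_continuous R _ s) H0.
  by apply: (bndC_sub _ (bndC_regular _ _ (bndC_sub (D' := set0) _ h))) => // x [/=]; rewrite (negbTE s01).
rewrite (_ : (fun p => _) = (fun p => boxint 3 (fun q => ker_total s q p))); last first.
  by apply/funext => p; exact: boxint_Dt_kernel.
have h := bndC_reparam (@cont_snd R 'rV[R]_d) (ker_total_bndC s01).
apply: (@bndC_box R d [set x : R * ST | 0 < s <= 1 /\ tube x.2] L Dt_const _ (fun z p => ker_total s z.2 p)).
by apply: bndC_sub h => -[[u q] p] /= [qb [_ Tp]].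
Qed.

End CommutatorBound.

(** * The divergence identity *)

Section Divergence.
Context {R : realType} {d : nat}.
Local Notation ST := (R * 'rV[R]_d)%type.
Local Notation ex i := ((0 : R, delta_mx 0 i : 'rV[R]_d) : ST).
Local Notation bndF k C mu f := (bndC (setT : set (R * ST)) k C mu (fun _ => f)).

Lemma is_derive_coord (q : 'rV[R]_d) (i j : 'I_d) :
  is_derive q (delta_mx 0 i : 'rV[R]_d) (fun q => q 0 j) (j == i)%:R.
Proof.
apply: is_derive_line_at0.
have := @is_derive_affine _ (id : R -> R) (j == i)%:R (q 0 j) 0 1.
rewrite mulr1 => /(_ (is_derive_id _ _)).
have -> // : (fun r : R => id ((j == i)%:R * r + q 0 j)) = (fun r : R => (r *: delta_mx 0 i + q) 0 j).
by apply/funext => r; rewrite !mxE eqxx /= mulrC.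
Qed.

Definition coord_weight (j : 'I_d) (q : 'rV[R]_d) : R := q 0 j.
Definition dcoord_weight (j i : 'I_d) (q : 'rV[R]_d) : R := (j == i)%:R.
Definition coord2_weight (j k : 'I_d) (q : 'rV[R]_d) : R := q 0 j * q 0 k.
Definition dcoord2_weight (j k i : 'I_d) (q : 'rV[R]_d) : R :=
  q 0 j * (k == i)%:R + q 0 k * (j == i)%:R.

Lemma weight_coord j : weight (coord_weight j).
Proof.
split; first exact: continuous_coord.
by move=> q qb; apply: le_trans (qb j) _; rewrite ler_nat.
Qed.

Lemma weight_dcoord j i : weight (dcoord_weight j i).
Proof.
split; first exact: cst_continuous.
by move=> q _; rewrite /dcoord_weight ger0_norm// (ler_nat _ _ 9); case: eqP.
Qed.

Lemma weight_coord2 j k : weight (coord2_weight j k).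
Proof.
split; first by apply: contM; exact: continuous_coord.
move=> q qb; rewrite normrM (le_trans (ler_pM _ _ (qb j) (qb k)))//.
by rewrite -natrM ler_nat.
Qed.

Lemma weight_dcoord2 j k i : weight (dcoord2_weight j k i).
Proof.
split.
  by apply: contD; apply: contM; [exact: continuous_coord|exact: cst_continuous|
    exact: continuous_coord|exact: cst_continuous].
move=> q qb; apply: le_trans (ler_normD _ _) _; rewrite !normrM.
have h (a b c : 'I_d) : `|q 0 a| * `|(b == c)%:R| <= 3.
  by case: eqP => _; rewrite ?normr1 ?normr0 ?mulr1 ?mulr0.
by apply: le_trans (lerD (h _ _ _) (h _ _ _)) _; rewrite -natrD ler_nat.
Qed.

Lemma coord_weight_is_derive j i q : is_derive q (delta_mx 0 i : 'rV[R]_d) (coord_weight j) (dcoord_weight j i q).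
Proof. exact: is_derive_coord. Qed.

Lemma coord2_weight_is_derive j k i q : is_derive q (delta_mx 0 i : 'rV[R]_d) (coord2_weight j k) (dcoord2_weight j k i q).
Proof. exact: (is_deriveM (is_derive_coord q i j) (is_derive_coord q i k)). Qed.

Lemma ray_is_derive (f : ST -> R) (p : ST) (q : 'rV[R]_d) (a b s : R) :
  (forall i q, derivable f q (ex i)) -> (forall i, continuous (pdx i f)) ->
  is_derive s (1 : R) (fun s => f (p + (0, (a * s + b) *: q)))
    (a * \sum_k q 0 k * pdx k f (p + (0, (a * s + b) *: q))).
Proof.
move=> df cf; rewrite -scale_pair0 addrC.
have h := is_derive_line (is_derive_spatial ((a * s + b) *: ((0, q) : ST) + p) q df cf).
have := is_derive_affine h.
by under [X in is_derive _ _ X _ -> _]eq_fun do rewrite addrC scale_pair0.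
Qed.

Variables (L : nat) (v : vfield R d) (X : R -> 'rV[R]_d) (rho : R).
Hypothesis r0 : 0 < rho.
Hypothesis HX : forall (t : R) k,
  is_derive t (1 : R) (fun r => X r 0 k) (v (t, X t) 0 k).
Notation tube := (tube X rho).

Section Ray.
Variables (f E : ST -> R) (B mu : R).
Hypothesis Hf : advectedC v L.+1 f.
Hypothesis HE : bndF L.+2 B mu E.
Notation psi := (comove X E).

Lemma div_segment_avg_true k p :
  \sum_j pdx j (segment_avg rho true f psi (coord2_weight j k)) p =
  rho^-1 * (f p * boxint 3 (fun q : 'rV[R]_d => q 0 k * psi (p + (0, rho *: q))) -
            boxint 3 (fun q : 'rV[R]_d => q 0 k * f (p + (0, - rho *: q))) * psi p).
Proof.
have c3 : 0 <= 3 :> R by [].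
pose K j := pdx_kernel X rho f E (coord2_weight j k) j.
(* Summing over [j] spends the factor [q_j] of the weight on the derivative along the segment, so
   the primitive in [s] carries the weight [q_k] alone. *)
pose g s := boxint 3 (fun q => segment_kernel rho f psi (coord_weight k) (s, q) p).
have cp (F : R * 'rV[R]_d -> ST -> R) : continuous (fun x : (R * 'rV[R]_d) * ST => F x.1 x.2) ->
    continuous (fun z => F z p).
  by move=> cF; exact: (continuous_comp2 (continuous_pair (@cont_id (R * 'rV[R]_d)%type) (@cst_continuous _ _ p)) cF).
have cK j : continuous (fun z => K j z p).
  exact: (cp (K j) (pdx_kernel_continuous (i := j) (rho := rho) HX Hf HE (weight_coord2 j k))).
have cF : continuous (fun z => segment_kernel rho f psi (coord_weight k) z p).
  exact: (cp (segment_kernel rho f psi (coord_weight k)) (segment_kernel_continuous (rho := rho) HX Hf HE (weight_coord k))).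
have cS : continuous (fun z => \sum_j K j z p) by exact: cont_sum.
have E1 : \sum_j pdx j (segment_avg rho true f psi (coord2_weight j k)) p = avgbox true (fun z => \sum_j K j z p).
  rewrite avgbox_sum//; apply: eq_bigr => j _.
  by have [_ e] := segment_avg_pdx rho HX Hf HE (weight_coord2 j k) true j p; exact: e.
have df i q : derivable f q (ex i) by case: Hf => -[_ /(_ i)[]].
have cf i : continuous (pdx i f) by case: Hf => -[_ /(_ i)[_]]; case: (L) => [|?] [].
have Hpsi := bndC_comove (@X_continuous R d v X HX) HE.
have sp := bndC_spatialC (0 : R) Hpsi.
have dps i q : derivable psi q (ex i) by case: sp => _ /(_ i)[].
have cps i : continuous (pdx i psi) by case: sp => _ /(_ i)[_ []].
have dF s q : is_derive s (1 : R) (fun s => segment_kernel rho f psi (coord_weight k) (s, q) p)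
    (- rho * \sum_j K j (s, q) p).
  have e1 s' : - rho * s' + 0 = - (s' * rho) by ring.
  have e2 s' : - rho * s' + rho = (1 - s') * rho by ring.
  have h1 : is_derive s (1 : R) (fun s => f (p + (0, - (s * rho) *: q)))
      (- rho * \sum_k q 0 k * pdx k f (p + (0, - (s * rho) *: q))).
    have := ray_is_derive p q (- rho) 0 s df cf.
    by under [X in is_derive _ _ X _ -> _]eq_fun do rewrite e1; rewrite e1.
  have h2 : is_derive s (1 : R) (fun s => psi (p + (0, ((1 - s) * rho) *: q)))
      (- rho * \sum_k q 0 k * pdx k psi (p + (0, ((1 - s) * rho) *: q))).
    have := ray_is_derive p q (- rho) rho s dps cps.
    by under [X in is_derive _ _ X _ -> _]eq_fun do rewrite e2; rewrite e2.
  have h := is_deriveZ (q 0 k) (is_deriveM h1 h2).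
  have {}h : is_derive s (1 : R) (fun s => segment_kernel rho f psi (coord_weight k) (s, q) p) _ := h.
  apply: is_derive_eq h _; rewrite /GRing.scale /=.
  set a := p + (0, - (s * rho) *: q); set b := p + (0, ((1 - s) * rho) *: q).
  have -> : \sum_j K j (s, q) p =
      q 0 k * (psi b * \sum_j q 0 j * pdx j f a + f a * \sum_j q 0 j * pdx j psi b).
    rewrite !mulr_sumr -big_split mulr_sumr; apply: eq_bigr => j _ /=.
    by rewrite (pdx_comove X HE) /K /pdx_kernel /coord2_weight -/a -/b; ring.
  ring.
have cD : continuous (fun z : R * 'rV[R]_d => - rho * \sum_j K j z p) by exact: contZ.
have dg s : is_derive s (1 : R) g (boxint 3 (fun q => - rho * \sum_j K j (s, q) p)).
  exact: (boxint_is_derive c3 cF cD dF).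
have I1 : avgbox true (fun z => - rho * \sum_j K j z p) = g 1 - g 0.
  apply: (@FTC_int1 _ 0 1 _ g) => //; first exact: (boxint_slice_continuous cD).
have fq (h : ST -> R) (c : R) : continuous h -> continuous (fun q : 'rV[R]_d => q 0 k * h (p + (0, c *: q))).
  move=> ch; apply: contM; first exact: continuous_coord.
  have c1 := contVD (@cst_continuous 'rV[R]_d _ p) (continuous_pair (@cst_continuous _ _ (0 : R))
    (contVZ (@cst_continuous _ _ c) (@cont_id 'rV[R]_d))).
  exact: (continuous_comp2 c1 ch).
have g0 : g 0 = f p * boxint 3 (fun q : 'rV[R]_d => q 0 k * psi (p + (0, rho *: q))).
  rewrite /g -boxintZ//; last by apply: fq; case: sp.
  apply: eq_boxint => // q _; rewrite /segment_kernel /coord_weight /shift_lo /shift_hi /= subr0 mul0r oppr0 scale0r mul1r.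
  by rewrite (_ : (0, 0) = 0 :> ST)// addr0 mulrCA.
have g1 : g 1 = boxint 3 (fun q : 'rV[R]_d => q 0 k * f (p + (0, - rho *: q))) * psi p.
  rewrite /g mulrC -boxintZ//; last by apply: fq; case: Hf => -[].
  apply: eq_boxint => // q _; rewrite /segment_kernel /coord_weight /shift_lo /shift_hi /= subrr mul0r scale0r mul1r.
  by rewrite (_ : (0, 0) = 0 :> ST)// addr0 mulrA [RHS]mulrC.
move: I1; rewrite avgboxZ// -E1 g0 g1 => I1.
rewrite -opprB -I1 mulNr opprK mulKf// gt_eqF//.
Qed.
End Ray.
End Divergence.

(** * Momenta of the source and the inverse of the symmetric divergence *)

Section Inverse.
Context {R : realType} {d : nat}.
Local Notation ST := (R * 'rV[R]_d)%type.
Local Notation ex i := ((0 : R, delta_mx 0 i : 'rV[R]_d) : ST).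
Local Notation bndF k C mu f := (bndC (setT : set (R * ST)) k C mu (fun _ => f)).

Variables (L : nat) (v : vfield R d) (X : R -> 'rV[R]_d) (rho : R).
Hypothesis r0 : 0 < rho.
Hypothesis HX : forall (t : R) k,
  is_derive t (1 : R) (fun r => X r 0 k) (v (t, X t) 0 k).
Notation tube := (tube X rho).

Let c3 : 0 <= 3 :> R. Proof. by []. Qed.

(** Two points of the tube at the same time differ by at most [2 rho] in each coordinate. Hence box
    integrals centred in the tube see the whole support and have no boundary terms. *)
Lemma tube_far p (q : 'rV[R]_d) i (c : R) : tube p -> 3 <= `|q 0 i| -> `|c| = rho ->
  ~ tube (p + (0, c *: q)).
Proof.
move=> /(_ i) h1 q3 cr /(_ i); rewrite /= addr0 !mxE => h2.
have : `|c * q 0 i| <= rho + rho.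
  have -> : c * q 0 i = (p.2 0 i + c * q 0 i - X p.1 0 i) - (p.2 0 i - X p.1 0 i) by ring.
  by apply: le_trans (ler_normB _ _) _; exact: lerD.
rewrite normrM cr -mulr2n -mulr_natr ler_pM2l// => q2.
by have := le_trans q3 q2; rewrite ler_nat.
Qed.

Lemma dilate_continuous (p : ST) (c : R) : continuous (fun q : 'rV[R]_d => p + (0, c *: q)).
Proof.
exact: (contVD (@cst_continuous 'rV[R]_d _ p) (continuous_pair (@cst_continuous _ _ (0 : R))
    (contVZ (@cst_continuous _ _ c) (@cont_id 'rV[R]_d)))).
Qed.

Lemma coord_dilate_continuous (h : ST -> R) (p : ST) (c : R) j : continuous h ->
  continuous (fun q : 'rV[R]_d => q 0 j * h (p + (0, c *: q))).
Proof.
move=> ch; apply: contM; first exact: continuous_coord.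
exact: (continuous_comp2 (@dilate_continuous p c) ch).
Qed.

Section Ray.
Variables (f E : ST -> R) (B mu : R).
Hypothesis Hf : advectedC v L.+1 f.
Hypothesis HE : bndF L.+2 B mu E.
Hypothesis f_tube : forall p, f p != 0 -> tube p.
Hypothesis psi_tube : forall p, comove X E p != 0 -> tube p.
Hypothesis f_mean : forall p : ST, tube p -> boxint 3 (fun q : 'rV[R]_d => f (p + (0, - rho *: q))) = 0.
Notation psi := (comove X E).
Notation dpsi i := (comove X (pdx i E)).

Let cf : continuous f. Proof. by case: Hf => -[]. Qed.
Let df i q : derivable f q (ex i). Proof. by case: Hf => -[_ /(_ i)[]]. Qed.
Let cdf i : continuous (pdx i f).
Proof. by case: Hf => -[_ /(_ i)[_]]; case: (L) => [|?] []. Qed.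

Lemma shift_at1 (p : ST) (q : 'rV[R]_d) :
  (p + (0, shift_lo rho (1, q)) = p + (0, - rho *: q)) *
  (p + (0, shift_hi rho (1, q)) = p).
Proof.
rewrite /shift_lo /shift_hi /= subrr mul0r scale0r mul1r.
by rewrite (_ : (0, 0) = 0 :> ST)// addr0.
Qed.

Lemma segment_avg_false_E P p : continuous P ->
  segment_avg rho false f psi P p = boxint 3 (fun q => P q * f (p + (0, - rho *: q))) * psi p.
Proof.
move=> cP; rewrite mulrC -boxintZ//; last first.
  by apply: contM => //; exact: (continuous_comp2 (@dilate_continuous p _) cf).
apply: eq_boxint => // q _; rewrite /segment_kernel !shift_at1 /=.
by rewrite mulrA [RHS]mulrC.
Qed.

(** Integrating the [q_j] derivative of [q_j f (x - rho q)] equates this integral with [rho^-1]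
    times the mean of [f]. So in the endpoint term the divergence falls on the bump only. *)
Lemma pdx_mean0 p j : tube p ->
  boxint 3 (fun q : 'rV[R]_d => q 0 j * pdx j f (p + (0, - rho *: q))) = 0.
Proof.
move=> Tp.
have c1 := continuous_comp2 (@dilate_continuous p (- rho)) cf.
have c2 := @coord_dilate_continuous (pdx j f) p (- rho) j (@cdf j).
have h : boxint 3 (fun q : 'rV[R]_d => f (p + (0, - rho *: q)) +
     (- rho) * (q 0 j * pdx j f (p + (0, - rho *: q)))) = 0.
  apply: (@boxint_derive0 _ 3 c3 d (fun q => q 0 j * f (p + (0, - rho *: q))) _ j).
  - exact: coord_dilate_continuous.
  - by apply: contD => //; exact: contZ.
  - move=> q; have h := is_deriveM (is_derive_coord q j j)
      (@is_derive_dilation R d f j p (- rho) q (@df j _)).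
    by apply: is_derive_eq h _; rewrite /GRing.scale /= eqxx mulr1; ring.
  - move=> q q3; have [->|fn] := eqVneq (f (p + (0, - rho *: q))) 0; first by rewrite mulr0.
    by case: (tube_far Tp q3 _ (f_tube fn)); rewrite normrN gtr0_norm.
move: h; rewrite boxintD//; last exact: contZ.
rewrite boxintZ// f_mean// add0r => /eqP; rewrite mulf_eq0 oppr_eq0 gt_eqF//=.
by move/eqP.
Qed.

Lemma div_segment_avg_false p j :
  pdx j (segment_avg rho false f psi (coord_weight j)) p =
  boxint 3 (fun q : 'rV[R]_d => q 0 j * f (p + (0, - rho *: q))) * dpsi j p.
Proof.
have [_ e] := segment_avg_pdx rho HX Hf HE (weight_coord j) false j p; rewrite [LHS]e {e}.
have c1 := @coord_dilate_continuous _ p (- rho) j cf.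
have c2 := @coord_dilate_continuous _ p (- rho) j (@cdf j).
have -> : avgbox false (fun z => pdx_kernel X rho f E (coord_weight j) j z p) =
    boxint 3 (fun q : 'rV[R]_d => psi p * (q 0 j * pdx j f (p + (0, - rho *: q))) +
      dpsi j p * (q 0 j * f (p + (0, - rho *: q)))).
  by apply: eq_boxint => // q _; rewrite /pdx_kernel !shift_at1 /coord_weight /=; ring.
rewrite boxintD//; [|exact: contZ|exact: contZ].
rewrite !boxintZ// [RHS]mulrC.
have [->|pn] := eqVneq (psi p) 0; first by rewrite mul0r add0r.
by rewrite pdx_mean0 ?mulr0 ?add0r//; exact: psi_tube.
Qed.

End Ray.

Section Momenta.
Variable U : vfield R d.
Hypothesis cU : forall l, continuous (vcomp U l).
Hypothesis U_tube : forall l p, vcomp U l p != 0 -> tube p.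
Hypothesis U_linear : zero_linear_momentum U.
Hypothesis U_angular : zero_angular_momentum U.

Lemma integral_slice0 (g : ST -> R) p : continuous g -> (forall p, g p != 0 -> tube p) ->
  tube p -> integral_rV (fun x => g (p.1, x)) = 0 ->
  boxint 3 (fun q : 'rV[R]_d => g (p + (0, - rho *: q))) = 0.
Proof.
move=> cg g_tube Tp.
have e (q : 'rV[R]_d) : p + (0, - rho *: q) = (p.1, p.2 - rho *: q).
  by apply: (f_equal2 pair); [exact: addr0|rewrite /= scaleNr].
rewrite (@integral_rV_boxint R 3 d _ p.2 rho)//.
- move/eqP; rewrite mulf_eq0 expf_eq0 (gt_eqF r0) andbF /= => /eqP {2}<-.
  by apply: eq_boxint => // q _; rewrite e.
- exact: (continuous_comp2 (continuous_pair (@cst_continuous _ _ p.1) (@cont_id 'rV[R]_d)) cg).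
move=> q i q3; rewrite -e; have [//|gn] := eqVneq (g (p + (0, - rho *: q))) 0.
by case: (tube_far Tp q3 _ (g_tube _ gn)); rewrite normrN gtr0_norm.
Qed.

Lemma mean0 l p : tube p ->
  boxint 3 (fun q : 'rV[R]_d => vcomp U l (p + (0, - rho *: q))) = 0.
Proof. by move=> Tp; apply: integral_slice0 => //; [exact: U_tube|exact: U_linear]. Qed.

(** In the angular momentum the position is [x - rho q]. The part in [x] is a multiple of the linear
    momentum, hence zero; the part in [q] is the antisymmetric first moment. *)
Lemma first_moment_sym j l p : tube p ->
  boxint 3 (fun q : 'rV[R]_d => q 0 j * vcomp U l (p + (0, - rho *: q))) =
  boxint 3 (fun q : 'rV[R]_d => q 0 l * vcomp U j (p + (0, - rho *: q))).
Proof.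
move=> Tp; pose g (p : ST) := p.2 0 j * vcomp U l p - p.2 0 l * vcomp U j p.
have cc k : continuous (fun p : ST => p.2 0 k).
  exact: (continuous_comp2 (@cont_snd R 'rV[R]_d) (@continuous_coord _ _ k)).
have cg : continuous g by apply: contD; [|apply: contN]; apply: contM.
have g_tube p' : g p' != 0 -> tube p'.
  rewrite /g; have [->|] := eqVneq (vcomp U l p') 0; last by move=> /U_tube.
  have [->|/U_tube//] := eqVneq (vcomp U j p') 0.
  by rewrite !mulr0 subrr eqxx.
have := integral_slice0 cg g_tube Tp (U_angular p.1 j l).
have c k := continuous_comp2 (@dilate_continuous p (- rho)) (@cU k).
have c1 k m := @coord_dilate_continuous _ p (- rho) m (@cU k).
have -> : boxint 3 (fun q : 'rV[R]_d => g (p + (0, - rho *: q))) =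
  boxint 3 (fun q : 'rV[R]_d => (p.2 0 j * vcomp U l (p + (0, - rho *: q)) +
     (- p.2 0 l) * vcomp U j (p + (0, - rho *: q))) +
   ((- rho) * (q 0 j * vcomp U l (p + (0, - rho *: q))) +
    rho * (q 0 l * vcomp U j (p + (0, - rho *: q))))).
  by apply: eq_boxint => // q _; rewrite /g /= !mxE; ring.
rewrite !boxintD//; do ?[apply: contD|apply: contZ] => //.
rewrite !boxintZ// !mean0// !mulr0 !add0r mulNr addrC => /eqP.
by rewrite subr_eq0 => /eqP/(mulfI (lt0r_neq0 r0)).
Qed.

End Momenta.

Section Operator.
Variables (E : ST -> R) (B mu : R).
Hypothesis HE : bndF L.+3 B mu E.
Notation phi := (comove X E).
Notation dphi i := (comove X (pdx i E)).
Hypothesis phi_tube : forall p, phi p != 0 -> tube p.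
Hypothesis dphi_tube : forall l p, dphi l p != 0 -> tube p.
Hypothesis phi_mass : forall p : ST, tube p ->
  boxint 3 (fun q : 'rV[R]_d => phi (p + (0, rho *: q))) = 1.

Definition symdiv_inv (U : vfield R d) (j k : 'I_d) (p : ST) : R :=
  - rho ^+ 2 * (\sum_l segment_avg rho true (vcomp U l) (dphi l) (coord2_weight j k) p)
  - rho * segment_avg rho false (vcomp U k) phi (coord_weight j) p.

Let HE2 : bndF L.+2 B mu E := bndC_pred HE.
Let HdE l : bndF L.+2 (B * mu) mu (pdx l E) := bndC_pdx l HE.

(** Integration by parts in [q_l] moves the derivative onto [q_k] and leaves the unit mass of the
    bump. *)
Lemma phi_first_moment k l p : tube p ->
  boxint 3 (fun q : 'rV[R]_d => q 0 k * dphi l (p + (0, rho *: q))) = - (k == l)%:R / rho.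
Proof.
move=> Tp.
have sp := bndC_spatialC (0 : R) (bndC_comove (@X_continuous R d v X HX) HE).
have cphi : continuous phi by case: sp.
have dph q : derivable phi q (ex l) by case: sp => _ /(_ l)[].
have cdphi : continuous (dphi l).
  by rewrite -(pdx_comove X HE2); case: sp => _ /(_ l)[_ []].
have c1 := continuous_comp2 (@dilate_continuous p rho) cphi.
have c2 := @coord_dilate_continuous _ p rho k cdphi.
have h : boxint 3 (fun q : 'rV[R]_d => (k == l)%:R * phi (p + (0, rho *: q)) +
     rho * (q 0 k * dphi l (p + (0, rho *: q)))) = 0.
  apply: (@boxint_derive0 _ 3 c3 d (fun q => q 0 k * phi (p + (0, rho *: q))) _ l).
  - exact: coord_dilate_continuous.
  - by apply: contD; exact: contZ.
  - move=> q; have h := is_deriveM (is_derive_coord q l k)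
      (@is_derive_dilation R d phi l p rho q (dph _)).
    apply: is_derive_eq h _; rewrite (pdx_comove X HE2) /GRing.scale /=; ring.
  - move=> q q3; have [->|fn] := eqVneq (phi (p + (0, rho *: q))) 0; first by rewrite mulr0.
    by case: (tube_far Tp q3 _ (phi_tube fn)); rewrite gtr0_norm.
move: h; rewrite boxintD//; [|exact: contZ|exact: contZ].
rewrite !boxintZ// phi_mass// mulr1 => /eqP; rewrite addrC addr_eq0 => /eqP <-.
by rewrite mulrC mulKf// gt_eqF.
Qed.

Variable U : vfield R d.
Hypothesis aU : forall l, advectedC v L.+1 (vcomp U l).
Hypothesis U_tube : forall l p, vcomp U l p != 0 -> tube p.
Hypothesis U_linear : zero_linear_momentum U.
Hypothesis U_angular : zero_angular_momentum U.

Let cU l : continuous (vcomp U l). Proof. by case: (aU l) => -[]. Qed.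

Let dS l j k i p : is_derive p (ex i) (segment_avg rho true (vcomp U l) (dphi l) (coord2_weight j k))
   (pdx i (segment_avg rho true (vcomp U l) (dphi l) (coord2_weight j k)) p).
Proof. by apply: derivableP; case: (segment_avg_pdx rho HX (aU l) (HdE l) (weight_coord2 j k) true i p). Qed.

Let dS0 j k i p : is_derive p (ex i) (segment_avg rho false (vcomp U k) phi (coord_weight j))
   (pdx i (segment_avg rho false (vcomp U k) phi (coord_weight j)) p).
Proof. by apply: derivableP; case: (segment_avg_pdx rho HX (aU k) HE2 (weight_coord j) false i p). Qed.

Lemma is_derive_sumr (V : normedModType R) (I : Type) (s : seq I) (F : I -> V -> R) (D : I -> R)
    (p u : V) : (forall i, is_derive p u (F i) (D i)) ->
  is_derive p u (fun x => \sum_(i <- s) F i x) (\sum_(i <- s) D i).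
Proof.
move=> dF; elim: s => [|i s IH].
  by rewrite big_nil; under [fun x => _]eq_fun do rewrite big_nil; exact: is_derive_cst.
rewrite big_cons; under [fun x => _]eq_fun do rewrite big_cons.
exact: (is_deriveD (dF i) IH).
Qed.

Lemma symdiv_inv_pdx j k i p :
  is_derive p (ex i) (symdiv_inv U j k)
   (- rho ^+ 2 * (\sum_l pdx i (segment_avg rho true (vcomp U l) (dphi l) (coord2_weight j k)) p)
    - rho * pdx i (segment_avg rho false (vcomp U k) phi (coord_weight j)) p).
Proof.
have h1 := is_derive_sumr (index_enum 'I_d) (fun l => dS l j k i p).
exact: (is_deriveB (is_deriveZ (- rho ^+ 2) h1) (is_deriveZ rho (dS0 j k i p))).
Qed.

(** At [s = 0] the first moment of [d_l phi] is [- delta_kl / rho], which returns [U^k]. At [s = 1]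
    there remains [rho] times the sum over [l] of a first moment of [U] times [d_l phi]; the
    endpoint term gives the same sum with the moment transposed and the opposite sign, and
    [first_moment_sym] cancels them. *)
Lemma symdiv_invP k p : \sum_j pdx j (symdiv_inv U j k) p = U p 0 k.
Proof.
have -> : \sum_j pdx j (symdiv_inv U j k) p =
   - rho ^+ 2 * (\sum_l \sum_j pdx j (segment_avg rho true (vcomp U l) (dphi l) (coord2_weight j k)) p)
    - rho * \sum_j pdx j (segment_avg rho false (vcomp U k) phi (coord_weight j)) p.
  rewrite exchange_big !mulr_sumr -sumrB; apply: eq_bigr => j _.
  by have [_ e] := symdiv_inv_pdx j k j p; exact: e.
under eq_bigr => l _ do rewrite (div_segment_avg_true r0 HX (aU l) (HdE l)).
under [X in _ - rho * X]eq_bigr => j _ do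
  rewrite (div_segment_avg_false (aU k) HE2 (@U_tube k) phi_tube (fun p => @mean0 U cU U_tube U_linear k p)).
have e1 : \sum_l rho^-1 * (vcomp U l p * boxint 3 (fun q : 'rV[R]_d => q 0 k * dphi l (p + (0, rho *: q))) -
    boxint 3 (fun q : 'rV[R]_d => q 0 k * vcomp U l (p + (0, - rho *: q))) * dphi l p) =
  - rho ^- 2 * U p 0 k - rho^-1 * \sum_l boxint 3 (fun q : 'rV[R]_d => q 0 l * vcomp U k (p + (0, - rho *: q))) * dphi l p.
  rewrite -mulr_sumr sumrB mulrBr; congr (_ - _).
    rewrite (bigD1 k)//= big1 => [|l lk]; last first.
      (* The moments are computed for centres in the tube; elsewhere the factor in front of them
         vanishes. *)
      have [->|/U_tube Tp] := eqVneq (vcomp U l p) 0; first by rewrite mul0r.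
      by rewrite phi_first_moment// eq_sym (negbTE lk) oppr0 mul0r mulr0.
    rewrite addr0; have [e|Un] := eqVneq (vcomp U k p) 0.
      by rewrite e mul0r mulr0; move: e; rewrite /vcomp => ->; rewrite mulr0.
    rewrite phi_first_moment ?eqxx; last exact: (U_tube Un).
    by rewrite mulr1n /vcomp; field; rewrite gt_eqF.
  congr (_ * _); apply: eq_bigr => l _.
  have [->|/dphi_tube Tp] := eqVneq (dphi l p) 0; first by rewrite !mulr0.
  by rewrite (first_moment_sym cU U_tube U_linear U_angular).
rewrite e1; set S := \sum_l _.
field; rewrite gt_eqF//.
Qed.

Lemma symdiv_inv_sym j k p : symdiv_inv U j k p = symdiv_inv U k j p.
Proof.
rewrite /symdiv_inv; congr (_ * _ - _ * _).
  apply: eq_bigr => l _; congr (segment_avg _ _ _ _ _ _).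
  by apply/funext => q; rewrite /coord2_weight mulrC.
rewrite !(segment_avg_false_E E (aU _)); try exact: continuous_coord.
have [->|/phi_tube Tp] := eqVneq (phi p) 0; first by rewrite !mulr0.
by congr (_ * _); exact: (first_moment_sym cU U_tube U_linear U_angular).
Qed.

End Operator.
End Inverse.

(** * Cylinders and flows *)

Section Cylinder.
Context {R : realType} {d : nat}.
Local Notation ST := (R * 'rV[R]_d)%type.
Local Notation ex i := ((0 : R, delta_mx 0 i : 'rV[R]_d) : ST).
Local Notation bndF k C mu f := (bndC (setT : set (R * ST)) k C mu (fun _ => f)).

Variables (X : R -> 'rV[R]_d) (rho : R).
Hypothesis r0 : 0 < rho.

Definition sqdist (p : ST) : R := \sum_(k < d) (p.2 0 k - X p.1 0 k) ^+ 2.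

Lemma sqdist_tube p : sqdist p <= rho ^+ 2 -> tube X rho p.
Proof.
move=> h k; rewrite -ler_sqr ?nnegrE ?normr_ge0 ?(ltW r0)// real_normK ?num_real//.
apply: le_trans h; rewrite /sqdist (bigD1 k)//= lerDl.
by apply: sumr_ge0 => i _; exact: sqr_ge0.
Qed.

Lemma enorm_le (h : 'rV[R]_d) : (enorm h <= rho) = (\sum_(i < d) h 0 i ^+ 2 <= rho ^+ 2).
Proof.
have S0 : 0 <= \sum_(i < d) h 0 i ^+ 2 by apply: sumr_ge0 => i _; exact: sqr_ge0.
by rewrite /enorm -[in LHS](gtr0_norm r0) -sqrtr_sqr ler_sqrt// sqr_ge0.
Qed.

Lemma coord_le_enorm (h : 'rV[R]_d) i : `|h 0 i| <= enorm h.
Proof.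
rewrite /enorm -sqrtr_sqr ler_sqrt; last by apply: sumr_ge0 => j _; exact: sqr_ge0.
by rewrite (bigD1 i)//= lerDl; apply: sumr_ge0 => j _; exact: sqr_ge0.
Qed.

(** The point is the combination of the two endpoints with weights [1 - s] and [s]. With
    [y = rho q], the identity [(1-s) |x - s y|^2 + s |x + (1-s) y|^2 - |x|^2 = s (1-s) |y|^2] gives
    convexity without a norm. *)
Lemma sqdist_convex (p : ST) (q : 'rV[R]_d) (s : R) : 0 <= s <= 1 ->
  sqdist (p + (0, shift_lo rho (s, q))) <= rho ^+ 2 ->
  sqdist (p + (0, shift_hi rho (s, q))) <= rho ^+ 2 -> sqdist p <= rho ^+ 2.
Proof.
move=> /andP[s0 s1] h1 h2.
apply: (@le_trans _ _ ((1 - s) * sqdist (p + (0, shift_lo rho (s, q))) +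
   s * sqdist (p + (0, shift_hi rho (s, q))))); last first.
  have : (1 - s) * rho ^+ 2 + s * rho ^+ 2 = rho ^+ 2 by ring.
  by move=> <-; apply: lerD; apply: ler_wpM2l => //; rewrite subr_ge0.
rewrite /sqdist !mulr_sumr -big_split; apply: ler_sum => k _ /=.
rewrite !addr0 !mxE; set x := p.2 0 k - _.
have -> : p.2 0 k + - (s * rho) * q 0 k - X p.1 0 k = x - s * rho * q 0 k by rewrite /x; ring.
have -> : p.2 0 k + (1 - s) * rho * q 0 k - X p.1 0 k = x + (1 - s) * rho * q 0 k by rewrite /x; ring.
rewrite -subr_ge0.
have -> : (1 - s) * (x - s * rho * q 0 k) ^+ 2 + s * (x + (1 - s) * rho * q 0 k) ^+ 2 - x ^+ 2 =
   s * (1 - s) * (rho * q 0 k) ^+ 2 by ring.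
by rewrite mulr_ge0 ?sqr_ge0// mulr_ge0// subr_ge0.
Qed.

Variables (t0 tau : R).

Definition cylinder : set ST := [set p : ST | `|p.1 - t0| <= tau /\ sqdist p <= rho ^+ 2].

Lemma segment_avg_support b (f psi : ST -> R) (P : 'rV[R]_d -> R) p :
  (forall p, f p != 0 -> cylinder p) -> (forall p, psi p != 0 -> sqdist p <= rho ^+ 2) ->
  ~ cylinder p -> segment_avg rho b f psi P p = 0.
Proof.
move=> fc pc np; rewrite /segment_avg -[RHS](@avgbox0 R d b); apply: eq_avgbox => s q s01 _.
rewrite /segment_kernel; have [->|/fc [h1 h2]] := eqVneq (f (p + (0, shift_lo rho (s, q)))) 0.
  by rewrite mul0r mulr0.
have [->|/pc h3] := eqVneq (psi (p + (0, shift_hi rho (s, q)))) 0.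
  by rewrite !mulr0.
case: np; split; last exact: (sqdist_convex s01 h2 h3).
by move: h1; rewrite /= addr0.
Qed.

Hypothesis cX : continuous X.

Lemma sqdist_continuous : continuous sqdist.
Proof.
apply: cont_sum => k.
have c1 : continuous (fun p : ST => p.2 0 k - X p.1 0 k).
  apply: contD; first exact: (continuous_comp2 (@cont_snd R 'rV[R]_d) (@continuous_coord _ _ k)).
  apply: contN.
  exact: (continuous_comp2 (continuous_comp2 (@cont_fst R 'rV[R]_d) cX) (@continuous_coord _ _ k)).
by under [fun p => _]eq_fun do rewrite expr2; exact: contM.
Qed.

Lemma cylinder_closed : closed cylinder.
Proof.
have c1 : continuous (fun p : ST => `|p.1 - t0|).
  have c : continuous (fun p : ST => p.1 - t0).
    by apply: contD; [exact: cont_fst|exact: cst_continuous].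
  by move=> p; apply: cvg_norm; exact: c.
have h1 := closed_comp (fun p _ => c1 p) (@closed_le R tau).
have h2 := closed_comp (fun p _ => @sqdist_continuous p) (@closed_le R (rho ^+ 2)).
exact: (closedI h1 h2).
Qed.

Section Profile.
Variables (h : R -> R) (K : R) (L : nat).
Hypothesis d0 : (0 < d)%N.
Hypothesis K0 : 0 < K.
Hypothesis Hh : smooth1_bnd K L h.
Hypothesis h0 : forall x, d%:R^-1 <= `|x| -> h x = 0.
Hypothesis h1 : forall x, `|x| <= 1 -> int1 (- 3) 3 (fun q => h (x + q)) = 1.

(** Unit mass is meant in the rescaled variable [q], so there is no factor [rho^-d] and the
    amplitude [K ^+ d] does not depend on [rho]. *)
Definition profile (p : ST) : R := \prod_(i < d) h (rho^-1 * p.2 0 i).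

Lemma profile_bndF : bndF L (K ^+ d) (d%:R * rho^-1) profile.
Proof.
have hs : size (index_enum 'I_d) = d by rewrite -sum1_size sum1_card card_ord.
have Ri : 0 <= rho^-1 by rewrite invr_ge0 ltW.
have := bndC_prod (index_enum 'I_d) Ri (ltW K0) (fun i => @bndC_coord R d R L K h i rho r0 Hh).
by rewrite hs.
Qed.

Lemma comove_profile p :
  comove X profile p = \prod_(i < d) h (rho^-1 * (p.2 0 i - X p.1 0 i)).
Proof. by apply: eq_bigr => i _; rewrite /= !mxE. Qed.

Lemma profile_far (p : ST) k : rho / d%:R <= `|p.2 0 k - X p.1 0 k| -> comove X profile p = 0.
Proof.
move=> hk; rewrite comove_profile (bigD1 k)//= h0 ?mul0r//.
rewrite normrM gtr0_norm ?invr_gt0//.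
by rewrite ler_pdivlMl.
Qed.

(** The cube of half-side [rho / d] fits in the ball of radius [rho], as [d (rho / d)^2 <= rho^2];
    hence the support radius [d^-1] imposed on [h]. *)
Lemma near_sqdist (p : ST) : (forall k, `|p.2 0 k - X p.1 0 k| <= rho / d%:R) -> sqdist p <= rho ^+ 2.
Proof.
move=> hk; have d1 : 0 < d%:R :> R by rewrite ltr0n.
apply: (@le_trans _ _ (\sum_(k < d) (rho / d%:R) ^+ 2)).
  apply: ler_sum => k _; rewrite -[leLHS]real_normK ?num_real//.
  by rewrite ler_sqr ?nnegrE ?normr_ge0 ?divr_ge0 ?(ltW r0)//.
rewrite sumr_const card_ord -[leLHS]mulr_natr.
rewrite exprMn -mulrA ler_piMr ?sqr_ge0// expr2 -mulrA mulVf ?gt_eqF// mulr1.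
by rewrite invf_le1// ler1n.
Qed.

Lemma profile_support p : comove X profile p != 0 -> sqdist p <= rho ^+ 2.
Proof.
move=> pn; apply: near_sqdist => k; rewrite leNgt; apply: contra pn => hk.
by rewrite (@profile_far p k)// ltW.
Qed.

Lemma dprofile_support l p : (0 < L)%N -> comove X (pdx l profile) p != 0 -> sqdist p <= rho ^+ 2.
Proof.
move=> L0; have HE : bndF 1 (K ^+ d) (d%:R * rho^-1) profile := bndC_leq L0 profile_bndF.
have <- : pdx l (comove X profile) = comove X (pdx l profile).
  apply/funext => q.
  have dE : derivable profile (0, q.2 - X q.1) (ex l) := @bndC_der _ _ _ _ _ _ _ _ l HE 0 _.
  by have [_ e] := is_derive_comove dE; exact: e.
move=> pn; apply: near_sqdist => k; rewrite leNgt; apply: contra pn => hk.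
have ck : continuous (fun p : ST => `|p.2 0 k - X p.1 0 k|).
  have c : continuous (fun p : ST => p.2 0 k - X p.1 0 k).
    apply: contD; first exact: (continuous_comp2 (@cont_snd R 'rV[R]_d) (@continuous_coord _ _ k)).
    apply: contN.
    exact: (continuous_comp2 (continuous_comp2 (@cont_fst R 'rV[R]_d) cX) (@continuous_coord _ _ k)).
  by move=> q; apply: cvg_norm; exact: c.
pose O : set ST := [set p : ST | rho / d%:R < `|p.2 0 k - X p.1 0 k|].
have oO : open O.
  by apply: (@open_comp _ _ (fun p : ST => `|p.2 0 k - X p.1 0 k|) [set x | rho / d%:R < x]);
    [move=> q _; exact: ck|exact: open_gt].
have [_ e] := @derive_zero_open R d (ex l) O (comove X profile) oO
  (fun q Oq => @profile_far q k (ltW Oq)) p hk.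
by apply/eqP; exact: e.
Qed.

Lemma profile_mass p : tube X rho p ->
  boxint 3 (fun q : 'rV[R]_d => comove X profile (p + (0, rho *: q))) = 1.
Proof.
move=> Tp; pose y i := rho^-1 * (p.2 0 i - X p.1 0 i).
have ch : continuous h by case: (L) Hh => [|?] [].
transitivity (boxint 3 (fun q : 'rV[R]_d => \prod_(i < d) (fun x => h (y i + x)) (q 0 i))).
  apply: eq_boxint => // q _; rewrite comove_profile; apply: eq_bigr => i _.
  congr h; rewrite /y /= addr0 !mxE addrAC mulrDr; congr (_ + _).
  by rewrite mulKf// gt_eqF.
have cy i : continuous (fun x => h (y i + x)).
  exact: (continuous_comp2 (contD (@cst_continuous _ _ (y i)) (@cont_id R)) ch).
have c3 : 0 <= 3 :> R by [].
rewrite (@boxint_prod R 3 c3 d (fun i x => h (y i + x)))//.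
apply: big1 => i _; apply: h1.
by rewrite /y normrM gtr0_norm ?invr_gt0// ler_pdivrMl// mulr1; exact: Tp.
Qed.

End Profile.
End Cylinder.

(** * Uniqueness of trajectories by Gronwall's inequality *)

Section FlowUniqueness.
Context {R : realType} {d : nat}.
Local Notation ST := (R * 'rV[R]_d)%type.
Local Notation ex i := ((0 : R, delta_mx 0 i : 'rV[R]_d) : ST).

(** Cauchy-Schwarz up to a factor 2, from [a b <= a^2 + b^2] on every pair of indices. *)
Lemma sum_prod_le_sq (x : 'I_d -> R) :
  (\sum_k `|x k|) * (\sum_k `|x k|) <= 2 * d%:R * \sum_k x k ^+ 2.
Proof.
rewrite mulr_suml.
apply: (@le_trans _ _ (\sum_(k < d) \sum_(m < d) (x k ^+ 2 + x m ^+ 2))).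
  apply: ler_sum => k _; rewrite mulr_sumr; apply: ler_sum => m _.
  rewrite -(real_normK (num_real (x k))) -(real_normK (num_real (x m))).
  move: `|x k| `|x m| => a b; rewrite -subr_ge0.
  have -> : a ^+ 2 + b ^+ 2 - a * b = (a - b / 2) ^+ 2 + 3 / 4 * b ^+ 2 by field.
  by rewrite addr_ge0 ?sqr_ge0// mulr_ge0 ?sqr_ge0//; lra.
rewrite exchange_big /=.
under eq_bigr => m _ do rewrite big_split /= sumr_const card_ord -mulr_natr.
rewrite big_split /= sumr_const card_ord -[X in X + _]mulr_natr -mulr_suml.
rewrite le_eqVlt; apply/orP; left; apply/eqP; ring.
Qed.

(** The squared distance [w] satisfies [|w'| <= C w], so [exp (- C t) w] does not increase and
    [exp (C t) w] does not decrease. The first settles times after [t0], the second times before. *)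
Lemma ode_unique (v : vfield R d) (M : R) (X Y : R -> 'rV[R]_d) (t0 : R) : 0 <= M ->
  (forall l i p, derivable (vcomp v l : ST -> R) p (ex i)) ->
  (forall l i p, `|pdx i (vcomp v l) p| <= M) ->
  (forall (t : R) k, is_derive t (1 : R) (fun r => X r 0 k) (v (t, X t) 0 k)) ->
  (forall (t : R) k, is_derive t (1 : R) (fun r => Y r 0 k) (v (t, Y t) 0 k)) ->
  X t0 = Y t0 -> forall t, X t = Y t.
Proof.
move=> M0 dv bv dX dY XY0 t.
pose w t := \sum_k (X t 0 k - Y t 0 k) * (X t 0 k - Y t 0 k).
pose w' t := \sum_k 2 * (X t 0 k - Y t 0 k) * (v (t, X t) 0 k - v (t, Y t) 0 k).
have dw s : is_derive s (1 : R) w (w' s).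
  apply: is_derive_sumr => k.
  have h := is_deriveB (dX s k) (dY s k).
  have {}h : is_derive s (1 : R) (fun r => X r 0 k - Y r 0 k) _ := h.
  have h2 := is_deriveM h h.
  apply: is_derive_eq h2 _; rewrite /GRing.scale /=; ring.
(* A factor [2 M] from the derivative of the square and the Lipschitz bound, a factor [2 d] from
   [sum_prod_le_sq]. *)
pose C := 4 * M * d%:R.
have w0 s : 0 <= w s by apply: sumr_ge0 => k _; rewrite -expr2 sqr_ge0.
have w'w s : `|w' s| <= C * w s.
  apply: le_trans (ler_norm_sum _ _ _) _.
  apply: (@le_trans _ _ (2 * M * ((\sum_k `|X s 0 k - Y s 0 k|) * (\sum_k `|X s 0 k - Y s 0 k|)))).
    rewrite mulr_suml mulr_sumr; apply: ler_sum => k _.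
    have := spatial_lipschitz (dv k) (bv k) (s, Y s) (X s - Y s).
    have -> : (s, Y s) + (0, X s - Y s) = (s, X s) :> ST.
      by apply: (f_equal2 pair); [exact: addr0|exact: subrKC].
    under eq_bigr => m _ do rewrite !mxE.
    rewrite /vcomp => H; rewrite !normrM (@ger0_norm _ 2)// -!mulrA ler_wpM2l//.
    by rewrite [M * _]mulrCA ler_wpM2l.
  have := sum_prod_le_sq (fun k => X s 0 k - Y s 0 k).
  move/(ler_wpM2l (mulr_ge0 (ler0n R 2) M0))/le_trans; apply.
  rewrite /w; under eq_bigr => k _ do rewrite expr2.
  by rewrite /C le_eqVlt; apply/orP; left; apply/eqP; ring.
have dexp (c s : R) : is_derive s (1 : R) (fun r => expR (c * r)) (c * expR (c * s)).
  have := @is_derive_affine R (@expR R) c 0 s (expR (c * s)).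
  rewrite addr0 => /(_ (is_derive_expR _)).
  by under [X in is_derive _ _ X _ -> _]eq_fun do rewrite addr0.
have dg (c s : R) : is_derive s (1 : R) (fun r => expR (c * r) * w r)
    (expR (c * s) * (w' s + c * w s)).
  have h := is_deriveM (dexp c s) (dw s).
  by apply: is_derive_eq h _; rewrite /GRing.scale /=; ring.
have wt0 : w t0 = 0 by apply: big1 => k _; rewrite XY0 subrr mulr0.
have wt : w t <= 0.
  have key (c : R) : (expR (c * t) * w t <= 0) -> w t <= 0.
    by rewrite pmulr_rle0// expR_gt0.
  have [tt|tt] := leP t0 t.
    apply: (key (- C)); have [u _] := mvt_real (dg (- C)) t0 t.
    rewrite wt0 mulr0 subr0 => ->; rewrite mulr_le0_ge0 ?subr_ge0//.
    rewrite mulr_ge0_le0 ?expR_ge0// mulNr subr_le0.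
    exact: le_trans (ler_norm _) (w'w u).
  apply: (key C); have [u _] := mvt_real (dg C) t0 t.
  rewrite wt0 mulr0 subr0 => ->; rewrite mulr_ge0_le0 ?subr_le0 ?(ltW tt)//.
  rewrite mulr_ge0 ?expR_ge0//.
  have := le_trans (ler_norm (- w' u)) _; rewrite normrN => /(_ _ (w'w u)).
  by rewrite lerNl -subr_ge0 opprK addrC.
have wt' : w t = 0 by apply/eqP; rewrite eq_le wt w0.
apply/rowP => k; apply/eqP; rewrite -subr_eq0 -sqrf_eq0 expr2 -normr_le0.
rewrite ger0_norm ?sqr_ge0 -?expr2 ?sqr_ge0// expr2 -wt' /w (bigD1 k)//= lerDl.
by apply: sumr_ge0 => m _; rewrite -expr2 sqr_ge0.
Qed.
End FlowUniqueness.

(** * Estimates for the inverse *)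

Section FinalEstimates.
Context {R : realType} {d : nat}.
Local Notation ST := (R * 'rV[R]_d)%type.
Local Notation ex i := ((0 : R, delta_mx 0 i : 'rV[R]_d) : ST).
Local Notation et := ((1 : R, 0 : 'rV[R]_d) : ST).
Local Notation bndF k C mu f := (bndC (setT : set (R * ST)) k C mu (fun _ => f)).

Lemma vC0norm_coord_le (V : vfield R d) (c : R) : (vC0norm V <= c%:E)%E ->
  forall l p, `|V p 0 l| <= c.
Proof.
move=> h l p; apply: le_trans (coord_le_enorm (V p) l) _; rewrite -lee_fin.
by apply: le_trans h; apply: ereal_sup_ubound; exists p.
Qed.

Lemma C0norm_le (f : spacetime R d -> R) (c : R) : (forall p, `|f p| <= c) ->
  (C0norm f <= c%:E)%E.
Proof. by move=> h; apply: ge_ereal_sup => _ [p _ <-]; rewrite lee_fin. Qed.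

(** The sum is at most twice its larger term. This turns a rate that the Leibniz rule has made a sum
    into a bound by any [S] dominating the pure powers. *)
Lemma powD_le (a b S : R) m : 0 <= a -> 0 <= b -> a ^+ m <= S -> b ^+ m <= S ->
  (a + b) ^+ m <= 2 ^+ m * S.
Proof.
move=> a0 b0 aS bS; wlog ab : a b a0 b0 aS bS / a <= b.
  by move=> H; have [/H|/ltW/H] := leP a b; [exact|rewrite addrC; exact].
apply: (@le_trans _ _ ((2 * b) ^+ m)).
  by apply: lerXn2r; rewrite ?nnegrE ?addr_ge0 ?mulr_ge0//; lra.
by rewrite exprMn ler_wpM2l// exprn_ge0.
Qed.

Lemma pow3D_le (a b c S : R) m : 0 <= a -> 0 <= b -> 0 <= c ->
  a ^+ m <= S -> b ^+ m <= S -> c ^+ m <= S ->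
  (a + b + c) ^+ m <= 3 ^+ m * S.
Proof.
move=> a0 b0 c0 aS bS cS.
pose x := Num.max a (Num.max b c).
have [xa [xb xc]] : a <= x /\ b <= x /\ c <= x.
  by rewrite /x !le_max !lexx !orbT.
have x0 : 0 <= x := le_trans a0 xa.
have xS : x ^+ m <= S by rewrite /x /Num.max; do 2 case: ifP.
apply: (@le_trans _ _ ((3 * x) ^+ m)).
  by apply: lerXn2r; rewrite ?nnegrE ?addr_ge0 ?mulr_ge0//; lra.
by rewrite exprMn ler_wpM2l// exprn_ge0.
Qed.

Lemma pow_le_sum2 (rho Lam : R) m : 0 < rho -> 0 < Lam ->
  (rho^-1) ^+ m <= \sum_(0 <= i < m.+1) rho ^- (m - i) * Lam ^+ i /\
  Lam ^+ m <= \sum_(0 <= i < m.+1) rho ^- (m - i) * Lam ^+ i.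
Proof.
move=> r0 l0.
have p0 i : 0 <= rho ^- (m - i) * Lam ^+ i.
  by rewrite mulr_ge0 ?invr_ge0 ?exprn_ge0// ltW.
rewrite big_mkord; split.
  rewrite (bigD1 ord0)//= subn0 expr0 mulr1 exprVn lerDl; exact: sumr_ge0.
rewrite (bigD1 ord_max)//= subnn expr0 invr1 mul1r lerDl; exact: sumr_ge0.
Qed.

(** One term of a nonnegative sum; it is applied at the three corners, where a single index equals
    [m]. *)
Lemma pow_le_sum3 (Xi rho Lam : R) m (i0 i1 i2 : 'I_m.+1) : 0 < Xi -> 0 < rho -> 0 < Lam ->
  (i0 + i1 + i2 = m)%N ->
  Xi ^+ i0 * rho ^- i1 * Lam ^+ i2 <=
  \sum_(m0 < m.+1) \sum_(m1 < m.+1) \sum_(m2 < m.+1 | (m0 + m1 + m2 == m)%N)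
     Xi ^+ m0 * rho ^- m1 * Lam ^+ m2.
Proof.
move=> x0 r0 l0 e.
have p0 (a b c : nat) : 0 <= Xi ^+ a * rho ^- b * Lam ^+ c.
  by rewrite !mulr_ge0 ?invr_ge0 ?exprn_ge0// ltW.
rewrite (bigD1 i0)//= (bigD1 i1)//= (bigD1 i2)//=; last by rewrite e.
rewrite -!addrA lerDl !addr_ge0//; try exact: sumr_ge0.
  by apply: sumr_ge0 => i _; apply: sumr_ge0.
by apply: sumr_ge0 => i _; apply: sumr_ge0 => j _; apply: sumr_ge0.
Qed.

Section Estimates.
Variables (L : nat) (v : vfield R d) (X : R -> 'rV[R]_d) (rho : R).
Hypothesis r0 : 0 < rho.
Hypothesis Hv : forall l, spatialC L.+1 (vcomp v l).
Hypothesis HX : forall (t : R) k,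
  is_derive t (1 : R) (fun r => X r 0 k) (v (t, X t) 0 k).
Variables (M Xi : R).
Hypothesis M0 : 0 <= M.
Hypothesis Xi0 : 0 <= Xi.
Hypothesis Hgrad : forall i l, bndF L M Xi (pdx i (vcomp v l)).
Variables (E : ST -> R) (B mu : R).
Hypothesis HE : bndF L.+3 B mu E.
Notation phi := (comove X E).
Notation dphi i := (comove X (pdx i E)).
Hypothesis phi_tube : forall p, phi p != 0 -> tube X rho p.
Hypothesis dphi_tube : forall l p, dphi l p != 0 -> tube X rho p.
Hypothesis B0 : 0 <= B.
Hypothesis mu0 : 0 <= mu.
Hypothesis mu_rho : rho * mu <= d%:R.

Let HE2 : bndF L.+2 B mu E := bndC_pred HE.
Let HdE l : bndF L.+2 (B * mu) mu (pdx l E) := bndC_pdx l HE.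
Let cX := @X_continuous R d v X HX.

Notation Rjk U j k := (symdiv_inv X rho E U j k).

Lemma segment_avg_linear b f g (E' : ST -> R) (P : 'rV[R]_d -> R) (B' a : R) p :
  advectedC v L.+1 f -> advectedC v L.+1 g -> bndF L.+2 B' mu E' -> weight P ->
  segment_avg rho b (fun q => a * f q + g q) (comove X E') P p =
  a * segment_avg rho b f (comove X E') P p + segment_avg rho b g (comove X E') P p.
Proof.
move=> Hf Hg HE' wP.
have cc h : advectedC v L.+1 h -> continuous (fun z => segment_kernel rho h (comove X E') P z p).
  move=> Hh; have c := segment_kernel_continuous (rho := rho) HX Hh HE' wP.
  exact: (continuous_comp2 (continuous_pair (@cont_id (R * 'rV[R]_d)%type) (@cst_continuous _ _ p)) c).
rewrite /segment_avg -avgboxZ; last exact: cc.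
rewrite -avgboxD; [|by apply: contZ; exact: cc|exact: cc].
by apply: eq_avgbox => s q _ _; rewrite /segment_kernel; ring.
Qed.

Lemma symdiv_inv_linear (U W : vfield R d) (a : R) j k p :
  (forall l, advectedC v L.+1 (vcomp U l)) -> (forall l, advectedC v L.+1 (vcomp W l)) ->
  Rjk (fun q => a *: U q + W q) j k p = a * Rjk U j k p + Rjk W j k p.
Proof.
move=> HU HW.
have e l : vcomp (fun q => a *: U q + W q) l = (fun q => a * vcomp U l q + vcomp W l q).
  by apply/funext => q; rewrite /vcomp !mxE.
rewrite /symdiv_inv e (segment_avg_linear _ _ _ (HU k) (HW k) HE2 (weight_coord j)).
under eq_bigr => l _ do rewrite e (segment_avg_linear _ _ _ (HU l) (HW l) (HdE l) (weight_coord2 j k)).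
rewrite big_split /= -mulr_sumr; ring.
Qed.

Variable U : vfield R d.
Hypothesis aU : forall l, advectedC v L.+1 (vcomp U l).

Lemma symdiv_inv_pdt j k p :
  is_derive p et (Rjk U j k)
   (- rho ^+ 2 * (\sum_l pdt (segment_avg rho true (vcomp U l) (dphi l) (coord2_weight j k)) p)
    - rho * pdt (segment_avg rho false (vcomp U k) phi (coord_weight j)) p).
Proof.
have h1 := is_derive_sumr (index_enum 'I_d) (fun l => derivableP
  (segment_avg_pdt_derivable (rho := rho) (b := true) (p := p) Hv HX (aU l) (HdE l) (weight_coord2 j k))).
have h2 := derivableP (segment_avg_pdt_derivable (rho := rho) (b := false) (p := p) Hv HX (aU k) HE2 (weight_coord j)).
exact: (is_deriveB (is_deriveZ (- rho ^+ 2) h1) (is_deriveZ rho h2)).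
Qed.

Lemma symdiv_inv_Dt j k p :
  Dt v (Rjk U j k) p =
  (- rho ^+ 2) * (\sum_l Dt v (segment_avg rho true (vcomp U l) (dphi l) (coord2_weight j k)) p) +
  (- rho) * Dt v (segment_avg rho false (vcomp U k) phi (coord_weight j)) p.
Proof.
rewrite {1}/Dt; have [_ e] := symdiv_inv_pdt j k p; rewrite [pdt _ _]e {e}.
have ex i : pdx i (Rjk U j k) p =
    - rho ^+ 2 * (\sum_l pdx i (segment_avg rho true (vcomp U l) (dphi l) (coord2_weight j k)) p)
    - rho * pdx i (segment_avg rho false (vcomp U k) phi (coord_weight j)) p.
  by have [_ e] := symdiv_inv_pdx rho HX HE aU j k i p; exact: e.
under [X in _ + X = _]eq_bigr => i _ do rewrite ex.
rewrite /Dt big_split /=.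
have -> : \sum_(i < d) v p 0 i * (- rho ^+ 2 * (\sum_l pdx i (segment_avg rho true (vcomp U l) (dphi l) (coord2_weight j k)) p)
    - rho * pdx i (segment_avg rho false (vcomp U k) phi (coord_weight j)) p) =
  - rho ^+ 2 * (\sum_l \sum_(i < d) v p 0 i * pdx i (segment_avg rho true (vcomp U l) (dphi l) (coord2_weight j k)) p)
  - rho * \sum_(i < d) v p 0 i * pdx i (segment_avg rho false (vcomp U k) phi (coord_weight j)) p.
  rewrite exchange_big !mulr_sumr -sumrB; apply: eq_bigr => i _ /=.
  by rewrite mulrBr -mulr_sumr; ring.
ring.
Qed.

Lemma symdiv_inv_advected j k : advectedC v L.+1 (Rjk U j k).
Proof.
have r2 (T : topologicalType) n (c : R) F : bndC (set0 : set (T * ST)) n 0 0 F ->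
    bndC (set0 : set (T * ST)) n 0 0 (fun th p => c * F th p).
  by move=> HF; exact: (regM (reg_param n (@cst_continuous T _ c)) HF).
have rS b f (E' : ST -> R) (B' : R) P n : bndF L.+2 B' mu E' -> spatialC L.+1 f -> weight P ->
    (n <= L.+1)%N -> advectedC v L.+1 f -> spatialC n (segment_avg rho b f (comove X E') P).
  move=> HE' Hf wP nL Hadv; apply: (spatialC_leq nL).
  have Hpsi := bndC_pred (bndC_comove cX HE').
  have h : bndC (set0 : set ((R * 'rV[R]_d) * ST)) L.+1 0 0 (segment_kernel rho f (comove X E') P).
    apply: (regM (reg_param _ (continuous_comp2 (@cont_snd R 'rV[R]_d) wP.1))).
    apply: regM; first exact: (reg_at (@shift_lo_continuous R d rho) Hf).
    exact: (bndC_regular _ _ (bndC_at set0 (@shift_hi_continuous R d rho) Hpsi)).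
  have h2 : bndC [set z : (R * 'rV[R]_d) * ST | in_box 3 z.1.2 /\ 0 < z.1.1 <= 1 /\ set0 z.2] L.+1 0 0
      (segment_kernel rho f (comove X E') P) by apply: bndC_sub h => z [_ [_ []]].
  exact: (bndC_spatialC 0 (bndC_avgbox b h2)).
split.
- have h : bndC (set0 : set (R * ST)) L.+1 0 0 (fun _ => Rjk U j k).
    apply: regB; apply: r2.
      apply: reg_sum => l; apply: spatialC_bndC.
      by apply: (rS _ _ _ _ _ _ (HdE l)) => //; [case: (aU l)|exact: weight_coord2].
    by apply: spatialC_bndC; apply: (rS _ _ _ _ _ _ HE2) => //; [case: (aU k)|exact: weight_coord].
  exact: (bndC_spatialC 0 h).
- by move=> p; case: (symdiv_inv_pdt j k p).
have h : bndC (set0 : set (R * ST)) L 0 0 (fun _ => Dt v (Rjk U j k)).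
  apply: (@bndC_ext _ _ _ _ _ _ _ (fun _ p =>
    (- rho ^+ 2) * (\sum_l Dt v (segment_avg rho true (vcomp U l) (dphi l) (coord2_weight j k)) p) +
    (- rho) * Dt v (segment_avg rho false (vcomp U k) phi (coord_weight j)) p)).
    by move=> _ p; rewrite symdiv_inv_Dt.
  apply: regD; apply: r2.
    apply: reg_sum => l; apply: spatialC_bndC.
    exact: (segment_avg_Dt_spatialC rho Hv HX (aU l) (HdE l) (weight_coord2 j k)).
  apply: spatialC_bndC; exact: (segment_avg_Dt_spatialC rho Hv HX (aU k) HE2 (weight_coord j)).
exact: (bndC_spatialC 0 h).
Qed.

Variables (A At la : R).
Hypothesis A0 : 0 <= A.
Hypothesis At0 : 0 <= At.
Hypothesis la0 : 0 <= la.
Hypothesis HU : forall l, bndF L.+1 A la (vcomp U l).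
Hypothesis HDU : forall l, bndF L At la (Dt v (vcomp U l)).
Hypothesis U_tube : forall l p, vcomp U l p != 0 -> tube X rho p.

Definition symdiv_const : R := 9 * B * 6 ^+ d * (d%:R * d%:R + 1).

Lemma size_index_enum : (size (index_enum 'I_d))%:R = d%:R :> R.
Proof. by congr _%:R; rewrite -sum1_size sum1_card card_ord. Qed.

(** Both terms of the inverse scale like [rho]: the segment term has the factor [rho^2], but also
    one more derivative of the bump, worth [mu], and [rho mu <= d]. *)
Lemma bndC_combine (D : set (R * ST)) n (S m : R) (F : 'I_d -> ST -> R) (G : ST -> R) :
  0 <= S -> 0 <= m ->
  (forall l, bndC D n (S * (B * mu)) m (fun _ => F l)) -> bndC D n (S * B) m (fun _ => G) ->
  bndC D n (rho * S * B * (d%:R * d%:R + 1)) m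
    (fun _ p => (- rho ^+ 2) * (\sum_l F l p) + (- rho) * G p).
Proof.
move=> S0 m0 HF HG.
have h1 := bndCZ (- rho ^+ 2) (bndC_sum (index_enum 'I_d) m0 HF).
have := bndCD h1 (bndCZ (- rho) HG).
rewrite size_index_enum !normrN normrX (gtr0_norm r0) => h.
apply: bndC_le h => //.
  by rewrite addr_ge0// ?mulr_ge0// ?exprn_ge0 ?(ltW r0).
have -> : rho ^+ 2 * (d%:R * (S * (B * mu))) + rho * (S * B) =
   rho * S * B * (d%:R * (rho * mu) + 1) by ring.
rewrite ler_wpM2l ?mulr_ge0 ?(ltW r0)// lerD2r ler_wpM2l//.
Qed.

Lemma symdiv_inv_bound j k :
  bndF L.+1 (symdiv_const * A * rho) (la + mu) (Rjk U j k).
Proof.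
have h := @bndC_combine setT L.+1 (9 * A * 6 ^+ d) (la + mu)
  (fun l => segment_avg rho true (vcomp U l) (dphi l) (coord2_weight j k)) (segment_avg rho false (vcomp U k) phi (coord_weight j)).
have -> : symdiv_const * A * rho = rho * (9 * A * 6 ^+ d) * B * (d%:R * d%:R + 1).
  by rewrite /symdiv_const; ring.
apply: (@bndC_ext _ _ _ _ _ _ _ (fun _ p => - rho ^+ 2 * (\sum_l segment_avg rho true (vcomp U l) (dphi l) (coord2_weight j k) p)
   + (- rho) * segment_avg rho false (vcomp U k) phi (coord_weight j) p)).
  by move=> _ p; rewrite /symdiv_inv; congr (_ + _); exact: mulNr.
apply: h.
- by rewrite !mulr_ge0// exprn_ge0.
- exact: addr_ge0.
- move=> l; have Hd := bndC_pred (bndC_comove cX (HdE l)).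
  have := segment_avg_bndF rho true (weight_coord2 j k) (HU l) Hd.
  by rewrite (_ : 9 * A * (B * mu) * _ = 9 * A * 6 ^+ d * (B * mu))//; ring.
- have Hd := bndC_pred (bndC_comove cX HE2).
  have := segment_avg_bndF rho false (weight_coord j) (HU k) Hd.
  by rewrite (_ : 9 * A * B * _ = 9 * A * 6 ^+ d * B)//; ring.
Qed.

Definition comm_const : R := d%:R * (1 + 3 * d%:R * d%:R + 3 * d%:R + d%:R * d%:R).

(** Confined to the tube, since the bound on [v(x) - v(t, X(t))] grows with the distance to
    [X(t)]. *)
Lemma symdiv_inv_Dt_bound j k :
  bndC [set x : R * ST | tube X rho x.2] L (symdiv_const * (At + A * M * comm_const) * rho)
   (la + Xi + rho^-1 + mu) (fun _ => Dt v (Rjk U j k)).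
Proof.
have m0 : 0 <= la + Xi + rho^-1 + mu by rewrite !addr_ge0// invr_ge0 ltW.
pose Q := At + A * M * comm_const.
have c0 : 0 <= comm_const by rewrite mulr_ge0// !addr_ge0// !mulr_ge0.
have Q0 : 0 <= Q by rewrite addr_ge0// !mulr_ge0.
have h := @bndC_combine [set x : R * ST | tube X rho x.2] L (9 * Q * 6 ^+ d) (la + Xi + rho^-1 + mu)
  (fun l => Dt v (segment_avg rho true (vcomp U l) (dphi l) (coord2_weight j k))) (Dt v (segment_avg rho false (vcomp U k) phi (coord_weight j))).
have -> : symdiv_const * (At + A * M * comm_const) * rho = rho * (9 * Q * 6 ^+ d) * B * (d%:R * d%:R + 1).
  by rewrite /symdiv_const /Q; ring.
apply: (@bndC_ext _ _ _ _ _ _ _ (fun _ p =>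
    (- rho ^+ 2) * (\sum_l Dt v (segment_avg rho true (vcomp U l) (dphi l) (coord2_weight j k)) p) +
    (- rho) * Dt v (segment_avg rho false (vcomp U k) phi (coord_weight j)) p)).
  by move=> _ p; rewrite symdiv_inv_Dt.
apply: h => //.
- by rewrite !mulr_ge0// exprn_ge0.
- move=> l.
  have := segment_avg_Dt_bound r0 Hv HX M0 Xi0 Hgrad (aU l) (HU l) (HDU l) (HdE l) (weight_coord2 j k)
    (weight_dcoord2 j k) (coord2_weight_is_derive j k) A0 At0 (mulr_ge0 B0 mu0) la0 mu0 mu_rho
    (@U_tube l) (@dphi_tube l) true.
  by rewrite (_ : Dt_const M A At (B * mu) * 6 ^+ d = 9 * Q * 6 ^+ d * (B * mu))// /Dt_const /Q /comm_const; ring.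
have := segment_avg_Dt_bound r0 Hv HX M0 Xi0 Hgrad (aU k) (HU k) (HDU k) HE2 (weight_coord j)
    (weight_dcoord j) (coord_weight_is_derive j) A0 At0 B0 la0 mu0 mu_rho
    (@U_tube k) phi_tube false.
by rewrite (_ : Dt_const M A At B * 6 ^+ d = 9 * Q * 6 ^+ d * B)// /Dt_const /Q /comm_const; ring.
Qed.

End Estimates.
End FinalEstimates.

(** * The flow cylinder as a neighbourhood of one trajectory *)

Section FlowCylinder.
Context {R : realType} {d : nat}.
Local Notation ST := (R * 'rV[R]_d)%type.
Local Notation ex i := ((0 : R, delta_mx 0 i : 'rV[R]_d) : ST).
Variables (v : vfield R d) (p0 : ST).

(** Parametrised by absolute time, because the fields are evaluated at [(t, X t)]. *)
Definition trajectory (Phi : R -> ST -> ST) (t : R) : 'rV[R]_d := (Phi (t - p0.1) p0).2.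

Lemma flow_trajectory Phi t : is_flow v Phi -> Phi (t - p0.1) p0 = (t, trajectory Phi t).
Proof.
by move=> /(_ p0)[_ /(_ (t - p0.1))[e _]]; rewrite [LHS]surjective_pairing e subrKC.
Qed.

Lemma trajectory_start Phi : is_flow v Phi -> trajectory Phi p0.1 = p0.2.
Proof. by move=> /(_ p0)[e _]; rewrite /trajectory subrr e. Qed.

Lemma is_derive_trajectory Phi : is_flow v Phi -> forall (t : R) k,
  is_derive t (1 : R) (fun r => trajectory Phi r 0 k) (v (t, trajectory Phi t) 0 k).
Proof.
move=> HF t k; rewrite -(flow_trajectory t HF).
have [_ /(_ (t - p0.1))[_ [dM eM]]] := HF p0.
have dk := (derivable_mxP _ _ _).1 dM 0 k.
have h : is_derive (t - p0.1) (1 : R) (fun r => (Phi r p0).2 0 k) (v (Phi (t - p0.1) p0) 0 k).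
  by split; [exact: dk|rewrite -eM derive_mx// mxE].
have := @is_derive_affine R (fun r => (Phi r p0).2 0 k) 1 (- p0.1) t (v (Phi (t - p0.1) p0) 0 k).
rewrite !mul1r => /(_ h).
by under [X in is_derive _ _ X _ -> _]eq_fun do rewrite mul1r.
Qed.

(** In [flow_cylinder] each point may come with its own flow; the bounded gradient forces all of
    them to share the trajectory of the centre. *)
Lemma flow_cylinderE Phi (M tau rho : R) : is_flow v Phi -> 0 <= M -> 0 < rho ->
  (forall l i p, derivable (vcomp v l : ST -> R) p (ex i)) ->
  (forall l i p, `|pdx i (vcomp v l) p| <= M) ->
  flow_cylinder v tau rho p0 = cylinder (trajectory Phi) rho p0.1 tau.
Proof.
move=> HF M0 r0 dv bv; apply/seteqP; split => [p [Psi [HG [s [h [sle hle ->]]]]]|p [h1 h2]].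
  have [_ /(_ s)[e1 _]] := HG p0.
  have e2 : (Psi s p0).2 = trajectory Phi (p0.1 + s).
    rewrite (ode_unique M0 dv bv (is_derive_trajectory HF) (is_derive_trajectory HG) (t0 := p0.1)).
      by rewrite /trajectory addrAC subrr add0r.
    by rewrite !trajectory_start.
  have e3 : p0.1 + s - p0.1 = s by rewrite addrAC subrr add0r.
  split; first by rewrite [X in `|X - _|]e1 e3.
  move: hle; rewrite enorm_le// => hle; apply: le_trans hle.
  rewrite /sqdist le_eqVlt; apply/orP; left; apply/eqP; apply: eq_bigr => i _.
  by rewrite [X in trajectory _ X]e1 -e2 mxE [X in X ^+ _]addrAC subrr add0r.
exists Phi; split => //; exists (p.1 - p0.1), (p.2 - trajectory Phi p.1); split => //.
  rewrite enorm_le//; apply: le_trans h2; rewrite le_eqVlt; apply/orP; left; apply/eqP.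
  by apply: eq_bigr => i _; rewrite !mxE.
by rewrite (flow_trajectory p.1 HF) /= subrKC -surjective_pairing.
Qed.

End FlowCylinder.

(** * The solution operator, its support and its estimates *)

Section Solution.
Context {R : realType} {d : nat}.
Local Notation ST := (R * 'rV[R]_d)%type.
Local Notation bndF k C mu f := (bndC (setT : set (R * ST)) k C mu (fun _ => f)).
Hypothesis d0 : (0 < d)%N.

Variables (h : R -> R) (K : R) (L : nat).
Hypothesis K0 : 0 < K.
Hypothesis Hh : smooth1_bnd K L.+3 h.
Hypothesis h0 : forall x, d%:R^-1 <= `|x| -> h x = 0.
Hypothesis h1 : forall x, `|x| <= 1 -> int1 (- 3) 3 (fun q => h (x + q)) = 1.

Variables (v : vfield R d) (X : R -> 'rV[R]_d) (rho t0 tau : R).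
Hypothesis r0 : 0 < rho.
Hypothesis Hv : forall l, spatialC L.+1 (vcomp v l).
Hypothesis HX : forall (t : R) k,
  is_derive t (1 : R) (fun r => X r 0 k) (v (t, X t) 0 k).

Definition symdiv_op (U : vfield R d) : tfield R d :=
  fun p => \matrix_(j, k) symdiv_inv X rho (profile rho h) U j k p.

Lemma tcomp_symdiv_op U j k :
  tcomp (symdiv_op U) j k = symdiv_inv X rho (profile rho h) U j k.
Proof. by apply/funext => p; rewrite /tcomp mxE. Qed.

Let HE : bndF L.+3 (K ^+ d) (d%:R * rho^-1) (profile rho h) := profile_bndF r0 K0 Hh.
Let cX : continuous X := X_continuous HX.

Let E_sqdist p : comove X (profile rho h) p != 0 -> sqdist X p <= rho ^+ 2.
Proof. exact: profile_support. Qed.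

Let dE_sqdist l p : comove X (pdx l (profile rho h)) p != 0 -> sqdist X p <= rho ^+ 2.
Proof. exact: (dprofile_support r0 cX d0 K0 Hh h0). Qed.

Let E_tube p : comove X (profile rho h) p != 0 -> tube X rho p.
Proof. by move=> /E_sqdist; exact: sqdist_tube. Qed.

Let dE_tube l p : comove X (pdx l (profile rho h)) p != 0 -> tube X rho p.
Proof. by move=> /dE_sqdist; exact: sqdist_tube. Qed.

Lemma symdiv_op_linear (a : R) (U W : vfield R d) p :
  (forall l, advectedC v L.+1 (vcomp U l)) -> (forall l, advectedC v L.+1 (vcomp W l)) ->
  symdiv_op (fun q => a *: U q + W q) p = a *: symdiv_op U p + symdiv_op W p.
Proof.
move=> HU HW; apply/matrixP => j k; rewrite !mxE.
exact: (symdiv_inv_linear rho HX HE a j k p HU HW).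
Qed.

Variable U : vfield R d.
Hypothesis aU : forall l, advectedC v L.+1 (vcomp U l).
Hypothesis U_cyl : forall p, U p != 0 -> cylinder X rho t0 tau p.

Let Ul_cyl l p : vcomp U l p != 0 -> cylinder X rho t0 tau p.
Proof. by move=> n; apply: U_cyl; apply: contra n => /eqP e; rewrite /vcomp e mxE. Qed.

Let U_tube l p : vcomp U l p != 0 -> tube X rho p.
Proof. by move=> /Ul_cyl[_ /(sqdist_tube r0)]. Qed.

Lemma symdiv_op_advected j k : advectedC v L.+1 (tcomp (symdiv_op U) j k).
Proof. by rewrite tcomp_symdiv_op; exact: (symdiv_inv_advected rho Hv HX HE aU). Qed.

Lemma symdiv_op_outside j k p : ~ cylinder X rho t0 tau p -> tcomp (symdiv_op U) j k p = 0.
Proof.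
move=> np; rewrite tcomp_symdiv_op /symdiv_inv big1 => [|l _].
  by rewrite (segment_avg_support false _ (@Ul_cyl k) E_sqdist np) !mulr0 subrr.
exact: (segment_avg_support true _ (@Ul_cyl l) (@dE_sqdist l) np).
Qed.

Lemma symdiv_op_supp j k : supp (tcomp (symdiv_op U) j k) `<=` cylinder X rho t0 tau.
Proof.
move=> p /(@closure_subset _ _ (cylinder X rho t0 tau)) H.
apply: (cylinder_closed cX); apply: H => q /= qn.
by apply: contrapT => nq; move: qn; rewrite symdiv_op_outside// eqxx.
Qed.

Section Momenta.
Hypothesis U_linear : zero_linear_momentum U.
Hypothesis U_angular : zero_angular_momentum U.

Lemma symdiv_op_sym p j k : symdiv_op U p j k = symdiv_op U p k j.
Proof.
by rewrite !mxE (symdiv_inv_sym r0 E_tube aU U_tube U_linear U_angular).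
Qed.

Lemma symdiv_op_div p k : \sum_j pdx j (tcomp (symdiv_op U) j k) p = U p 0 k.
Proof.
under eq_bigr => j _ do rewrite tcomp_symdiv_op.
exact: (symdiv_invP r0 HX HE E_tube dE_tube (fun p => profile_mass r0 Hh h1 (p := p))
  aU U_tube U_linear U_angular).
Qed.

End Momenta.

Variables (A Lam : R).
Hypothesis A0 : 0 <= A.
Hypothesis Lam0 : 0 < Lam.
Hypothesis HU : forall l, bndF L.+1 A Lam (vcomp U l).

Let d1 : 1 <= d%:R :> R. Proof. by rewrite ler1n. Qed.
Let Ri : 0 < rho^-1. Proof. by rewrite invr_gt0. Qed.
Let mu_rho : rho * (d%:R * rho^-1) <= d%:R.
Proof. by rewrite mulrCA divff ?mulr1// gt_eqF. Qed.
Let B0 : 0 <= K ^+ d. Proof. by rewrite exprn_ge0// ltW. Qed.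
Let mu0 : 0 <= d%:R * rho^-1. Proof. by rewrite mulr_ge0// ltW. Qed.

Lemma symdiv_const_ge0 : 0 <= symdiv_const (d := d) (K ^+ d).
Proof. by rewrite /symdiv_const !mulr_ge0// ?exprn_ge0 ?(ltW K0)// addr_ge0// mulr_ge0. Qed.

Lemma symdiv_op_bound j k (b : {ffun 'I_d -> nat}) p : (mlen b <= L.+1)%N ->
  `|nabla b (tcomp (symdiv_op U) j k) p| <=
  symdiv_const (d := d) (K ^+ d) * (2 * d%:R) ^+ L.+1 * A * rho *
    \sum_(0 <= m < (mlen b).+1) rho ^- (mlen b - m) * Lam ^+ m.
Proof.
move=> bL; rewrite tcomp_symdiv_op.
have H := symdiv_inv_bound r0 HX HE B0 mu0 mu_rho A0 (ltW Lam0) HU j k.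
apply: le_trans (bndC_nabla bL H (th := 0) (p := p) I) _.
set S := \sum_(_ <= _ < _) _.
have [S1 S2] := @pow_le_sum2 R rho Lam (mlen b) r0 Lam0; rewrite -/S in S1 S2.
have S0 : 0 <= S by apply: le_trans S2; rewrite exprn_ge0// ltW.
have dm1 : 1 <= d%:R ^+ mlen b :> R by exact: exprn_ege1.
have -> : symdiv_const (d := d) (K ^+ d) * (2 * d%:R) ^+ L.+1 * A * rho * S =
  symdiv_const (d := d) (K ^+ d) * A * rho * ((2 * d%:R) ^+ L.+1 * S) by ring.
apply: ler_wpM2l; first by rewrite !mulr_ge0 ?symdiv_const_ge0// ltW.
(* The rate is [Lam + d / rho]: splitting the power costs [2^m], and extracting [d] costs [d^m]. *)
apply: (@le_trans _ _ ((2 * d%:R) ^+ mlen b * S)); last first.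
  by apply: ler_wpM2r => //; apply: ler_weXn2l => //; rewrite mulr_ege1// ler1n.
rewrite exprMn -mulrA; apply: powD_le; rewrite ?(ltW Lam0)//.
  by apply: le_trans S2 _; rewrite ler_peMl.
by rewrite exprMn ler_wpM2l// exprn_ge0.
Qed.

Variables (Xi ev tauh : R).
Hypothesis Xi0 : 0 < Xi.
Hypothesis ev0 : 0 < ev.
Hypothesis tauh0 : 0 < tauh.
Hypothesis tauh_le : tauh <= Xi^-1 * (Num.sqrt ev)^-1.
Hypothesis Hgrad : forall i l, bndF L (A * Num.sqrt ev * Xi) Xi (pdx i (vcomp v l)).
Hypothesis HDU : forall l, bndF L (A * tauh^-1) Lam (Dt v (vcomp U l)).

Lemma symdiv_op_Dt_bound j k (b : {ffun 'I_d -> nat}) p : (mlen b <= L)%N ->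
  `|nabla b (Dt v (tcomp (symdiv_op U) j k)) p| <=
  symdiv_const (d := d) (K ^+ d) * (1 + A * comm_const (d := d)) * (3 * (d%:R + 1)) ^+ L *
    A * tauh^-1 * rho *
    \sum_(m0 < (mlen b).+1) \sum_(m1 < (mlen b).+1)
      \sum_(m2 < (mlen b).+1 | (m0 + m1 + m2 == mlen b)%N)
        Xi ^+ m0 * rho ^- m1 * Lam ^+ m2.
Proof.
move=> bL; set S := \sum_(_ < _) _.
have S0 : Xi ^+ mlen b <= S.
  by have := @pow_le_sum3 R Xi rho Lam (mlen b) ord_max ord0 ord0 Xi0 r0 Lam0;
    rewrite /= !expr0 invr1 !mulr1 !addn0; apply.
have S1 : rho^-1 ^+ mlen b <= S.
  by have := @pow_le_sum3 R Xi rho Lam (mlen b) ord0 ord_max ord0 Xi0 r0 Lam0;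
    rewrite /= !expr0 mulr1 mul1r !addn0 exprVn; apply.
have S2 : Lam ^+ mlen b <= S.
  by have := @pow_le_sum3 R Xi rho Lam (mlen b) ord0 ord0 ord_max Xi0 r0 Lam0;
    rewrite /= !expr0 invr1 !mul1r; apply.
have Sp : 0 <= S by apply: le_trans S2; rewrite exprn_ge0// ltW.
have ti0 : 0 < tauh^-1 by rewrite invr_gt0.
have comm0 : 0 <= comm_const (d := d) :> R.
  by rewrite mulr_ge0// !addr_ge0// !mulr_ge0.
have c0 : 0 <= symdiv_const (d := d) (K ^+ d) * (1 + A * comm_const (d := d)) * A * tauh^-1 * rho.
  by rewrite !mulr_ge0 ?symdiv_const_ge0 ?addr_ge0 ?mulr_ge0// ltW.
(* Off the tube the kernel estimate is silent, but there [R] vanishes on the open complement of the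
   cylinder, and with it all its derivatives. *)
have [Tp|nT] := pselect (tube X rho p); last first.
  have np : ~ cylinder X rho t0 tau p by move=> [_ /(sqdist_tube r0)].
  rewrite (@nabla_zero_open _ _ (~` cylinder X rho t0 tau)) ?normr0//.
  - rewrite (_ : _ * A * tauh^-1 * rho * S = symdiv_const (d := d) (K ^+ d) *
      (1 + A * comm_const (d := d)) * A * tauh^-1 * rho * ((3 * (d%:R + 1)) ^+ L * S)); last by ring.
    by rewrite mulr_ge0// mulr_ge0// exprn_ge0// mulr_ge0// addr_ge0.
  - exact/closed_openC/cylinder_closed.
  move=> q nq; have oC : open (~` cylinder X rho t0 tau) by exact/closed_openC/cylinder_closed.
  have z u : 'D_u (tcomp (symdiv_op U) j k : ST -> R) q = 0.
    by have [_ ->] := derive_zero_open u oC (fun q => @symdiv_op_outside j k q) nq.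
  rewrite /Dt [pdt _ _]z add0r big1// => i _; rewrite [pdx _ _ _]z mulr0//.
rewrite tcomp_symdiv_op.
have M0 : 0 <= A * Num.sqrt ev * Xi by rewrite !mulr_ge0 ?sqrtr_ge0// ltW.
have H := symdiv_inv_Dt_bound r0 Hv HX M0 (ltW Xi0) Hgrad HE E_tube dE_tube B0 mu0 mu_rho aU
   A0 (mulr_ge0 A0 (ltW ti0)) (ltW Lam0) HU HDU U_tube j k.
apply: le_trans (bndC_nabla bL H (th := 0) (p := p) Tp) _.
have evs : 0 < Num.sqrt ev by rewrite sqrtr_gt0.
(* Here the upper bound on [tauh] enters: the gradient of [v], hence the commutator, is no faster
   than [tauh^-1]. *)
have Mt : Num.sqrt ev * Xi <= tauh^-1.
  by rewrite -[leLHS]invrK lef_pV2 ?posrE ?invr_gt0 ?mulr_gt0// invfM mulrC.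
have Q : A / tauh + A * (A * Num.sqrt ev * Xi) * comm_const (d := d) <=
    (1 + A * comm_const (d := d)) * A * tauh^-1.
  have -> : (1 + A * comm_const (d := d)) * A * tauh^-1 =
    A / tauh + A * A * comm_const (d := d) * tauh^-1 by ring.
  have -> : A * (A * Num.sqrt ev * Xi) * comm_const (d := d) =
    A * A * comm_const (d := d) * (Num.sqrt ev * Xi) by ring.
  by rewrite lerD2l ler_wpM2l// !mulr_ge0.
have lam0 : 0 <= Lam + Xi + rho^-1 + d%:R * rho^-1.
  by rewrite !addr_ge0// ltW.
apply: (@le_trans _ _ (symdiv_const (d := d) (K ^+ d) * ((1 + A * comm_const (d := d)) * A * tauh^-1) * rho *
  ((3 * (d%:R + 1)) ^+ L * S))); last by rewrite le_eqVlt; apply/orP; left; apply/eqP; ring.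
apply: ler_pM.
- by rewrite !mulr_ge0 ?symdiv_const_ge0 ?addr_ge0 ?mulr_ge0// ltW.
- exact: exprn_ge0.
- by apply: ler_wpM2r; [exact: ltW|apply: ler_wpM2l => //; exact: symdiv_const_ge0].
have d1' : 1 <= d%:R + 1 :> R by rewrite lerDr.
have dm1 : 1 <= (d%:R + 1) ^+ mlen b :> R by exact: exprn_ege1.
apply: (@le_trans _ _ ((3 * (d%:R + 1)) ^+ mlen b * S)); last first.
  by apply: ler_wpM2r => //; apply: ler_weXn2l => //; rewrite mulr_ege1// ler1n.
rewrite exprMn -mulrA.
(* The bump contributes [d / rho] and the drift [1 / rho]. *)
have -> : Lam + Xi + rho^-1 + d%:R * rho^-1 = Lam + Xi + (d%:R + 1) * rho^-1 by ring.
apply: pow3D_le; rewrite ?(ltW Lam0) ?(ltW Xi0)//.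
- by rewrite mulr_ge0// ?ltW// addr_ge0.
- by apply: le_trans S2 _; rewrite ler_peMl.
- by apply: le_trans S0 _; rewrite ler_peMl.
by rewrite exprMn ler_wpM2l// exprn_ge0// addr_ge0.
Qed.

End Solution.

(** * From sup norms of multi-index derivatives to graded bounds, and the zero field *)

Section Fields.
Context {R : realType} {d : nat}.
Local Notation ST := (R * 'rV[R]_d)%type.
Local Notation bndF k C mu f := (bndC (setT : set (R * ST)) k C mu (fun _ => f)).

Lemma bndF_of_vC0norm (V : vfield R d) (C mu : R) k :
  (forall l, spatialC k (vcomp V l)) ->
  (forall b : {ffun 'I_d -> nat}, (mlen b <= k)%N ->
     (vC0norm (vnabla b V) <= (C * mu ^+ mlen b)%:E)%E) ->
  forall l, bndF k C mu (vcomp V l).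
Proof.
move=> HV bV l.
have := @bndC_of_nabla R d R [::] k C mu (vcomp V l) (HV l); rewrite mulr1; apply.
move=> b /andP[_ bk] p.
by have := vC0norm_coord_le (bV b bk) l p; rewrite mxE.
Qed.

Lemma bndF_pdx_of_vC0norm (V : vfield R d) (C mu : R) k :
  (forall l, spatialC k.+1 (vcomp V l)) ->
  (forall b : {ffun 'I_d -> nat}, (1 <= mlen b <= k.+1)%N ->
     (vC0norm (vnabla b V) <= (C * mu ^+ mlen b)%:E)%E) ->
  forall i l, bndF k (C * mu) mu (pdx i (vcomp V l)).
Proof.
move=> HV bV i l.
apply: (@bndC_of_nabla R d R [:: i] k C mu (vcomp V l) (HV l)) => b bk p.
by have := vC0norm_coord_le (bV b bk) l p; rewrite mxE.
Qed.

Lemma tcomp0 j l : tcomp (fun=> 0 : 'M[R]_d) j l = (fun=> 0) :> (ST -> R).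
Proof. by apply/funext => p; rewrite /tcomp mxE. Qed.

Lemma nabla0 (b : {ffun 'I_d -> nat}) (p : ST) : nabla b (fun=> 0 : R) p = 0.
Proof. exact: (nabla_zero_open b openT). Qed.

Lemma Dt0 (v : vfield R d) : Dt v (fun=> 0 : R) = (fun=> 0).
Proof.
apply/funext => p; rewrite /Dt /pdt derive_cst add0r big1// => i _.
by rewrite /pdx derive_cst mulr0.
Qed.

Lemma advectedC0 (v : vfield R d) k : advectedC v k (fun=> 0 : R).
Proof.
have z n : spatialC n ((fun=> 0) : ST -> R).
  exact: (bndC_spatialC 0 (reg_param n (@cst_continuous R _ (0 : R)))).
split; rewrite ?Dt0//.
Qed.

End Fields.

Theorem theorem11p1 (R : realType) (d L : nat) (A : R) :
  (2 <= d)%N -> (1 <= L)%N -> 0 < A ->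
  exists C2 C3 : R, 0 < C2 /\ 0 < C3 /\
  forall (N Xi ev : R) (v : vfield R d) (p0 : spacetime R d) (rho tau : R),
    0 < N -> 0 < Xi -> 0 < ev ->
    (forall l : 'I_d, spatialC L (vcomp v l)) ->
    (forall b : {ffun 'I_d -> nat}, (1 <= mlen b <= L)%N ->
       (vC0norm (vnabla b v) <= (A * Xi ^+ mlen b * Num.sqrt ev)%:E)%E) ->
    0 < rho -> 0 < tau -> tau <= Xi^-1 * (Num.sqrt ev)^-1 ->
    exists op : vfield R d -> tfield R d,
      linear_on (admissible_source v L tau rho p0) op /\
      forall (U : vfield R d) (Lam tauh : R),
        admissible_source v L tau rho p0 U ->
        0 < Lam -> 0 < tauh -> tauh <= Xi^-1 * (Num.sqrt ev)^-1 ->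
        (forall b : {ffun 'I_d -> nat}, (mlen b <= L)%N ->
           (vC0norm (vnabla b U) <= (A * Lam ^+ mlen b)%:E)%E) ->
        (forall b : {ffun 'I_d -> nat}, (mlen b <= L.-1)%N ->
           (vC0norm (vnabla b (vDt v U))
              <= (A * tauh^-1 * Lam ^+ mlen b)%:E)%E) ->
        [/\ (forall j l : 'I_d, advectedC v L (tcomp (op U) j l)) /\
            (forall (p : spacetime R d) (j l : 'I_d), op U p j l = op U p l j),
            forall (p : spacetime R d) (l : 'I_d),
              \sum_(j < d) pdx j (tcomp (op U) j l) p = U p 0 l,
            forall j l : 'I_d,
              supp (tcomp (op U) j l) `<=` flow_cylinder v tau rho p0,
            forall (j l : 'I_d) (b : {ffun 'I_d -> nat}), (mlen b <= L)%N ->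
              (C0norm (nabla b (tcomp (op U) j l))
                 <= (C2 * A * rho *
                     \sum_(0 <= m < (mlen b).+1)
                        rho ^- (mlen b - m) * Lam ^+ m)%:E)%E
          & forall (j l : 'I_d) (b : {ffun 'I_d -> nat}), (mlen b <= L.-1)%N ->
              (C0norm (nabla b (Dt v (tcomp (op U) j l)))
                 <= (C3 * A * tauh^-1 * rho *
                     \sum_(m0 < (mlen b).+1) \sum_(m1 < (mlen b).+1)
                       \sum_(m2 < (mlen b).+1 | (m0 + m1 + m2 == mlen b)%N)
                         Xi ^+ m0 * rho ^- m1 * Lam ^+ m2)%:E)%E].
Proof.
(* With [L] written [L'.+1], the gradient of [v] and the advective derivatives are controlled to
   order [L'], as in the sections above. *)
move=> d2 + A0; case: L => [//|L'] _.
have d0 : (0 < d)%N := ltnW d2.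
have dR : 0 < d%:R :> R by rewrite ltr0n.
(* Of the [L'.+3] orders, two are spent on [d_l phi] and on its gradient in the advective
   derivative; [L'.+1] remain. *)
have [h [K [K0 Hh h0 h1]]] := @bump_exists R L'.+3 d%:R^-1
  ltac:(by rewrite invr_gt0) ltac:(by rewrite invf_le1// ler1n).
have B0 : 0 < K ^+ d := exprn_gt0 d K0.
have sc0 : 0 < symdiv_const (d := d) (K ^+ d).
  by rewrite /symdiv_const !mulr_gt0// ?exprn_gt0// ltr_wpDl// mulr_ge0.
have cc0 : 0 <= comm_const (d := d) :> R.
  by rewrite mulr_ge0// !addr_ge0// !mulr_ge0.
(* The bump, hence both constants, is fixed before [v], [rho] and [U]. The second constant involves
   [A] because the commutator is quadratic: one [A] from [U], another from the gradient of [v]. *)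
exists (symdiv_const (d := d) (K ^+ d) * (2 * d%:R) ^+ L'.+1).
exists (symdiv_const (d := d) (K ^+ d) * (1 + A * comm_const (d := d)) * (3 * (d%:R + 1)) ^+ L').
split; first by rewrite mulr_gt0// exprn_gt0// mulr_gt0.
split.
  apply: mulr_gt0; last by rewrite exprn_gt0// mulr_gt0// ltr_wpDl.
  by rewrite mulr_gt0// ltr_pwDl// mulr_ge0// ltW.
move=> N Xi ev v p0 rho tau _ Xi0 ev0 Hv bv r0 tau0 _.
have evs : 0 < Num.sqrt ev by rewrite sqrtr_gt0.
have Hgrad : forall i l, bndC (setT : set (R * (R * 'rV[R]_d))) L' (A * Num.sqrt ev * Xi) Xi
    (fun=> pdx i (vcomp v l)).
  by apply: bndF_pdx_of_vC0norm => // b /bv; rewrite mulrAC.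
have M0 : 0 <= A * Num.sqrt ev * Xi by rewrite !mulr_ge0// ltW.
have U_in U : admissible_source v L'.+1 tau rho p0 U ->
    forall p, U p != 0 -> flow_cylinder v tau rho p0 p.
  by move=> [_ _ _ sU] p Up; apply: sU; exact: subset_closure.
have [[Phi HF]|noflow] := pselect (exists Phi, is_flow v Phi); last first.
  have cyl0 p : ~ flow_cylinder v tau rho p0 p.
    by move=> [Phi [HF _]]; apply: noflow; exists Phi.
  exists (fun _ _ => 0); split.
    by move=> a U W _ _ p; rewrite scaler0 addr0.
  move=> U Lam tauh /U_in U_cyl Lam0 tauh0 _ _ _; split.
  - by split => [j l|p j l]; rewrite ?tcomp0 ?mxE//; exact: advectedC0.
  - move=> p l; have /eqP -> : U p == 0.
      by apply: contrapT => /negP /U_cyl; exact: cyl0.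
    rewrite mxE big1// => j _; rewrite tcomp0; exact: derive_cst.
  - move=> j l p; rewrite tcomp0 /supp.
    have -> : [set p : R * 'rV[R]_d | (0 : R) != 0] = set0.
      by rewrite -subset0 => q /=; rewrite eqxx.
    by rewrite closure0.
  - move=> j l b _; rewrite tcomp0; apply: C0norm_le => p; rewrite nabla0 normr0.
    rewrite mulr_ge0//; first by rewrite !mulr_ge0// ?exprn_ge0// ?mulr_ge0// ltW.
    by apply: sumr_ge0 => m _; rewrite mulr_ge0 ?invr_ge0 ?exprn_ge0// ltW.
  move=> j l b _; rewrite tcomp0 Dt0; apply: C0norm_le => p; rewrite nabla0 normr0.
  rewrite mulr_ge0//.
    rewrite !mulr_ge0 ?exprn_ge0// ?invr_ge0 ?addr_ge0 ?mulr_ge0// ?addr_ge0 ?(ltW sc0) ?(ltW A0)//; exact: ltW.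
  do 3 (apply: sumr_ge0 => ? _).
  by rewrite !mulr_ge0 ?invr_ge0 ?exprn_ge0// ltW.
pose X := trajectory p0 Phi.
have HX := is_derive_trajectory p0 HF.
have cylE : flow_cylinder v tau rho p0 = cylinder X rho p0.1 tau.
  apply: (flow_cylinderE p0 tau HF M0 r0) => l i p.
    by case: (Hv l) => _ /(_ i)[].
  exact: (bndC_bnd (Hgrad i l) (z := (0, p)) I).
(* The operator is built from the trajectory, [rho] and the bump alone, so one choice serves every
   [U], [Lam] and [tauh]. *)
exists (symdiv_op h X rho); split.
  move=> a U W [aU _ _ _] [aW _ _ _] p.
  exact: (symdiv_op_linear K0 Hh r0 HX a p aU aW).
move=> U Lam tauh HU Lam0 tauh0 tauh_le bU bDU.
have U_cyl p : U p != 0 -> cylinder X rho p0.1 tau p by rewrite -cylE; exact: U_in.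
have [aU U_lin U_ang _] := HU.
have nU : forall l, bndC (setT : set (R * (R * 'rV[R]_d))) L'.+1 A Lam (fun=> vcomp U l).
  by apply: bndF_of_vC0norm => // l; case: (aU l).
have nDU l : bndC (setT : set (R * (R * 'rV[R]_d))) L' (A * tauh^-1) Lam (fun=> Dt v (vcomp U l)).
  have e m : vcomp (vDt v U) m = Dt v (vcomp U m).
    by apply/funext => p; rewrite /vcomp mxE.
  rewrite -e; apply: bndF_of_vC0norm => // m; rewrite e; by case: (aU m).
rewrite cylE; split.
- split => [j l|p j l]; first exact: (symdiv_op_advected K0 Hh r0 Hv HX aU).
  exact: (symdiv_op_sym d0 h0 r0 aU U_cyl U_lin U_ang).
- exact: (symdiv_op_div d0 K0 Hh h0 h1 r0 HX aU U_cyl U_lin U_ang).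
- exact: (symdiv_op_supp d0 K0 Hh h0 r0 HX U_cyl).
- move=> j l b bL; apply: C0norm_le => p.
  exact: (symdiv_op_bound d0 K0 Hh r0 HX (ltW A0) Lam0 nU).
move=> j l b bL; apply: C0norm_le => p.
exact: (symdiv_op_Dt_bound d0 K0 Hh h0 r0 Hv HX aU U_cyl (ltW A0) Lam0 nU Xi0 ev0 tauh0 tauh_le Hgrad nDU).
Qed.
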